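(* Let $\mathcal{M}=(M,g)$ be the germ at a point $P$ of a Riemannian manifold of dimension $m\ge2$, and let $\psi$ be a smooth nowhere vanishing real function of one variable. If $\mathcal{M}$ is centrally harmonic about $P$, then the radial conformal deformation $\mathcal{M}_\psi:=(M,\psi(r_P^2)^{-2}g)$ is centrally harmonic about $P$ as well.
   Context: Let $r_P(Q)$ denote the geodesic distance from $P$ to $Q$ with respect to the given metric. A function $f$ is radial about $P$ if $f(Q)=\check f(r_P(Q))$ for some function $\check f$ of a single variable. Let $\Delta^0_{\mathcal{M}}$ be the Laplace-Beltrami operator on functions and let $\iota_P$ be the injectivity radius at $P$. $\mathcal{M}$ is said to be centrally harmonic about $P$ if there exists a non-constant radial function $f$ (about $P$, smooth away from $P$ and permitted to be singular at $P$) with $\Delta^0_{\mathcal{M}}f=0$ for $0<r_P<\iota_P$. For germs, $M$ is regarded as a small geodesic ball about $P$ and the equation is required for all sufficiently small $r_P>0$. In $\mathcal{M}_\psi$, the function $r_P$ appearing in the conformal factor $\psi(r_P^2)^{-2}$ is the distance for the original metric $g$, and $\psi$ is assumed to be defined on an interval containing the relevant values of $r_P^2$ (including $0$); whether $\mathcal{M}_\psi$ is centrally harmonic is tested using its own geodesic distance function from $P$ and its own Laplacian. *)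

(* Defs.v *)
From HB Require Import structures.
From mathcomp Require Import all_boot all_order all_algebra.
From mathcomp Require Import all_classical all_reals all_analysis.

Set Implicit Arguments.
Unset Strict Implicit.
Unset Printing Implicit Defensive.
Import Order.TTheory GRing.Theory Num.Theory numFieldNormedType.Exports.
Local Open Scope classical_set_scope.
Local Open Scope ring_scope.

(* The germ of a Riemannian manifold at a point is given in a coordinate       *)
(* chart: a connected open set U of R^m containing the point P, with the       *)
(* matrix g of the metric tensor in these coordinates. Vectors are row         *)
(* vectors; functions are total and only their values on U matter.             *)

Definition partial (R : realType) (m : nat) (i : 'I_m) (f : 'rV[R]_m -> R) :
  'rV[R]_m -> R := fun x => 'D_('e_i) f x.

(* C^oo on A (meant for A open): all iterated partial derivatives of all       *)
(* orders are differentiable at the points of A.                               *)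
Definition smooth_on (R : realType) (m : nat) (A : set 'rV[R]_m)
    (f : 'rV[R]_m -> R) : Prop :=
  forall (s : seq 'I_m) (x : 'rV[R]_m), A x ->
    differentiable (foldr (@partial R m) f s) x.

Definition smooth_fun_on (R : realType) (A : set R) (psi : R -> R) : Prop :=
  forall (n : nat) (t : R), A t -> derivable (derive1n n psi) t 1.

Record riemannian_germ (R : realType) (m : nat) (U : set 'rV[R]_m)
    (P : 'rV[R]_m) (g : 'rV[R]_m -> 'M[R]_m) : Prop := RiemannianGerm {
  germ_open : open U;
  germ_connected : connected U;
  germ_center : U P;
  metric_smooth : forall i j : 'I_m, smooth_on U (fun x => g x i j);
  metric_sym : forall x, U x -> (g x)^T = g x;
  metric_posdef : forall x, U x -> forall v : 'rV[R]_m, v != 0 ->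
    0 < (v *m g x *m v^T) 0 0
}.

Definition C1 (R : realType) (m : nat) (c : R -> 'rV[R]_m) : Prop :=
  (forall t, derivable c t 1) /\ continuous (derive1 c).

(* C^1 on a closed subinterval, including at its end points, is expressed by   *)
(* the existence of a C^1 extension to the whole line.                         *)
Definition piecewise_C1 (R : realType) (m : nat) (a b : R)
    (c : R -> 'rV[R]_m) : Prop :=
  exists2 s : seq R, itv_partition a b s &
    forall k : nat, (k < size s)%N ->
      exists2 e : R -> 'rV[R]_m, C1 e &
        forall t, nth b (a :: s) k <= t <= nth b s k -> c t = e t.

(* The derivative of c may fail to exist at the finitely many break points,    *)
(* a Lebesgue-null set.                                                        *)
Definition curve_length (R : realType) (m : nat) (g : 'rV[R]_m -> 'M[R]_m)
    (a b : R) (c : R -> 'rV[R]_m) : R :=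
  \int[lebesgue_measure]_(t in `[a, b])
    Num.sqrt ((derive1 c t *m g (c t) *m (derive1 c t)^T) 0 0).

Definition geodesic_distance (R : realType) (m : nat) (U : set 'rV[R]_m)
    (g : 'rV[R]_m -> 'M[R]_m) (P Q : 'rV[R]_m) : R :=
  inf [set L | exists (a b : R) (c : R -> 'rV[R]_m),
    [/\ piecewise_C1 a b c, c a = P, c b = Q,
        forall t, a <= t <= b -> U (c t) & L = curve_length g a b c]].

(* sum_ij (det g)^(-1/2) d_i ((det g)^(1/2) g^ij d_j f)                        *)
Definition laplace_beltrami (R : realType) (m : nat) (g : 'rV[R]_m -> 'M[R]_m)
    (f : 'rV[R]_m -> R) (x : 'rV[R]_m) : R :=
  (Num.sqrt (\det (g x)))^-1 *
  \sum_(i < m) \sum_(j < m)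
    partial i (fun y => Num.sqrt (\det (g y)) * invmx (g y) i j *
                        partial j f y) x.

Definition punctured_ball (R : realType) (m : nat) (U : set 'rV[R]_m)
    (P : 'rV[R]_m) (g : 'rV[R]_m -> 'M[R]_m) (eps : R) : set 'rV[R]_m :=
  [set x | U x /\ 0 < geodesic_distance U g P x < eps].

Definition radial_on (R : realType) (m : nat) (U : set 'rV[R]_m)
    (P : 'rV[R]_m) (g : 'rV[R]_m -> 'M[R]_m) (A : set 'rV[R]_m)
    (f : 'rV[R]_m -> R) : Prop :=
  exists F : R -> R, forall x, A x -> f x = F (geodesic_distance U g P x).

(* Non-constancy is that of the germ of f at P: f is not constant on any       *)
(* punctured geodesic ball about P, however small.                             *)
Definition centrally_harmonic (R : realType) (m : nat) (U : set 'rV[R]_m)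
    (P : 'rV[R]_m) (g : 'rV[R]_m -> 'M[R]_m) : Prop :=
  exists (f : 'rV[R]_m -> R) (eps : R),
    [/\ 0 < eps,
        smooth_on (punctured_ball U P g eps) f,
        radial_on U P g (punctured_ball U P g eps) f,
        forall x, punctured_ball U P g eps x -> laplace_beltrami g f x = 0 &
        forall delta, 0 < delta ->
          ~ exists k : R, forall x, punctured_ball U P g delta x -> f x = k].

(* psi(r_P^2)^(-2) g, with r_P the distance of the original metric g           *)
Definition radial_conformal (R : realType) (m : nat) (U : set 'rV[R]_m)
    (P : 'rV[R]_m) (psi : R -> R) (g : 'rV[R]_m -> 'M[R]_m) :
    'rV[R]_m -> 'M[R]_m :=
  fun x => (psi (geodesic_distance U g P x ^+ 2)) ^- 2 *: g x.

(* Main.v *)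
Require Import Defs.
From HB Require Import structures.
From mathcomp Require Import all_boot all_order all_algebra.
From mathcomp Require Import all_classical all_reals all_analysis.
From mathcomp Require Import ring lra.

(* Let r be the distance to P and f = F(r) a non-constant radial harmonic function. If f has no
   critical point near P, then dr = +-df / |df|, so r is smooth there. The conformal metric
   phi(r)^2 g, with phi(s) = |psi(s^2)|^(-1), has distance function h(r) with h' = phi. Its
   Laplacian annihilates u as soon as du = phi(r)^(2 - m) df, because
   sqrt(det g) g^(-1) is multiplied by phi^(m - 2). With kap = phi^(2 - m) this is solved by
   u = kap(r) f - K(r), K' = kap' F, which is radial for the new metric.

   No Gauss lemma or exponential map is used: r is merely continuous with local slope at most
   one, and every point near P is joined to P by curves of length close to r. It remains to
   exclude critical points.
   - If |df| = 0 at one point of a sphere r = s then |df| = 0 on the whole sphere: F is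
     differentiable with |F'(s)| = |df| as soon as df does not vanish at a point of the sphere,
     while F is left Lipschitz at s with constant any number above |df|.
   - If all spheres of radius below some s are critical, then F is constant there, which
     non-constancy of the germ forbids.
   - Otherwise there is a critical radius c with noncritical radii just below. Then F is
     strictly monotone below c, so f - F(c) has a strict sign inside r < c. A small Euclidean
     ball inside touches the sphere r = c at a point where df = 0, which contradicts Hopf's
     boundary point lemma. *)
Import Order.TTheory GRing.Theory Num.Theory numFieldNormedType.Exports.
Local Open Scope classical_set_scope.
Local Open Scope ring_scope.

Set Implicit Arguments.
Unset Strict Implicit.
Unset Printing Implicit Defensive.

(** * Positive definite matrices *)

(** The obstacle is that [r] is only given as an infimum of lengths, so its regularity has to be
    extracted from [f]. Let [N] be the length of [df] and [N x > 0]. Moving from [x] along the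
    gradient line by a small length [t] changes [f] by about [N x * t] and [r] by at most about [t].
    Since [f = F(r)] is strictly monotone on this line, so is [r], and the line meets all radii near
    [r x]: the increments of [F] are at least about [N x] times those of the radius. Almost shortest
    curves, along which [f] changes by at most about [N x] times the length, give the same bound
    from above. Hence [F' = +-N], and comparing the two first-order expansions of [f], in [y] and in
    [r y], differentiates [r].

    Lengths are never differentiated almost everywhere. A piecewise C^1 curve has a right derivative
    at every parameter but the last, and a Dini criterion turns pointwise bounds on right
    derivatives into bounds on lengths; it also compares the old and the new length along one
    curve. *)

Definition qf (R : realType) (m : nat) (A : 'M[R]_m) (v w : 'rV[R]_m) : R :=
  (v *m A *m w^T) 0 0.

Definition posdef (R : realType) (m : nat) (A : 'M[R]_m) : Prop :=
  A^T = A /\ forall v : 'rV[R]_m, v != 0 -> 0 < qf A v v.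

Section QuadraticForms.
Context {R : realType}.

Lemma qf_ge0 m (A : 'M[R]_m) v : posdef A -> 0 <= qf A v v.
Proof.
move=> [_ pA]; have [->|/pA/ltW//] := eqVneq v 0.
by rewrite /qf !mul0mx mxE.
Qed.

(** The Euclidean product is needed beside the norm of row vectors, which is the sup norm: the balls
    of Hopf's lemma have to be round. *)
Lemma qf1E m (v w : 'rV[R]_m) : qf 1%:M v w = \sum_i v 0 i * w 0 i.
Proof. by rewrite /qf mulmx1 mxE; apply: eq_bigr => i _; rewrite !mxE. Qed.

Lemma qfE m (A : 'M[R]_m) v w :
  qf A v w = \sum_i \sum_j v 0 i * A i j * w 0 j.
Proof.
rewrite /qf -mulmxA mxE; apply: eq_bigr => i _.
by rewrite mxE big_distrr /=; apply: eq_bigr => j _; rewrite !mxE mulrA.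
Qed.

Lemma qf1_ge0 m (v : 'rV[R]_m) : 0 <= qf 1%:M v v.
Proof. by rewrite qf1E; apply: sumr_ge0 => i _; rewrite -expr2 sqr_ge0. Qed.

Lemma qf1_gt0 m (v : 'rV[R]_m) : v != 0 -> 0 < qf 1%:M v v.
Proof.
move=> v0; rewrite lt0r qf1_ge0 andbT qf1E; apply: contraNneq v0 => /eqP.
rewrite psumr_eq0 => [/allP v0|i _]; last by rewrite -expr2 sqr_ge0.
apply/eqP/rowP => i; rewrite mxE; apply/eqP.
by have := v0 i; rewrite mem_index_enum -expr2 sqrf_eq0 => /(_ isT).
Qed.

Lemma qfDl m (A : 'M[R]_m) u v w : qf A (u + v) w = qf A u w + qf A v w.
Proof. by rewrite /qf !mulmxDl mxE. Qed.

Lemma qfZl m (A : 'M[R]_m) k v w : qf A (k *: v) w = k * qf A v w.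
Proof. by rewrite /qf -!scalemxAl mxE. Qed.

Lemma qfDr m (A : 'M[R]_m) u v w : qf A u (v + w) = qf A u v + qf A u w.
Proof. by rewrite /qf linearD mulmxDr mxE. Qed.

Lemma qfZr m (A : 'M[R]_m) k v w : qf A v (k *: w) = k * qf A v w.
Proof. by rewrite /qf linearZ -scalemxAr mxE. Qed.

Lemma qfZ m (A : 'M[R]_m) k v w : qf (k *: A) v w = k * qf A v w.
Proof. by rewrite /qf -scalemxAr -scalemxAl mxE. Qed.

Lemma qfDm m (A B : 'M[R]_m) v w : qf (A + B) v w = qf A v w + qf B v w.
Proof. by rewrite /qf mulmxDr mulmxDl mxE. Qed.

Lemma qf0l m (A : 'M[R]_m) w : qf A 0 w = 0.
Proof. by rewrite /qf !mul0mx mxE. Qed.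

Lemma qfC m (A : 'M[R]_m) v w : A^T = A -> qf A v w = qf A w v.
Proof.
move=> AT; rewrite /qf.
have -> : v *m A *m w^T = (w *m A *m v^T)^T.
  by rewrite !trmx_mul AT trmxK mulmxA.
by rewrite mxE.
Qed.

Lemma qf_block m (a : R) (b : 'rV[R]_m) (D : 'M[R]_m) t v :
  qf (block_mx a%:M b b^T D) (row_mx t%:M v) (row_mx t%:M v) =
  a * t ^+ 2 + 2 * t * qf 1%:M b v + qf D v v.
Proof.
rewrite /qf tr_row_mx mul_row_block mul_row_col.
have vb : v *m b^T = (qf 1%:M b v)%:M.
  rewrite [LHS]mx11_scalar /qf mulmx1; congr (_%:M).
  by rewrite -[v *m b^T]trmxK trmx_mul trmxK mxE.
have bv : b *m v^T = (qf 1%:M b v)%:M.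
  by rewrite [LHS]mx11_scalar /qf mulmx1.
rewrite mulmx1 vb [(t%:M *m b + _) *m _]mulmxDl -mulmxA bv tr_scalar_mx.
rewrite -!scalar_mxM -raddfD /= -scalar_mxM.
by rewrite !mxE !eqxx !mulr1n; ring.
Qed.

(* Induction on the size, splitting off the first row by a Schur complement. *)
Lemma posdef_factor m (A : 'M[R]_m) : posdef A ->
  exists2 C : 'M[R]_m, C \in unitmx & A = C^T *m C.
Proof.
elim: m A => [|m IH] A [AT pA].
  exists 1%:M; first by rewrite unitmx1.
  by apply/matrixP => -[].
pose B : 'M[R]_(1 + m) := A.
pose a := ulsubmx B 0 0; pose b := ursubmx B; pose D := drsubmx B.
have Bb : B = block_mx a%:M b b^T D.
  rewrite -[LHS]submxK -(mx11_scalar (ulsubmx B)); congr (block_mx _ _ _ _).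
  by rewrite /b trmx_ursub [B^T]AT.
have DT : D^T = D by rewrite /D trmx_drsub [B^T]AT.
have qB (t : R) (v : 'rV[R]_m) : qf A (row_mx t%:M v : 'rV[R]_(1 + m))
    (row_mx t%:M v : 'rV[R]_(1 + m)) =
    a * t ^+ 2 + 2 * t * qf 1%:M b v + qf D v v by rewrite -qf_block -Bb.
have a_gt0 : 0 < a.
  have := pA (row_mx 1%:M 0 : 'rV[R]_(1 + m)).
  rewrite qB [qf _ b 0]qfC ?trmx1// !qf0l expr1n mulr1 mulr0 !addr0; apply.
  apply/negP => /eqP/(congr1 (fun M : 'rV[R]_(1 + m) => M 0 (lshift m 0))).
  by rewrite row_mxEl !mxE eqxx => /eqP; rewrite oner_eq0.
have a_neq0 : a != 0 by rewrite gt_eqF.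
pose D' := D - a^-1 *: (b^T *m b).
have [|C' C'u D'E] := IH D'.
  split=> [|v v0].
    by rewrite /D' linearB /= linearZ /= trmx_mul trmxK DT.
  (* Completing the square: the first coordinate chosen here minimises [qf A] over all vectors with
     remaining coordinates [v], and the minimum is [qf D' v v]. *)
  have -> : qf D' v v = qf A
      (row_mx (- a^-1 * qf 1%:M b v)%:M v : 'rV[R]_(1 + m))
      (row_mx (- a^-1 * qf 1%:M b v)%:M v : 'rV[R]_(1 + m)).
    have -> : qf D' v v = qf D v v - a^-1 * qf 1%:M b v ^+ 2.
      rewrite /qf /D' mulmxBr mulmxBl -scalemxAr -scalemxAl mxE; congr (_ + _).
      rewrite 2!mxE mulmxA -(mulmxA _ b) mxE big_ord1; congr (- (_ * _)).
      rewrite expr2 mulmx1; congr (_ * _).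
      by rewrite -[v *m b^T]trmxK trmx_mul trmxK mxE.
    by rewrite qB; field.
  apply: pA; apply: contraNneq v0 => /(congr1 (rsubmx : 'rV[R]_(1 + m) -> _)).
  by rewrite row_mxKr => ->; apply/eqP/rowP => i; rewrite !mxE.
pose s : R := Num.sqrt a.
  have s0 : s != 0 by rewrite gt_eqF// sqrtr_gt0.
  have ss : s * s = a by rewrite -expr2 sqr_sqrtr// ltW.
  pose C : 'M[R]_(1 + m) := block_mx s%:M (s^-1 *: b) 0 C'.
have Cu : C \in unitmx.
  rewrite unitmxE det_ublock unitrM -!unitmxE C'u andbT.
  by rewrite unitmxE det_scalar expr1 unitfE.
have BE : B = C^T *m C.
  rewrite {1}Bb /C tr_block_mx mulmx_block.
  rewrite !trmx0 !mul0mx !addr0 mulmx0 addr0 tr_scalar_mx -scalar_mxM ss.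
  rewrite mul_scalar_mx scalerA mulfV// scale1r linearZ /= -scalemxAl.
  rewrite mul_mx_scalar scalerA mulVf// scale1r.
  congr block_mx; rewrite -D'E /D' -scalemxAl -scalemxAr scalerA -invfM ss.
  by rewrite addrC subrK.
by exists C.
Qed.

Lemma posdef_det m (A : 'M[R]_m) : posdef A -> 0 < \det A.
Proof.
move=> /posdef_factor[C Cu ->]; rewrite det_mulmx det_tr -expr2.
by rewrite exprn_even_gt0//= -unitfE -unitmxE.
Qed.

Lemma posdef_unit m (A : 'M[R]_m) : posdef A -> A \in unitmx.
Proof. by move=> /posdef_det; rewrite unitmxE unitfE; case: ltgtP. Qed.

Lemma posdef_inv m (A : 'M[R]_m) : posdef A -> posdef (invmx A).
Proof.
move=> pA; have Au := posdef_unit pA; have [AT pos] := pA.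
have iAT : (invmx A)^T = invmx A by rewrite trmx_inv AT.
split=> // v v0; have := pos (v *m invmx A).
rewrite /qf trmx_mul iAT mulmxKV// mulmxA; apply.
apply: contraNneq v0 => /(congr1 (mulmx^~ A)).
by rewrite mulmxKV// mul0mx => ->.
Qed.

Lemma posdef_CauchySchwarz m (A : 'M[R]_m) v w : posdef A ->
  qf A v w <= Num.sqrt (qf A v v) * Num.sqrt (qf A w w).
Proof.
move=> pA; have [AT pos] := pA.
rewrite -sqrtrM ?qf_ge0//.
apply: le_trans (ler_norm _) _; rewrite -sqrtr_sqr ler_wsqrtr//.
have [->|w0] := eqVneq w 0; first by rewrite -![qf A _ 0]qfC// !qf0l mulr0 expr0n.
have ww := pos _ w0.
(* This vector is [qf A w w] times the part of [v] orthogonal to [w]; its square is [qf A w w] times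
   the difference to be estimated. *)
have := qf_ge0 (qf A w w *: v + (- qf A v w) *: w) pA.
rewrite !(qfDl, qfDr, qfZl, qfZr) (qfC w v AT) => h.
rewrite -subr_ge0 -(pmulr_rge0 _ ww).
by apply: le_trans h _; rewrite le_eqVlt; apply/orP; left; apply/eqP; ring.
Qed.

(** Writing [A = C^T C] turns the sum into values of [H] on the rows of [C]. It is applied to a
    Hessian at an interior minimum. *)
Lemma posdef_trace m (A H : 'M[R]_m) : posdef A ->
  (forall v, 0 <= qf H v v) -> 0 <= \sum_i \sum_j A i j * H i j.
Proof.
move=> /posdef_factor[C _ ->] H0.
suff -> : \sum_i \sum_j (C^T *m C) i j * H i j = \sum_k qf H (row k C) (row k C).
  exact: sumr_ge0.
under [RHS]eq_bigr do rewrite qfE.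
rewrite [RHS]exchange_big /=; apply: eq_bigr => i _.
rewrite [RHS]exchange_big /=; apply: eq_bigr => j _.
rewrite mxE big_distrl /=; apply: eq_bigr => k _.
by rewrite !mxE mulrAC.
Qed.

End QuadraticForms.

(** * One-sided derivatives *)

Definition cts (R : realType) (V : topologicalType) (a b : R) (G : R -> V) :=
  forall t, a <= t <= b -> G u @[u --> within `[a, b] (nbhs t)] --> G t.

(** One-sided, so that break points of a piecewise C^1 curve are not exceptional. *)
Definition rderiv (R : realType) (V : normedModType R) (G : R -> V) (t : R)
  (v : V) := h^-1 *: (G (t + h) - G t) @[h --> 0^'+] --> v.

Section OneVariable.
Context {R : realType}.

Lemma cvg_near_eq (T : Type) (W : topologicalType) (F : set_system T)
    (f g : T -> W) (l : W) : Filter F ->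
  (\forall x \near F, f x = g x) -> f @ F --> l -> g @ F --> l.
Proof. by move=> FF fg; apply: cvg_trans; exact: near_eq_cvg. Qed.

(** For a small slope [e'], the parameters at which [G] lies above the line of slope [- e'] through
    [(a, G a)] contain their supremum by continuity, and the right-hand bound moves past any
    supremum below [b]. *)
Lemma dini_le (G : R -> R) a b : a <= b -> cts a b G ->
  (forall t, a <= t < b -> forall e, 0 < e ->
     \forall h \near 0^'+, - e * h <= G (t + h) - G t) ->
  G a <= G b.
Proof.
move=> ab cG dG; apply/ler_addgt0Pr => e e0.
(* The summand 1 covers the case [a = b]. *)
rewrite -lerBlDr; pose e' := e / (b - a + 1).
have ba1 : 0 < b - a + 1 by rewrite ltr_wpDl// subr_ge0.
have e'0 : 0 < e' by rewrite divr_gt0.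
pose S := [set t | a <= t <= b /\ G a - e' * (t - a) <= G t].
have Sa : S a by split; rewrite ?lexx ?ab// subrr mulr0 subr0.
have ubS : ubound S b by move=> t [/andP[]].
have supS : has_sup S by split; [exists a|exists b].
pose s := sup S.
have as_ : a <= s by exact: (ub_le_sup supS.2).
have sb : s <= b by apply: ge_sup => //; exists a.
have Ss : S s.
  split; first by rewrite as_ sb.
  rewrite leNgt; apply/negP => sG.
  have cs : G u + e' * (u - a) @[u --> within `[a, b] (nbhs s)] -->
      G s + e' * (s - a).
    apply: cvgD; first by apply: cG; rewrite as_ sb.
    apply: cvgM; first exact: cvg_cst.
    by apply: cvgB; [exact: cvg_within|exact: cvg_cst].
  have /cvgr_lt/(_ (G a)) := cs; rewrite -ltrBrDr => /(_ sG).
  rewrite near_withinE => -[/= d d0 dS].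
  have [t [tab Gt] st] := sup_adherent d0 supS.
  have ts : t <= s by exact: (ub_le_sup supS.2).
  have /= := dS t; rewrite in_itv/= tab -/s ger0_norm ?subr_ge0//.
  rewrite -/s in st; rewrite ltrBlDr -ltrBlDl => /(_ ltac:(lra) isT).
  by rewrite ltNge -lerBlDr Gt.
have [sb'|] := ltP s b; last first.
  move=> bs; have sbE : s = b by apply/le_anti; rewrite sb bs.
  case: Ss => _; rewrite sbE; apply: le_trans.
  rewrite lerD2l lerN2 /e' mulrAC ler_pdivrMr// ler_pM2l//.
  by rewrite lerDl.
have [h [h0 hb hG]] : exists h, [/\ 0 < h, s + h <= b & - e' * h <= G (s + h) - G s].
  have := dG s; rewrite as_ sb' => /(_ isT _ e'0) ds.
  near (0 : R)^'+ => h; exists h; split; last by near: h.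
    by near: h; exact: nbhs_right_gt.
  rewrite -lerBrDl; near: h; apply: nbhs_right_le; rewrite subr_gt0//.
suff : s + h <= s by rewrite gerDl leNgt h0.
apply: (ub_le_sup supS.2); split.
  by rewrite hb andbT; clear -as_ h0; lra.
by case: Ss => _; clear -hG; lra.
Unshelve. all: by end_near. Qed.

Lemma dini_rderiv (G : R -> R) a b : a <= b -> cts a b G ->
  (forall t, a <= t < b -> exists2 l, 0 <= l & rderiv G t l) -> G a <= G b.
Proof.
move=> ab cG dG; apply: dini_le => // t /dG[l l0 Gl] e e0.
have /cvgr_gt/(_ (- e)) := Gl; rewrite (lt_le_trans _ l0) ?oppr_lt0// => /(_ isT).
move=> H; near=> h; have h0 : 0 < h by near: h; exact: nbhs_right_gt.
have : - e < h^-1 * (G (t + h) - G t) by near: h.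
by rewrite mulrC ltr_pdivlMr// => /ltW.
Unshelve. all: by end_near. Qed.

Lemma rderiv_unique (V : normedModType R) (G : R -> V) t u v :
  rderiv G t u -> rderiv G t v -> u = v.
Proof. exact: cvg_unique. Qed.

Lemma rderivD (V : normedModType R) (F G : R -> V) t u v :
  rderiv F t u -> rderiv G t v -> rderiv (fun x => F x + G x) t (u + v).
Proof.
rewrite /rderiv => Fu Gv; apply: cvg_near_eq (cvgD Fu Gv).
by near=> h; rewrite fctE /= -scalerDr addrACA opprD.
Unshelve. all: by end_near. Qed.

Lemma rderivZ (V : normedModType R) (F : R -> V) t k u :
  rderiv F t u -> rderiv (fun x => k *: F x) t (k *: u).
Proof.
rewrite /rderiv => Fu; apply: cvg_near_eq (cvgZ (cvg_cst k) Fu).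
by near=> h; rewrite /= -scalerBr !scalerA mulrC.
Unshelve. all: by end_near. Qed.

Lemma rderivN (V : normedModType R) (F : R -> V) t u :
  rderiv F t u -> rderiv (fun x => - F x) t (- u).
Proof.
move=> Fu; have := rderivZ (k := -1) Fu; rewrite scaleN1r.
by under [X in rderiv X]funext do rewrite scaleN1r.
Qed.

Lemma rderivB (V : normedModType R) (F G : R -> V) t u v :
  rderiv F t u -> rderiv G t v -> rderiv (fun x => F x - G x) t (u - v).
Proof. by move=> Fu Gv; apply: rderivD => //; exact: rderivN. Qed.

Lemma rderiv_cvg (V : normedModType R) (G : R -> V) t u : rderiv G t u ->
  G (t + h) @[h --> 0^'+] --> G t.
Proof.
move=> Gu; rewrite -[X in _ --> X](subrK (G t)) subrr.
have -> : (0 : V) = (0 : R) *: u by rewrite scale0r.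
have : h *: (h^-1 *: (G (t + h) - G t)) + G t @[h --> 0^'+] --> 0 *: u + G t.
  apply: cvgD; last exact: cvg_cst.
  by apply: cvgZ => //; exact: cvg_within.
apply: cvg_near_eq; near=> h.
by rewrite scalerA mulfV ?scale1r ?subrK.
Unshelve. all: by end_near. Qed.

Lemma is_derive_rderiv (V : normedModType R) (G : R -> V) (t : R) v :
  is_derive t 1 G v -> rderiv G t v.
Proof.
move=> [dG <-]; apply: cvg_dnbhs_at_right; rewrite /derive.
have := dG; rewrite /derivable => /cvg_ex[l dl].
rewrite (cvg_lim (@norm_hausdorff _ _) dl); move: dl.
apply: cvg_near_eq; near=> h.
by rewrite /= [h *: 1]mulr1 (addrC t).
Unshelve. all: by end_near. Qed.

Lemma diff_eps (V W : normedModType R) (f : V -> W) x : differentiable f x ->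
  forall e, 0 < e ->
  \forall y \near x, `|f y - f x - 'd f x (y - x)| <= e * `|y - x|.
Proof.
move=> /diff_locallyP[_ /eqaddoP fE] e /fE; rewrite [in X in _ -> X](near_shift 0 x).
by rewrite subr0; apply: filterS => h; rewrite /= addrK !fctE /= opprD addrA.
Qed.

Lemma eps_diff (V W : normedModType R) (f : V -> W) x (L : {linear V -> W}) :
  continuous L ->
  (forall e, 0 < e ->
    \forall y \near x, `|f y - f x - L (y - x)| <= e * `|y - x|) ->
  differentiable f x /\ 'd f x = L :> (V -> W).
Proof.
move=> cL H.
have fE : f \o shift x = cst (f x) + L +o_ 0 id.
  apply/eqaddoP => e /H; rewrite [in X in X -> _](near_shift 0 x).
  by rewrite subr0; apply: filterS => h; rewrite /= addrK !fctE /= opprD addrA.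
have dE := diff_unique cL fE; split=> //.
by apply/diff_locallyP; rewrite dE.
Qed.

Lemma rderiv_comp (V W : normedModType R) (f : V -> W) (c : R -> V) t v :
  differentiable f (c t) -> rderiv c t v -> rderiv (f \o c) t ('d f (c t) v).
Proof.
move=> df cv; have cc := rderiv_cvg cv.
rewrite /rderiv.
have H1 : 'd f (c t) (h^-1 *: (c (t + h) - c t)) @[h --> 0^'+] -->
  'd f (c t) v.
  by apply: cvg_comp cv _; apply: diff_continuous.
have H2 : h^-1 *: ((f \o c) (t + h) - (f \o c) t) -
   'd f (c t) (h^-1 *: (c (t + h) - c t)) @[h --> 0^'+] --> 0.
  apply/cvgrPdist_le => e e0.
  pose e' := e / (`|v| + 1).
  have e'0 : 0 < e' by rewrite divr_gt0// ltr_wpDl.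
  have Q1 := cc _ (diff_eps df e'0).
  have Q2 : \forall h \near 0^'+, `|h^-1 *: (c (t + h) - c t)| <= `|v| + 1.
    have /cvgrPdist_le/(_ 1 ltr01) := cv; apply: filterS => h.
    rewrite distrC => vh; rewrite -lerBlDl; apply: le_trans vh.
    exact: lerB_dist.
  near=> h; have h0 : 0 < h by near: h; exact: nbhs_right_gt.
  rewrite sub0r normrN linearZ /= -scalerBr normrZ.
  have : `|f (c (t + h)) - f (c t) - 'd f (c t) (c (t + h) - c t)| <=
     e' * `|c (t + h) - c t| by near: h.
  have : `|h^-1 *: (c (t + h) - c t)| <= `|v| + 1 by near: h.
  rewrite normrZ gtr0_norm ?invr_gt0// => q1 q2.
  apply: le_trans (_ : h^-1 * (e' * `|c (t + h) - c t|) <= _).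
    by rewrite ler_pM2l ?invr_gt0.
  rewrite mulrCA; apply: le_trans (_ : e' * (`|v| + 1) <= _).
    by rewrite ler_pM2l.
  by rewrite /e' divfK// gt_eqF// ltr_wpDl.
rewrite -[X in _ --> X]add0r; apply: cvg_near_eq (cvgD H2 H1).
by near=> h; rewrite fctE /= subrK.
Unshelve. all: by end_near. Qed.

Lemma antiderivative (J : set R) (q : R -> R) : open J -> is_interval J ->
  (forall s, J s -> {for s, continuous q}) ->
  exists K : R -> R, forall s, J s -> is_derive s 1 K (q s).
Proof.
move=> oJ iJ cq; have [[s0 Js0]|/set0P/negP/negPn/eqP->] := pselect (J !=set0); last first.
  by exists (cst 0).
pose I a b := \int[lebesgue_measure]_(t in `[a, b]) q t.
(* A segment with its ends reversed is empty and has integral 0, hence the explicit sign. *)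
exists (fun s => if s0 <= s then I s0 s else - I s s0) => s Js.
have out u : J u -> exists2 d, 0 < d & J (u - d) /\ J (u + d).
  move=> Ju; have /nbhs_ballP[e /= e0 eJ] := open_nbhs_nbhs (conj oJ Ju).
  exists (e / 2); first by rewrite divr_gt0.
  by split; apply: eJ; rewrite /ball/= ?subKr ?opprD ?addNKr ?normrN gtr0_norm; lra.
(* With [s] and [s0] both inside [[a, b]], the two cases become the single expression
   [I a x - I a s0], to which the fundamental theorem applies. *)
have [a [b [[as_ as0 Ja] [sb s0b Jb]]]] : exists a b,
    [/\ a < s, a < s0 & J a] /\ [/\ s < b, s0 < b & J b].
  have [d d0 [Jl Ju]] := out _ Js; have [d' d0' [Jl' Ju']] := out _ Js0.
  have [ss0|ss0] := leP s s0.
    by exists (s - d), (s0 + d'); split; split=> //; lra.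
  by exists (s0 - d'), (s + d); split; split=> //; lra.
have Jab t : a <= t <= b -> J t by move=> /andP[at_ tb]; apply: (iJ a b) => //; apply/andP.
have intq u v : a <= u -> v <= b ->
    lebesgue_measure.-integrable `[u, v] (EFin \o q).
  move=> au vb; apply: continuous_compact_integrable; first exact: segment_compact.
  apply: continuous_in_subspaceT => t; rewrite inE/= in_itv/= => /andP[ut tv].
  by apply: cq; apply: Jab; rewrite (le_trans au ut) (le_trans tv vb).
have IB x y : a <= x -> x <= y -> y <= b -> I a y - I a x = I x y.
  move=> ax xy yb; rewrite /I Rintegral_itvB ?bnd_simp//; last exact: intq.
  rewrite Rintegral_itv_obnd_cbnd//.
  by apply: integrableS (intq x b ax _) => //; apply: subset_itv; rewrite bnd_simp.
have [dI Iq] := continuous_FTC1_closed sb (intq a b (lexx _) (lexx _)) as_ (cq _ Js).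
have dI' : is_derive s 1 (fun x => I a x - I a s0) (q s).
  rewrite -[q s]subr0 -Iq derive1E; apply: is_deriveB; exact/derivableP.
apply: near_eq_is_derive dI'; near=> x.
have ax : a <= x by near: x; apply: filterS (lt_nbhsr as_) => ? /ltW.
have xb : x <= b by near: x; exact: lt_le_nbhsl.
case: leP => xs0; first by rewrite (IB _ _ (ltW as0) xs0 xb).
by rewrite -(IB _ _ ax (ltW xs0) (ltW s0b)) opprB.
Unshelve. all: by end_near. Qed.

End OneVariable.

(** * Curves and their length *)

Definition cont_at (R : realType) (m : nat) (G : 'rV[R]_m -> 'M[R]_m)
  (x : 'rV[R]_m) := forall i j, {for x, continuous (fun y => G y i j)}.

(** The curves of [piecewise_C1] in a form that allows induction on the pieces; the equivalence is
    [piecewise_C1P]. *)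
Inductive pw (R : realType) (m : nat) (c : R -> 'rV[R]_m) : R -> R -> Prop :=
| pw_nil a : pw c a a
| pw_cons a x b e : a < x -> C1 e -> (forall t, a <= t <= x -> c t = e t) ->
    pw c x b -> pw c a b.

Definition speed (R : realType) (m : nat) (G : 'rV[R]_m -> 'M[R]_m)
    (c : R -> 'rV[R]_m) (t : R) : R :=
  Num.sqrt (qf (G (c t)) (derive1 c t) (derive1 c t)).

Section Length.
Context {R : realType} {m : nat}.
Implicit Types (c e : R -> 'rV[R]_m) (G : 'rV[R]_m -> 'M[R]_m).

Lemma derivable_cvg (V : normedModType R) (e : R -> V) (t : R) :
  derivable e t 1 -> e u @[u --> t] --> e t.
Proof.
by move=> de; apply: differentiable_continuous; apply/derivable1_diffP.
Qed.

Lemma piecewise_C1P a b c : piecewise_C1 a b c <-> pw c a b.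
Proof.
split.
  move=> [s]; elim: s a => [|x s IH] a [/= ps lb] H.
    by rewrite -(eqP lb); exact: pw_nil.
  have /andP[ax xs] := ps.
  have [e Ce ce] := H 0%N isT.
  apply: (pw_cons ax Ce ce); apply: IH; first by split.
  by move=> k ks; apply: (H k.+1 ks).
elim=> {a b} [a|a x b e ax Ce ce _ [s [ps /eqP ls] H]].
  by exists [::] => //; split => //=.
exists (x :: s); first by split; rewrite /= ?ax ?ps ?ls.
case=> [_|k ks]; first by exists e.
exact: (H k ks).
Qed.

Lemma pw_le c a b : pw c a b -> a <= b.
Proof. by elim=> // {}a x {}b e /ltW ax _ _ _; exact: le_trans. Qed.

Lemma pw_ext c c' a b : pw c a b -> (forall t, a <= t <= b -> c t = c' t) ->
  pw c' a b.
Proof.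
elim=> {a b} [a|a x b e ax Ce ce cxb IH] cc'; first exact: pw_nil.
have xb := pw_le cxb.
apply: (pw_cons ax Ce) => [t /andP[at_ tx]|].
  by rewrite -cc' ?at_ ?(le_trans tx)// ce// at_.
by apply: IH => t /andP[xt tb]; rewrite cc'// tb (le_trans (ltW ax)).
Qed.

Lemma pw_cat c a b d : pw c a b -> pw c b d -> pw c a d.
Proof. elim=> // {}a x {}b e ax Ce ce _ IH /IH; exact: pw_cons ax Ce ce. Qed.

Lemma pw_right c a b t : pw c a b -> a <= t < b ->
  exists e d, [/\ C1 e, t < d <= b & forall u, t <= u <= d -> c u = e u].
Proof.
elim=> {a b} [a|a x b e ax Ce ce cxb IH] /andP[at_ tb].
  by have := le_lt_trans at_ tb; rewrite ltxx.
have [tx|xt] := ltP t x; last by apply: IH; rewrite xt.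
exists e, x; split=> //; first by rewrite tx (pw_le cxb).
by move=> u /andP[tu ux]; rewrite ce// ux (le_trans at_).
Qed.

Lemma pw_cts c a b : pw c a b -> cts a b c.
Proof.
elim=> {a b} [a|a x b e ax [de _] ce cxb IH] t /andP[at_ tb].
  apply: cvg_near_eq (cvg_cst (c t)); rewrite near_withinE; near=> u.
  rewrite /= in_itv/= => /le_anti <-; congr c.
  by apply/le_anti; rewrite at_ tb.
have ec : e u @[u --> t] --> e t.
  exact: derivable_cvg.
have xb := pw_le cxb.
apply/cvgrPdist_le => eps e0; rewrite near_withinE.
(* Each side of the break point [x] is treated separately: on the side containing [t] by continuity
   of that piece, on the other because a small neighbourhood of [t] misses it, unless [t = x]. *)
have H1 : t <= x -> \forall u \near t, a <= u <= x -> `|c t - c u| <= eps.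
  move=> tx; have /cvgrPdist_le/(_ _ e0) := ec.
  apply: filterS => u H /ce ->; by rewrite ce// at_ tx.
have H2 : x <= t -> \forall u \near t, x <= u <= b -> `|c t - c u| <= eps.
  move=> xt; have := IH t; rewrite xt tb => /(_ isT).
  move=> /cvgrPdist_le/(_ _ e0); rewrite near_withinE.
  by apply: filterS => u; rewrite /= in_itv.
have H3 : t <= x -> \forall u \near t, x <= u <= b -> `|c t - c u| <= eps.
  rewrite le_eqVlt => /orP[/eqP tx|tx]; first by apply: H2; rewrite tx.
  by near=> u => /andP[]; rewrite leNgt; have -> : u < x by near: u; exact: lt_nbhsl.
have H4 : x <= t -> \forall u \near t, a <= u <= x -> `|c t - c u| <= eps.
  rewrite le_eqVlt => /orP[/eqP tx|tx]; first by apply: H1; rewrite tx.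
  by near=> u => /andP[_]; rewrite leNgt; have -> : x < u by near: u; exact: lt_nbhsr.
have [tx|/ltW xt] := leP t x.
  near=> u; rewrite /= in_itv/= => /andP[au ub]; have [ux|/ltW xu] := leP u x.
    by apply: (near (H1 tx) u) => //; rewrite au ux.
  by apply: (near (H3 tx) u) => //; rewrite xu ub.
near=> u; rewrite /= in_itv/= => /andP[au ub]; have [ux|/ltW xu] := leP u x.
  by apply: (near (H4 xt) u) => //; rewrite au ux.
by apply: (near (H2 xt) u) => //; rewrite xu ub.
Unshelve. all: by end_near. Qed.

Lemma cvg_coord (T : Type) (F : set_system T) {FF : Filter F} n k
    (v : T -> 'M[R]_(n, k)) (v0 : 'M[R]_(n, k)) i j :
  v x @[x --> F] --> v0 -> v x i j @[x --> F] --> v0 i j.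
Proof.
move=> cv; have cc : {for v0, continuous (fun M : 'M[R]_(n, k) => M i j)}.
  exact: coord_continuous.
exact: (cvg_comp v (fun M : 'M[R]_(n, k) => M i j) cv cc).
Qed.

Lemma cvg_qf (T : Type) (F : set_system T) {FF : Filter F}
    (A : T -> 'M[R]_m) (A0 : 'M[R]_m)
    (v w : T -> 'rV[R]_m) (v0 w0 : 'rV[R]_m) :
  (forall i j, A x i j @[x --> F] --> A0 i j) ->
  v x @[x --> F] --> v0 -> w x @[x --> F] --> w0 ->
  qf (A x) (v x) (w x) @[x --> F] --> qf A0 v0 w0.
Proof.
move=> cA cv cw; rewrite qfE.
under eq_fun do rewrite qfE.
apply: cvg_big => [|i _]; first exact: add_continuous.
apply: cvg_big => [|j _]; first exact: add_continuous.
by apply: cvgM; [apply: cvgM; [exact: cvg_coord|exact: cA]|exact: cvg_coord].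
Qed.

Lemma cvg_speed G e t : C1 e -> cont_at G (e t) ->
  speed G e u @[u --> t] --> speed G e t.
Proof.
move=> [de ce] cG; apply: (cvg_comp _ Num.sqrt) (@sqrt_continuous _ _).
apply: cvg_qf; [|exact: ce|exact: ce].
have ec := derivable_cvg (de t).
by move=> i j; exact: (cvg_comp e (fun y => G y i j) ec (cG i j)).
Qed.

Lemma speed_eq G c e a b t : (forall u, a <= u <= b -> c u = e u) ->
  a < t < b -> speed G c t = speed G e t.
Proof.
move=> ce /andP[at_ tb].
have ct : c t = e t by apply: ce; rewrite (ltW at_) (ltW tb).
rewrite /speed ct.
suff -> : derive1 c t = derive1 e t by [].
rewrite !derive1E; apply: near_eq_derive; near=> u; apply: ce.
apply/andP; split; first by apply: ltW; near: u; exact: lt_nbhsr.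
by near: u; exact: lt_le_nbhsl.
Unshelve. all: by end_near. Qed.

Lemma speed_ge0 G c t : 0 <= speed G c t.
Proof. exact: sqrtr_ge0. Qed.

Lemma speed_measurable_bounded G c a b : pw c a b ->
  (forall t, a <= t <= b -> cont_at G (c t)) ->
  measurable_fun `[a, b] (speed G c) /\
  exists M, forall t, a <= t <= b -> speed G c t <= M.
Proof.
elim=> {a b} [a|a x b e ax Ce ce cxb IH] cG.
  split; first by rewrite set_itv1; exact: measurable_fun_set1.
  by exists (speed G c a) => t /le_anti <-.
have xb := pw_le cxb.
have [|mxb [M HM]] := IH.
  by move=> t /andP[xt tb]; apply: cG; rewrite tb (le_trans (ltW ax) xt).
have qc : {within `[a, x], continuous (speed G e)}.
  apply: continuous_in_subspaceT => t; rewrite inE/= in_itv/= => atx.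
  apply: cvg_speed => //; rewrite -ce//; apply: cG.
  by case/andP: atx => -> tx; rewrite (le_trans tx xb).
(* Only on the open interval: at a break point [derive1 c] may be a default value. *)
have eqs t : t \in `]a, x[ -> speed G e t = speed G c t.
  by rewrite in_itv/= => atx; rewrite (speed_eq G ce atx).
split.
  have -> : `[a, b]%classic = `[a, x]%classic `|` `[x, b]%classic.
    apply/seteqP; split=> t; rewrite /= !in_itv/=.
      move=> /andP[at_ tb]; have [tx|/ltW xt] := leP t x; first by left; rewrite at_.
      by right; rewrite xt.
    case=> /andP[]; first by move=> -> tx; rewrite (le_trans tx xb).
    by move=> xt ->; rewrite (le_trans (ltW ax) xt).
  apply/measurable_funU => //; split=> //.
  apply/measurable_realfun.measurable_fun_itv_obnd_cbndP.
  apply/measurable_realfun.measurable_fun_itv_bndo_bndcP.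
  apply: (eq_measurable_fun (speed G e)); first by move=> t; rewrite inE; exact: eqs.
  have := continuous_compact_integrable (@segment_compact _ _ _) qc.
  move=> /integrableP[/measurable_realfun.measurable_EFinP + _].
  by apply: measurable_funS => //; exact: subset_itv_oo_cc.
have [t0 _ Ht0] := EVT_max (ltW ax) qc.
(* The value at [a] is listed separately because it need not be the speed of the first piece. *)
exists (Num.max (speed G e t0) (Num.max M (speed G c a))) => t /andP[at_ tb].
rewrite !le_max; have [xt|tx] := leP x t; first by rewrite HM ?xt// orbT.
have [ta|ta] := eqVneq t a.
  by apply/orP; right; apply/orP; right; rewrite ta (lexx (speed G c a)).
have at' : a < t by rewrite lt_neqAle eq_sym ta.
have := eqs t; rewrite in_itv/= at' tx => /(_ isT) <-.
by apply/orP; left; apply: Ht0; rewrite in_itv/= at_ (ltW tx).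
Qed.

Lemma speed_integrable G c a b : pw c a b ->
  (forall t, a <= t <= b -> cont_at G (c t)) ->
  lebesgue_measure.-integrable `[a, b] (EFin \o speed G c).
Proof.
move=> cab cG; have [mS [M HM]] := speed_measurable_bounded cab cG.
apply: measurable_bounded_integrable => //.
  rewrite /= lebesgue_measure_itv /=; case: ifP => // _.
  by rewrite -EFinB ltry.
exists M; split; first exact: num_real.
move=> y My t /=; rewrite in_itv/= => atb.
by rewrite ger0_norm ?speed_ge0// (le_trans (HM _ atb)) ?ltW.
Qed.

(** The quotient of [l] is the mean of the speed over []t, t + h[], where [c] agrees with a single
    C^1 curve for small [h]; so it tends to the speed of that curve at [t], even at a break
    point. *)
Lemma len_fun_ex G c a b : pw c a b ->
  (forall t, a <= t <= b -> cont_at G (c t)) ->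
  exists l : R -> R, [/\ l a = 0, l b = curve_length G a b c, cts a b l &
    forall t, a <= t < b -> forall v, rderiv c t v ->
      rderiv l t (Num.sqrt (qf (G (c t)) v v))].
Proof.
move=> cab cG; have ab := pw_le cab.
have iS := speed_integrable cab cG.
pose l t := \int[lebesgue_measure]_(u in `[a, t]) speed G c u.
exists l; split.
- by rewrite /l set_itv1 Rintegral_set1.
- by [].
- move=> t atb; have := parameterized_integral_continuous ab iS.
  by move=> /subspace_continuousP; apply; rewrite /= in_itv.
move=> t /andP[at_ tb] v cv.
have [|e [d [Ce /andP[td db] ce]]] := pw_right cab (t := t); first by rewrite at_.
have ct : c t = e t by apply: ce; rewrite lexx ltW.
have vE : v = derive1 e t.
  apply: rderiv_unique cv _.
  have [de _] := Ce; have /derivableP De := de t.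
  have := is_derive_rderiv De; rewrite -derive1E /rderiv.
  apply: cvg_near_eq; near=> h; rewrite ct ce//.
  have h0 : 0 < h by near: h; exact: nbhs_right_gt.
  rewrite lerDl (ltW h0) -lerBrDl; near: h; apply: nbhs_right_le.
  by rewrite subr_gt0.
have -> : Num.sqrt (qf (G (c t)) v v) = speed G e t by rewrite /speed vE ct.
have lE h : 0 < h -> t + h <= d -> l (t + h) - l t =
    \int[lebesgue_measure]_(u in `]t, t + h[) speed G c u.
  move=> h0 thd; have tth : t <= t + h by rewrite lerDl ltW.
  have ith : lebesgue_measure.-integrable `[a, t + h] (EFin \o speed G c).
    by apply: integrableS iS => //; apply: subset_itvl; rewrite bnd_simp (le_trans thd).
  rewrite /l Rintegral_itvB// ?bnd_simp// Rintegral_itv_bndo_bndc//.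
  by apply: integrableS ith => //; apply: subset_itv; rewrite bnd_simp.
have se : speed G e u @[u --> t] --> speed G e t.
  by apply: cvg_speed => //; rewrite -ct; apply: cG; rewrite at_ ltW.
rewrite /rderiv; apply/cvgrPdist_le => eps eps0.
have /cvgrPdist_le/(_ _ eps0)/nbhs_ballP[r /= r0 Hr] := se.
near=> h; have h0 : 0 < h by near: h; exact: nbhs_right_gt.
have hr : h < r by near: h; exact: nbhs_right_lt.
have thd : t + h <= d.
  by rewrite -lerBrDl; near: h; apply: nbhs_right_le; rewrite subr_gt0.
have sb u : `]t, t + h[%classic u -> `|speed G e t - speed G c u| <= eps.
  rewrite /= in_itv/= => /andP[tu uth].
  rewrite (speed_eq G ce); last by rewrite tu (lt_le_trans uth).
  by apply: Hr; rewrite /ball/= ltr0_norm; lra.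
have cI k : lebesgue_measure.-integrable `]t, t + h[ (EFin \o cst k).
  have H : lebesgue_measure.-integrable `[t, t + h] (EFin \o cst k).
    apply: continuous_compact_integrable; first exact: segment_compact.
    by apply: continuous_subspaceT; exact: cst_continuous.
  by apply: integrableS H => //; apply: subset_itv; rewrite bnd_simp.
have sI : lebesgue_measure.-integrable `]t, t + h[ (EFin \o speed G c).
  apply: integrableS iS => //; apply: subset_itv; rewrite bnd_simp//.
  exact: le_trans thd db.
have mh k : \int[lebesgue_measure]_(u in `]t, t + h[) cst k u = k * h.
  rewrite Rintegral_cst//= lebesgue_measure_itv/= lte_fin ltrDl h0.
  by rewrite -EFinB/= addrAC subrr add0r.
rewrite lE//; set X := Rintegral _ _ _.
have -> : h^-1 *: X = X / h by exact: mulrC.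
rewrite ler_distlC ler_pdivlMr// ler_pdivrMr// -!mh.
by apply/andP; split; apply: le_Rintegral => // u /sb; rewrite ler_distlC => /andP[].
Unshelve. all: by end_near. Qed.

End Length.

(** * Arc length *)

Definition joins (R : realType) (m : nat) (U : set 'rV[R]_m) (P Q : 'rV[R]_m)
    (a b : R) (c : R -> 'rV[R]_m) : Prop :=
  [/\ pw c a b, c a = P, c b = Q & forall t, a <= t <= b -> U (c t)].

Definition gnorm (R : realType) (m : nat) (A : 'M[R]_m) (v : 'rV[R]_m) : R :=
  Num.sqrt (qf A v v).

(* [l] is the arc length of [c] counted from the parameter [a]. *)
Definition arclength (R : realType) (m : nat) (G : 'rV[R]_m -> 'M[R]_m)
    (a b : R) (c : R -> 'rV[R]_m) (l : R -> R) : Prop :=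
  [/\ l a = 0, l b = curve_length G a b c, cts a b l &
    forall t, a <= t < b -> forall v, rderiv c t v ->
      rderiv l t (gnorm (G (c t)) v)].

Section Distance.
Context {R : realType} {m : nat}.
Implicit Types (c : R -> 'rV[R]_m) (G : 'rV[R]_m -> 'M[R]_m).
Implicit Types (U : set 'rV[R]_m) (P Q x y v w : 'rV[R]_m).

Lemma cvg_sumr (T : Type) (F : set_system T) {FF : Filter F} (I : Type)
    (r : seq I) (f : I -> T -> R) (l : I -> R) :
  (forall i, f i x @[x --> F] --> l i) ->
  \sum_(i <- r) f i x @[x --> F] --> \sum_(i <- r) l i.
Proof. by move=> fl; apply: cvg_big => //; exact: add_continuous. Qed.

Lemma ler_coord_norm v i : `|v 0 i| <= `|v|.
Proof.
rewrite [leRHS]mx_normrE.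
exact: (le_bigmax _ (fun ij : 'I_1 * 'I_m => `|v ij.1 ij.2|) (0, i)).
Qed.

Lemma qf_bound (A : 'M[R]_m) v w :
  `|qf A v w| <= (\sum_i \sum_j `|A i j|) * `|v| * `|w|.
Proof.
rewrite qfE (le_trans (ler_norm_sum _ _ _))// -mulrA mulr_suml ler_sum// => i _.
rewrite (le_trans (ler_norm_sum _ _ _))// mulr_suml ler_sum// => j _.
rewrite !normrM mulrAC mulrC ler_wpM2l//.
by apply: ler_pM => //; exact: ler_coord_norm.
Qed.

Lemma gnorm_ge0 (A : 'M[R]_m) v : 0 <= gnorm A v.
Proof. exact: sqrtr_ge0. Qed.

Lemma gnormZ (A : 'M[R]_m) k v : gnorm A (k *: v) = `|k| * gnorm A v.
Proof.
by rewrite /gnorm qfZl qfZr mulrA -expr2 sqrtrM ?sqr_ge0// sqrtr_sqr.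
Qed.

Lemma gnorm_perturb (A B : 'M[R]_m) (e : R) v : 0 < e ->
  \sum_i \sum_j `|(A - B) i j| < e ^+ 2 -> gnorm A v <= gnorm B v + e * `|v|.
Proof.
move=> e0 HAB; have q0 := qf_bound (A - B) v v.
have qE : qf A v v = qf B v v + qf (A - B) v v by rewrite -qfDm addrC subrK.
(* No positivity is assumed here: where the form is negative, the square root is 0. *)
have [q0'|q0'] := leP 0 (qf A v v); last first.
  by rewrite /gnorm (ler0_sqrtr (ltW q0')) addr_ge0 ?sqrtr_ge0 ?mulr_ge0// ltW.
rewrite -[leRHS]ger0_norm ?addr_ge0 ?gnorm_ge0 ?mulr_ge0 ?(ltW e0)//.
rewrite -sqrtr_sqr ler_wsqrtr// sqrrD.
have H : qf B v v <= gnorm B v ^+ 2.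
  rewrite /gnorm; have [h|/ltW h] := leP 0 (qf B v v); first by rewrite sqr_sqrtr.
  by rewrite (le_trans h)// sqr_ge0.
have H2 : qf (A - B) v v <= (e * `|v|) ^+ 2.
  apply: le_trans (ler_norm _) _; apply: le_trans q0 _.
  by rewrite exprMn -mulrA -expr2 ler_wpM2r ?sqr_ge0// ltW.
rewrite qE addrAC; apply: le_trans (lerD H H2) _.
by rewrite lerDl mulrn_wge0// mulr_ge0 ?gnorm_ge0// mulr_ge0// ltW.
Qed.

Lemma gnorm_near G x : cont_at G x -> forall e, 0 < e ->
  \forall z \near x, forall v, gnorm (G z) v <= gnorm (G x) v + e * `|v| /\
    gnorm (G x) v <= gnorm (G z) v + e * `|v|.
Proof.
move=> cG e e0.
have : \forall z \near x, \sum_i \sum_j `|(G z - G x) i j| < e ^+ 2.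
  have : \sum_i \sum_j `|(G z - G x) i j| @[z --> x] -->
     \sum_(i < m) \sum_(j < m) (0 : R).
    apply: (@cvg_sumr _ (nbhs x)) => i; apply: (@cvg_sumr _ (nbhs x)) => j.
    have : G z i j - G x i j @[z --> x] --> (0 : R).
      rewrite -[X in _ --> X](subrr (G x i j)).
      exact: (cvgB (cG i j) (cvg_cst (G x i j))).
    move=> /cvg_norm; rewrite normr0; apply: cvg_near_eq.
    by near=> z; rewrite !mxE.
  move=> /cvgr_lt; apply; rewrite big1 ?exprn_gt0// => i _; exact: big1.
apply: filterS => z Hz v; split; apply: gnorm_perturb => //.
apply: le_lt_trans Hz; rewrite le_eqVlt; apply/orP; left; apply/eqP.
by apply: eq_bigr => i _; apply: eq_bigr => j _; rewrite !mxE distrC.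
Unshelve. all: by end_near. Qed.

Lemma gnorm_le (A : 'M[R]_m) v :
  gnorm A v <= Num.sqrt (\sum_i \sum_j `|A i j|) * `|v|.
Proof.
rewrite /gnorm -[X in _ * X](ger0_norm (normr_ge0 v)) -sqrtr_sqr -sqrtrM; last first.
  by apply: sumr_ge0 => i _; apply: sumr_ge0.
by rewrite ler_wsqrtr// expr2 mulrA (le_trans (ler_norm _))// qf_bound.
Qed.

Lemma gnorm_cvg (T : Type) (F : set_system T) {FF : Filter F} (A : 'M[R]_m)
    (w : T -> 'rV[R]_m) v :
  w x @[x --> F] --> v -> gnorm A (w x) @[x --> F] --> gnorm A v.
Proof.
move=> cw; apply: (cvg_comp _ Num.sqrt) (@sqrt_continuous _ _).
by apply: cvg_qf => // i j; exact: cvg_cst.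
Qed.

(** [k] is the minimum of [gnorm A] on the compact unit sphere, or 1 when that sphere is empty, in
    dimension 0. *)
Lemma gnorm_gt0_lb (A : 'M[R]_m) : posdef A ->
  exists2 k, 0 < k & forall v, k * `|v| <= gnorm A v.
Proof.
move=> pA; pose S := [set v : 'rV[R]_m | `|v| = 1].
have [S0|S0] := pselect (S !=set0); last first.
  exists 1 => // v; have [->|v0] := eqVneq v 0; first by rewrite normr0 mulr0 gnorm_ge0.
  case: S0; exists (`|v|^-1 *: v); rewrite /S/= normrZ normfV normr_id mulVf//.
  by rewrite normr_eq0.
have cS : compact S.
  apply: bounded_closed_compact.
    exists 1; split; first exact: num_real.
    by move=> x x1 v /= ->; exact: ltW.
  have -> : S = (fun v : 'rV[R]_m => `|v|) @^-1` [set 1] by [].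
  apply: preimage_closed; last exact: closed_eq.
  by move=> v _; exact: norm_continuous.
have cg : {within S, continuous (gnorm A)}.
  apply: continuous_subspaceT => v; exact: (gnorm_cvg (F := nbhs v) (w := id)).
have [v0 v0S Hv0] := EVT_min_rV S0 cS cg.
move: v0S; rewrite inE => v01.
exists (gnorm A v0).
  rewrite /gnorm sqrtr_gt0; apply: pA.2; rewrite -normr_eq0.
  by rewrite [`|v0|]v01 oner_eq0.
move=> v; have [->|v0'] := eqVneq v 0; first by rewrite normr0 mulr0 gnorm_ge0.
have nv : 0 < `|v| by rewrite normr_gt0.
have /Hv0 : `|v|^-1 *: v \in S.
  by rewrite inE /S/= normrZ normfV normr_id mulVf// normr_eq0.
by rewrite gnormZ ger0_norm ?invr_ge0// mulrC ler_pdivlMr.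
Qed.

Lemma pw_rderiv c a b t : pw c a b -> a <= t < b -> exists v, rderiv c t v.
Proof.
move=> cab /(pw_right cab)[e [d [[de _] /andP[td _] ce]]].
exists (derive1 e t); have /derivableP De := de t.
have := is_derive_rderiv De; rewrite -derive1E /rderiv.
apply: cvg_near_eq; near=> h.
have h0 : 0 < h by near: h; exact: nbhs_right_gt.
rewrite !ce// ?lexx ?(ltW td)// lerDl (ltW h0) -lerBrDl.
by near: h; apply: nbhs_right_le; rewrite subr_gt0.
Unshelve. all: by end_near. Qed.

Lemma arclength_ex G c a b : pw c a b ->
  (forall t, a <= t <= b -> cont_at G (c t)) -> exists l, arclength G a b c l.
Proof. exact: len_fun_ex. Qed.

Lemma cts_sub (V : topologicalType) a b (f : R -> V) s t : cts a b f ->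
  a <= s -> t <= b -> cts s t f.
Proof.
move=> cf as_ tb u /andP[su ut]; have := cf u.
rewrite (le_trans as_ su) (le_trans ut tb) => /(_ isT); apply: cvg_trans.
apply: cvg_app; apply: within_subset => z /=; rewrite !in_itv/= => /andP[sz zt].
by rewrite (le_trans as_ sz) (le_trans zt tb).
Qed.

(* A function whose increments are locally at most those of the length element
   grows along a curve by at most the arc length. *)
Lemma arclength_incr G c a b l (phi : 'rV[R]_m -> R) s t :
  pw c a b -> arclength G a b c l -> a <= s -> s <= t -> t <= b ->
  (forall u, s <= u <= t -> {for c u, continuous phi}) ->
  (forall u, s <= u < t -> forall e, 0 < e -> \forall y \near c u,
    phi y - phi (c u) <= gnorm (G (c u)) (y - c u) + e * `|y - c u|) ->
  phi (c t) - phi (c s) <= l t - l s.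
Proof.
move=> cab [_ _ lc ld] as_ st tb cphi dphi.
suff : l s - phi (c s) <= l t - phi (c t) by clear; lra.
have cc := cts_sub (pw_cts cab) as_ tb.
apply: (dini_le (G := fun u => l u - phi (c u))) => //.
  move=> u sut; apply: cvgB; first exact: (cts_sub lc as_ tb).
  exact: (cvg_comp c phi (cc u sut) (cphi u sut)).
move=> u /andP[su ut] e e0.
have aub : a <= u < b by rewrite (le_trans as_ su) (lt_le_trans ut).
have [v cv] := pw_rderiv cab aub.
have lv := ld u aub v cv.
(* One third of [e] each for the hypothesis on [phi], the right derivative of [l] and the difference
   quotient of [c], whose norm is eventually below [|v| + 1]. *)
pose e' := e / 3 / (`|v| + 1).
have e30 : 0 < e / 3 by rewrite divr_gt0.
have v1 : 0 < `|v| + 1 by rewrite ltr_wpDl.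
have e'0 : 0 < e' by rewrite divr_gt0.
have su' : s <= u < t by rewrite su ut.
have H1 := rderiv_cvg cv (dphi u su' e' e'0).
have /cvgr_gt/(_ (gnorm (G (c u)) v - e / 3)) := lv.
rewrite ltrBlDr ltrDl => /(_ e30) H2.
have gc : gnorm (G (c u)) (h^-1 *: (c (u + h) - c u)) @[h --> 0^'+] -->
    gnorm (G (c u)) v by exact: gnorm_cvg.
have nc : `|h^-1 *: (c (u + h) - c u)| @[h --> 0^'+] --> `|v| by exact: cvg_norm.
have := cvgr_lt _ gc (gnorm (G (c u)) v + e / 3); rewrite ltrDl => /(_ _ e30) H3.
have := cvgr_lt _ nc (`|v| + 1); rewrite ltrDl => /(_ _ ltr01) H4.
near=> h; have h0 : 0 < h by near: h; exact: nbhs_right_gt.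
have h1 : phi (c (u + h)) - phi (c u) <=
   gnorm (G (c u)) (c (u + h) - c u) + e' * `|c (u + h) - c u| by near: h.
have h2 : gnorm (G (c u)) v - e / 3 < h^-1 *: (l (u + h) - l u) by near: h.
have h3 : gnorm (G (c u)) (h^-1 *: (c (u + h) - c u)) < gnorm (G (c u)) v + e / 3.
  by near: h.
have h4 : `|h^-1 *: (c (u + h) - c u)| < `|v| + 1 by near: h.
move: h2 h3 h4; rewrite gnormZ normrZ gtr0_norm ?invr_gt0//.
have -> : h^-1 *: (l (u + h) - l u) = (l (u + h) - l u) / h by exact: mulrC.
rewrite ltr_pdivlMr// !ltr_pdivrMl// => h2 h3 h4.
have h5 : e' * `|c (u + h) - c u| <= e / 3 * h.
  apply: le_trans (_ : e' * (h * (`|v| + 1)) <= _).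
    by rewrite ler_pM2l// ltW.
  by rewrite /e' mulrA mulrAC divfK// gt_eqF.
clear -h1 h2 h3 h5; nra.
Unshelve. all: by end_near. Qed.

End Distance.

(** * Geodesic distance *)

Lemma is_derive_line (R : realType) (V : normedModType R) (x w : V) (t : R) :
  is_derive t 1 (fun s : R => x + s *: w) w.
Proof.
have H : (fun h => h^-1 *: (((fun s => x + s *: w) \o shift t) (h *: (1 : R))
    - (x + t *: w))) @ 0^' --> w.
  apply: cvg_near_eq (cvg_cst w); near=> h.
  have h0 : h != 0 by near: h; exact: nbhs_dnbhs_neq.
  rewrite /= [h *: 1]mulr1 opprD addrACA subrr add0r -scalerBl addrK.
  by rewrite scalerA mulVf// scale1r.
by split; [apply/cvg_ex; exists w|exact: cvg_lim].
Unshelve. all: by end_near. Qed.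

Lemma continuous_scaled_dist (R : realType) (V : normedModType R) (p x : V)
  (k : R) : {for x, continuous (fun y => k * `|y - p|)}.
Proof.
apply: cvgM; first exact: cvg_cst.
by apply: cvg_norm; apply: cvgB; [exact: cvg_id|exact: cvg_cst].
Qed.

Lemma continuous_scaled_min_dist (R : realType) (V : normedModType R) (p x : V)
  (k d : R) : {for x, continuous (fun y => k * Num.min `|y - p| d)}.
Proof.
apply: cvgM; first exact: cvg_cst.
rewrite minr_absE; under eq_fun do rewrite minr_absE.
have nc : `|y - p| @[y --> x] --> `|x - p|.
  by apply: cvg_norm; apply: cvgB; [exact: cvg_id|exact: cvg_cst].
apply: cvgM; last exact: cvg_cst.
apply: cvgB; first by apply: cvgD => //; exact: cvg_cst.
by apply: cvg_norm; apply: cvgB => //; exact: cvg_cst.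
Qed.

(** Only continuity of the metric is asked, because the conformal metric is built from [r], which is
    at first merely continuous. *)
Definition admissible (R : realType) (m : nat) (U : set 'rV[R]_m)
    (P : 'rV[R]_m) (G : 'rV[R]_m -> 'M[R]_m) : Prop :=
  [/\ open U, U P & forall x, U x -> cont_at G x].

Section DistanceFrom.
Context {R : realType} {m : nat}.
Context (U : set 'rV[R]_m) (P : 'rV[R]_m) (G : 'rV[R]_m -> 'M[R]_m).
Hypothesis adm : admissible U P G.
Let oU : open U. Proof. by case: adm. Qed.
Let UP : U P. Proof. by case: adm. Qed.
Let cG x : U x -> cont_at G x. Proof. by case: adm => _ _; exact. Qed.
Implicit Types (c : R -> 'rV[R]_m) (Q x y v w : 'rV[R]_m).

Local Notation r := (geodesic_distance U G P).

Definition reach Q := exists a b c, joins U P Q a b c.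

Lemma curve_length_ge0 a b c : 0 <= curve_length G a b c.
Proof. by apply: Rintegral_ge0 => t _; exact: sqrtr_ge0. Qed.

Lemma dist_le Q a b c : joins U P Q a b c -> r Q <= curve_length G a b c.
Proof.
move=> [cab ca cb cU]; apply: ge_inf.
  by exists 0 => _ [a' [b' [c' [_ _ _ _ ->]]]]; exact: curve_length_ge0.
by exists a, b, c; split=> //; exact/piecewise_C1P.
Qed.

Lemma le_dist Q k : reach Q ->
  (forall a b c l, joins U P Q a b c -> arclength G a b c l -> k <= l b) ->
  k <= r Q.
Proof.
move=> [a0 [b0 [c0 [cab ca cb cU]]]] H; apply: lb_le_inf.
  exists (curve_length G a0 b0 c0), a0, b0, c0.
  by split=> //; exact/piecewise_C1P.
move=> _ [a [b [c [/piecewise_C1P cab' ca' cb' cU' ->]]]].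
have [l hl] := arclength_ex cab' (fun t tab => cG (cU' t tab)).
by have [_ <- _ _] := hl; apply: H hl.
Qed.

(** The infimum of the empty set is 0. Hence every point of a punctured ball is joined to [P]. *)
Lemma dist_unreach Q : ~ reach Q -> r Q = 0.
Proof.
move=> nQ; rewrite /geodesic_distance (_ : mkset _ = set0) ?inf0//.
apply/seteqP; split=> // L [a [b [c [/piecewise_C1P cab ca cb cU _]]]].
by apply: nQ; exists a, b, c.
Qed.

Lemma arclength_le_end a b c l : pw c a b ->
  arclength G a b c l -> forall s t, a <= s -> s <= t -> t <= b -> l s <= l t.
Proof.
move=> cab hl s t as_ st tb.
have := arclength_incr (phi := cst 0) cab hl as_ st tb.
rewrite subrr subr_ge0; apply => [u _|u _ e e0]; first exact: cst_continuous.
near=> y; rewrite addr_ge0 ?gnorm_ge0// mulr_ge0//.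
exact: ltW.
Unshelve. all: by end_near. Qed.

Lemma dist_ge0 Q : 0 <= r Q.
Proof.
have [rQ|/dist_unreach->//] := pselect (reach Q).
apply: le_dist => // a b c l [cab _ _ _] hl.
have ab := pw_le cab; have [<- _ _ _] := hl.
exact: (arclength_le_end cab hl).
Qed.

Lemma dist_near Q e : reach Q -> 0 < e -> exists a b c l,
  [/\ joins U P Q a b c, arclength G a b c l & l b < r Q + e].
Proof.
move=> [a0 [b0 [c0 [cab ca cb cU]]]] e0.
have [|_ [a [b [c [/piecewise_C1P cab' ca' cb' cU' ->]]]] Hb] := inf_adherent e0 (E :=
  [set L | exists (a b : R) (c : R -> 'rV[R]_m),
    [/\ piecewise_C1 a b c, c a = P, c b = Q,
        forall t, a <= t <= b -> U (c t) & L = curve_length G a b c]]).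
  split.
    exists (curve_length G a0 b0 c0), a0, b0, c0.
    by split=> //; exact/piecewise_C1P.
  by exists 0 => _ [a' [b' [c' [_ _ _ _ ->]]]]; exact: curve_length_ge0.
have [l hl] := arclength_ex cab' (fun t tab => cG (cU' t tab)).
exists a, b, c, l; split=> //.
by have [_ -> _ _] := hl.
Qed.

Lemma joinsP : joins U P P 0 0 (cst P).
Proof. by split=> //; exact: pw_nil. Qed.

Lemma distP : r P = 0.
Proof.
apply/le_anti; rewrite dist_ge0 andbT; apply: le_trans (dist_le joinsP) _.
by rewrite /curve_length set_itv1 Rintegral_set1.
Qed.

Lemma extend_segment x y a b c M : joins U P x a b c ->
  (forall s, 0 <= s <= 1 -> U (x + s *: (y - x))) ->
  (forall s, 0 <= s <= 1 -> gnorm (G (x + s *: (y - x))) (y - x) <= M) ->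
  exists2 c', joins U P y a (b + 1) c' &
    curve_length G a (b + 1) c' <= curve_length G a b c + M.
Proof.
move=> [cab ca cb cU] sU sM; have ab := pw_le cab.
pose e t := x + (t - b) *: (y - x).
have De (t : R) : is_derive t 1 e (y - x).
  have -> : e = fun t => (x - b *: (y - x)) + t *: (y - x).
    by apply/funext => u; rewrite /e scalerBl addrCA addrC.
  exact: is_derive_line.
have Ce : C1 e.
  split=> [t|]; first by have [] := De t.
  have -> : derive1 e = cst (y - x) by apply/funext => t; rewrite derive1E derive_val.
  exact: cst_continuous.
pose c' t := if t <= b then c t else e t.
have c'c t : a <= t <= b -> c t = c' t by move=> /andP[_ tb]; rewrite /c' tb.
have c'e t : b <= t <= b + 1 -> c' t = e t.
  move=> /andP[bt _]; rewrite /c'; case: ifPn => // tb.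
  by have -> : t = b; [apply/le_anti; rewrite tb bt|rewrite /e subrr scale0r addr0].
have b1 : b < b + 1 by rewrite ltrDl.
have c'ab := pw_ext cab c'c.
have c'p : pw c' a (b + 1).
  by apply: (pw_cat c'ab); apply: (pw_cons b1 Ce c'e); exact: pw_nil.
have jc' : joins U P y a (b + 1) c'.
  split=> //; first by rewrite -c'c ?lexx.
    rewrite c'e ?lexx ?ltW// /e addrAC subrr add0r scale1r.
    by rewrite addrC subrK.
  move=> t /andP[at_ tb]; have [tb'|/ltW bt] := leP t b.
    by rewrite -c'c ?at_//; apply: cU; rewrite at_.
  by rewrite c'e ?bt// /e; apply: sU; rewrite subr_ge0 bt lerBlDl.
exists c' => //.
have [_ _ _ c'U] := jc'.
(* The lengths of [c] and [c'] are compared through right derivatives: equal ones before [b], and at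
   most [M] on the added segment, which is run through in unit time. *)
have [l hl] := arclength_ex cab (fun t tab => cG (cU t tab)).
have [l' hl'] := arclength_ex c'p (fun t tab => cG (c'U t tab)).
have [la lb lc ld] := hl; have [la' lb' lc' ld'] := hl'.
rewrite -lb -lb'.
have E1 : l' b <= l b.
  suff : l a - l' a <= l b - l' b by rewrite la la' subrr subr_ge0.
  apply: (dini_rderiv (G := fun t => l t - l' t)) => //.
    move=> t tab; apply: cvgB; first exact: lc.
    by apply: (cts_sub lc') tab => //; exact: ltW.
  move=> t /andP[at_ tb]; exists 0 => //.
  have tab : a <= t < b by rewrite at_.
  have [v cv] := pw_rderiv cab tab.
  have cv' : rderiv c' t v.
    move: cv; rewrite /rderiv; apply: cvg_near_eq; near=> h.
    have h0 : 0 < h by near: h; exact: nbhs_right_gt.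
    rewrite !c'c ?at_ ?(ltW tb)//; apply/andP; split.
      by rewrite (le_trans at_)// lerDl ltW.
    by rewrite -lerBrDl; near: h; apply: nbhs_right_le; rewrite subr_gt0.
  rewrite -(subrr (gnorm (G (c t)) v)); apply: rderivB; first exact: ld.
  rewrite c'c ?at_ ?ltW//; apply: ld' => //.
  by rewrite at_ (lt_trans tb).
have E2 : l' (b + 1) <= l' b + M.
  rewrite -subr_ge0.
  have -> : l' b + M - l' (b + 1) =
      (M * (b + 1) - l' (b + 1)) - (M * b - l' b) by ring.
  rewrite subr_ge0.
  apply: (dini_rderiv (G := fun t => M * t - l' t)); first exact: ltW.
    move=> t tab; apply: cvgB; last exact: (cts_sub lc').
    by apply: cvgM; [exact: cvg_cst|exact: cvg_within].
  move=> t /andP[bt tb]; exists (M - gnorm (G (c' t)) (y - x)).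
    have -> : c' t = e t by apply: c'e; rewrite bt ltW.
    by rewrite subr_ge0; apply: (sM (t - b)); rewrite subr_ge0 bt lerBlDl ltW.
  apply: rderivB.
    have := is_derive_rderiv (is_derive_line (0 : R) M t).
    rewrite /rderiv; apply: cvg_near_eq; near=> h.
    by rewrite !add0r /GRing.scale/= !(mulrC _ M).
  apply: ld'; first by rewrite (le_trans ab).
  have := is_derive_rderiv (De t); rewrite /rderiv; apply: cvg_near_eq; near=> h.
  have h0 : 0 < h by near: h; exact: nbhs_right_gt.
  rewrite !c'e ?bt ?(ltW tb)//; apply/andP; split.
    by rewrite (le_trans bt)// lerDl ltW.
  by rewrite -lerBrDl; near: h; apply: nbhs_right_le; rewrite subr_gt0.
by apply: le_trans E2 _; rewrite lerD2r.
Unshelve. all: by end_near. Qed.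

Lemma dist_segment x y M :
  (forall s, 0 <= s <= 1 -> U (x + s *: (y - x))) ->
  (forall s, 0 <= s <= 1 -> gnorm (G (x + s *: (y - x))) (y - x) <= M) ->
  r y <= r x + M.
Proof.
move=> sU sM.
have M0 : 0 <= M by apply: le_trans (sM 0 _); rewrite ?gnorm_ge0// lexx ler01.
(* The reversed segment shows that [x] is reachable if [y] is; an unreachable [y] has distance 0 and
   poses no problem. *)
have sU' s : 0 <= s <= 1 -> U (y + s *: (x - y)).
  move=> /andP[s0 s1]; have -> : y + s *: (x - y) = x + (1 - s) *: (y - x).
    by rewrite scalerBl scale1r -(opprB y x) scalerN addrA (addrCA x) subrr addr0.
  by apply: sU; rewrite subr_ge0 s1 lerBlDr lerDl s0.
have [ry|ny] := pselect (reach y); last by rewrite dist_unreach// addr_ge0// dist_ge0.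
have rx : reach x.
  have [a [b [c jc]]] := ry.
  have [M' HM'] : exists M', forall s, 0 <= s <= 1 ->
      gnorm (G (y + s *: (x - y))) (x - y) <= M'.
    exists M => s s01; have -> : x - y = (-1) *: (y - x) by rewrite scaleN1r opprB.
    rewrite gnormZ normrN1 mul1r; have := sM (1 - s).
    have -> : y + s *: (-1 *: (y - x)) = x + (1 - s) *: (y - x).
      by rewrite scalerA mulrN1 scalerBl scale1r scaleNr addrA (addrCA x) subrr addr0.
    case/andP: s01 => s0 s1.
    by apply; rewrite subr_ge0 s1 lerBlDr lerDl s0.
  have [c' jc' _] := extend_segment jc sU' HM'.
  by exists a, (b + 1), c'.
rewrite -lerBlDr; apply: le_dist => // a b c l jc [_ -> _ _].
have [c' jc' L] := extend_segment jc sU sM.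
by rewrite lerBlDr (le_trans (dist_le jc')).
Qed.

Lemma dist_local x e : U x -> 0 < e -> exists2 d, 0 < d &
  forall y z, ball x d y -> ball x d z ->
    U y /\ r z <= r y + gnorm (G x) (z - y) + e * `|z - y|.
Proof.
move=> Ux e0.
have /nbhs_ballP[d /= d0 Hd] : \forall z \near x, U z /\ forall v,
    gnorm (G z) v <= gnorm (G x) v + e * `|v|.
  near=> z; split; first by near: z; exact: open_nbhs_nbhs.
  move=> v; have : forall v, gnorm (G z) v <= gnorm (G x) v + e * `|v| /\
    gnorm (G x) v <= gnorm (G z) v + e * `|v|.
    by near: z; apply: gnorm_near => //; exact: cG.
  by move=> /(_ v)[].
exists d => // y z xy xz; split; first by have [] := Hd y xy.
have bs s : 0 <= s <= 1 -> ball x d (y + s *: (z - y)).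
  move=> /andP[s0 s1]; move: xy xz; rewrite -!ball_normE /ball_/= => xy xz.
  have -> : x - (y + s *: (z - y)) = (1 - s) *: (x - y) + s *: (x - z).
    by apply/rowP => i; rewrite !mxE; ring.
  apply: le_lt_trans (ler_normD _ _) _.
  rewrite !normrZ (ger0_norm s0) ger0_norm ?subr_ge0//.
  have [->|s0'] := eqVneq s 0; first by rewrite subr0 mul1r mul0r addr0.
  have sp : 0 < s by rewrite lt_neqAle eq_sym s0'.
  rewrite [ltRHS](_ : d = (1 - s) * d + s * d); last by ring.
  apply: ler_ltD; first by rewrite ler_wpM2l// ?subr_ge0// ltW.
  by rewrite ltr_pM2l.
rewrite -addrA; apply: dist_segment => s /bs /Hd[]// _; exact.
Unshelve. all: by end_near. Qed.

(** The segment between [x] and [y], in both directions, has about the length [gnorm (G x) (y - x)].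
    This stands in for [|dr| <= 1] while [r] is not known to be differentiable. *)
Lemma dist_near_le x e : U x -> 0 < e -> \forall y \near x,
  r y - r x <= gnorm (G x) (y - x) + e * `|y - x| /\
  r x - r y <= gnorm (G x) (y - x) + e * `|y - x|.
Proof.
move=> Ux e0; have [d d0 Hd] := dist_local Ux e0; near=> y.
have xy : ball x d y by near: y; exact: nbhsx_ballx.
have xx : ball x d x by exact: ballxx.
have [_ h1] := Hd _ _ xx xy; have [_ h2] := Hd _ _ xy xx.
split; first by rewrite lerBlDl addrA.
rewrite lerBlDl addrA -(opprB x y) normrN -scaleN1r gnormZ normrN1 mul1r.
exact: h2.
Unshelve. all: by end_near. Qed.

Lemma dist_cont x : U x -> {for x, continuous r}.
Proof.
move=> Ux; pose K := Num.sqrt (\sum_i \sum_j `|G x i j|) + 1.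
have K0 : 0 < K by rewrite ltr_wpDl// sqrtr_ge0.
apply/(@cvgrPdist_le _ _ _ (nbhs x)) => e e0; near=> y.
have : ball x (e / K) y by near: y; apply: nbhsx_ballx; exact: divr_gt0.
rewrite -ball_normE => /ltW xy.
have [h1 h2] : r y - r x <= gnorm (G x) (y - x) + 1 * `|y - x| /\
  r x - r y <= gnorm (G x) (y - x) + 1 * `|y - x|.
  by near: y; exact: dist_near_le.
have h3 : gnorm (G x) (y - x) + 1 * `|y - x| <= e.
  apply: le_trans (lerD (gnorm_le _ _) (lexx _)) _.
  by rewrite -mulrDl -/K distrC mulrC -ler_pdivlMr.
by rewrite ler_norml (le_trans h2 h3) andbT lerNl opprB (le_trans h1 h3).
Unshelve. all: by end_near. Qed.

Lemma dist_arclength Q a b c l s t : joins U P Q a b c -> arclength G a b c l ->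
  a <= s -> s <= t -> t <= b -> r (c t) - r (c s) <= l t - l s.
Proof.
move=> [cab ca cb cU] hl as_ st tb; apply: (arclength_incr cab hl) => //.
  by move=> u /andP[su ut]; apply: dist_cont; apply: cU; rewrite (le_trans as_ su) (le_trans ut tb).
move=> u /andP[su /ltW ut] e e0.
have Uu : U (c u) by apply: cU; rewrite (le_trans as_ su) (le_trans ut tb).
by apply: filterS (dist_near_le Uu e0) => y [].
Qed.

Lemma dist_curve_cts Q a b c : joins U P Q a b c -> cts a b (r \o c).
Proof.
move=> [cab _ _ cU] t tab.
exact: (cvg_comp c r (pw_cts cab tab) (dist_cont (cU t tab))).
Qed.

(** Together the bounds say that along an almost shortest curve [l] exceeds [r] by no more than the
    total excess [l b - r Q]. *)
Lemma dist_curve_bounds Q a b c l t : joins U P Q a b c ->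
  arclength G a b c l -> a <= t <= b ->
  r (c t) <= l t /\ r Q - r (c t) <= l b - l t.
Proof.
move=> jc hl /andP[at_ tb]; have [_ ca cb _] := jc; split.
  have := dist_arclength jc hl (lexx a) at_ tb.
  by rewrite ca distP subr0; case: hl => -> _ _ _; rewrite subr0.
by have := dist_arclength jc hl at_ tb (lexx b); rewrite cb.
Qed.

(** * Comparison of the distance with the norm of the chart *)

Section EuclideanComparison.
Context (k rho : R).
Hypotheses (k0 : 0 < k) (rho0 : 0 < rho).
Hypothesis (kG : forall x, `|x - P| < rho -> forall v, k * `|v| <= gnorm (G x) v).

Lemma euclidean_arclength Q a b c l s t : joins U P Q a b c ->
  arclength G a b c l -> a <= s -> s <= t -> t <= b ->
  (forall u, s <= u <= t -> `|c u - P| < rho) ->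
  k * `|c t - c s| <= l t - l s.
Proof.
move=> [cab ca cb cU] hl as_ st tb cP.
have := arclength_incr (phi := fun y => k * `|y - c s|) cab hl as_ st tb.
rewrite subrr normr0 mulr0 subr0; apply => u.
  by move=> _; exact: continuous_scaled_dist.
move=> /andP[su ut] e e0; near=> y.
apply: le_trans (_ : k * `|y - c u| <= _).
  rewrite -mulrBr ler_pM2l//; apply: le_trans (lerB_dist _ _) _.
  by rewrite opprB addrA subrK.
have cuP : `|c u - P| < rho by apply: cP; rewrite su ltW.
apply: le_trans (kG cuP _) _.
by rewrite lerDl mulr_ge0// ltW.
Unshelve. all: by end_near. Qed.

(** The truncation at [rho] makes the compared function constant outside the coordinate ball, where
    nothing is known about the metric and where curves may wander. *)
Lemma euclidean_dist Q : reach Q -> k * Num.min `|Q - P| rho <= r Q.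
Proof.
move=> rQ; apply: le_dist => // a b c l [cab ca cb cU] hl.
have ab := pw_le cab; have [la _ _ _] := hl.
have := arclength_incr (phi := fun y => k * Num.min `|y - P| rho) cab hl
  (lexx a) ab (lexx b).
rewrite cb ca subrr normr0 (min_l (ltW rho0)) mulr0 subr0 la subr0; apply => u.
  by move=> _; exact: continuous_scaled_min_dist.
move=> _ e e0; near=> y.
have gy := gnorm_ge0 (G (c u)) (y - c u).
have [cu|cu] := leP rho `|c u - P|.
  apply: le_trans (_ : 0 <= _); last by rewrite addr_ge0// mulr_ge0// ltW.
  by rewrite -mulrBr pmulr_rle0// subr_le0 ge_min lexx orbT.
apply: le_trans (_ : k * `|y - c u| <= _).
  rewrite -mulrBr ler_pM2l// lerBlDr ge_min; apply/orP; left.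
  by apply: le_trans (ler_distD (c u) y P) _; rewrite lerD2l.
by apply: le_trans (kG cu _) _; rewrite lerDl mulr_ge0// ltW.
Unshelve. all: by end_near. Qed.

End EuclideanComparison.

Lemma euclidean_comparison : posdef (G P) -> exists k rho : R,
  [/\ 0 < k, 0 < rho & forall x, `|x - P| < rho ->
     U x /\ forall v, k * `|v| <= gnorm (G x) v].
Proof.
move=> /gnorm_gt0_lb[k k0 Hk]; have k20 : 0 < k / 2 by rewrite divr_gt0.
have /nbhs_ballP[d /= d0 Hd] : \forall z \near P, U z /\ forall v,
    gnorm (G P) v <= gnorm (G z) v + k / 2 * `|v|.
  near=> z; split; first by near: z; exact: open_nbhs_nbhs.
  move=> v; have : forall v, gnorm (G z) v <= gnorm (G P) v + k / 2 * `|v| /\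
    gnorm (G P) v <= gnorm (G z) v + k / 2 * `|v|.
    by near: z; apply: gnorm_near => //; exact: cG.
  by move=> /(_ v)[].
exists (k / 2), d; split=> // x xP.
have /Hd[Ux H] : ball P d x by rewrite -ball_normE /ball_/= distrC.
split=> // v; have := le_trans (Hk v) (H v).
by rewrite -lerBlDr -mulrBl {1}(splitr k) addrK.
Unshelve. all: by end_near. Qed.

End DistanceFrom.

(** * Distance of a radial conformal metric *)

Lemma heine_segment (R : realType) (phi : R -> R) (a b : R) :
  (forall s, a <= s <= b -> {for s, continuous phi}) ->
  forall e, 0 < e -> \forall d \near 0^'+, forall s t, a <= s <= b ->
    `|t - s| <= d -> `|phi s - phi t| <= e.
Proof.
move=> cphi e e0.
have e20 : 0 < e / 2 by rewrite divr_gt0.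
have /compact_near_coveringP/(_ R (0 : R)^'+ (fun d s => forall t,
  `|t - s| <= d -> `|phi s - phi t| <= e)) := @segment_compact R a b.
move=> H.
suff K : forall x, `[a, b]%classic x -> \forall x' \near x & i \near 0^'+,
    forall t, `|t - x'| <= i -> `|phi x' - phi t| <= e.
  have FF : Filter (0 : R)^'+ by typeclasses eauto.
  by apply: filterS (H FF K) => d Hd s t sab; apply: Hd; rewrite /= in_itv.
move=> s0; rewrite /= in_itv/= => /cphi /cvgrPdist_le/(_ _ e20).
move=> /nbhs_ballP[d /= d0 Hd].
have d20 : 0 < d / 2 by rewrite divr_gt0.
exists (ball s0 (d / 2), [set h | h < d / 2]).
  by split => /=; [exact: nbhsx_ballx|exact: nbhs_right_lt].
move=> [s h] /= [ss hd] t ts.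
rewrite /ball/= in ss.
have h1 : `|phi s0 - phi s| <= e / 2 by apply: Hd; rewrite /ball/=; lra.
have h2 : `|phi s0 - phi t| <= e / 2.
  apply: Hd; rewrite /ball/= (_ : s0 - t = (s0 - s) - (t - s)); last by ring.
  by apply: le_lt_trans (ler_normB _ _) _; lra.
rewrite (_ : phi s - phi t = (phi s0 - phi t) - (phi s0 - phi s)); last by ring.
by apply: le_trans (ler_normB _ _) _; lra.
Qed.

Lemma is_derive_derivable (R : realType) (V : normedModType R) (f : R -> V)
  (t : R) v : is_derive t 1 f v -> derivable f t 1.
Proof. by case. Qed.

Lemma is_derive_diff (R : realType) (f : R -> R) (t v : R) :
  is_derive t 1 f v -> differentiable f t /\ forall z, 'd f t z = z * v.
Proof.
move=> [df dv]; have dft : differentiable f t by exact/derivable1_diffP.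
by split=> // z; rewrite diff1E// derive1E dv.
Qed.

Lemma continuous_for_comp (S T V : topologicalType) (f : S -> T) (g : T -> V)
  (x : S) : {for x, continuous f} -> {for f x, continuous g} ->
  {for x, continuous (g \o f)}.
Proof. exact: continuous_comp. Qed.

Lemma continuous_forM (R : realType) (S : topologicalType) (f g : S -> R)
  (x : S) : {for x, continuous f} -> {for x, continuous g} ->
  {for x, continuous (fun y => f y * g y)}.
Proof. exact: continuousM. Qed.

Section Conformal.
Context {R : realType} {m : nat}.
Context (U : set 'rV[R]_m) (P : 'rV[R]_m) (G : 'rV[R]_m -> 'M[R]_m).
Hypothesis adm : admissible U P G.
Let cG x : U x -> cont_at G x. Proof. by case: adm => _ _; exact. Qed.
Context (J : set R) (phi h : R -> R).
Local Notation r := (geodesic_distance U G P).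
Hypotheses (oJ : open J) (iJ : is_interval J) (J0 : J 0).
Hypothesis (Jr : forall x, U x -> J (r x)).
Hypothesis (cphi : forall s, J s -> {for s, continuous phi}).
Hypothesis (phi_gt0 : forall s, J s -> 0 < phi s).
Hypotheses (dh : forall s, J s -> is_derive s 1 h (phi s)) (h0 : h 0 = 0).
Implicit Types (c : R -> 'rV[R]_m) (Q x y v w : 'rV[R]_m).

Definition conformal x := phi (r x) ^+ 2 *: G x.

Lemma conformal_cont x : U x -> cont_at conformal x.
Proof.
move=> Ux i j; rewrite /conformal.
have -> : (fun y => (phi (r y) ^+ 2 *: G y) i j) =
          (fun y => (phi \o r) y * (phi \o r) y * G y i j).
  by apply/funext => y; rewrite !mxE expr2.
have cr : {for x, continuous (phi \o r)}.
  exact: continuous_for_comp (dist_cont adm Ux) (cphi (Jr Ux)).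
exact: (continuous_forM (continuous_forM cr cr) (cG Ux (i := i) (j := j))).
Qed.

Lemma conformal_adm : admissible U P conformal.
Proof. by case: adm => oU UP _; split=> //; exact: conformal_cont. Qed.

Lemma gnorm_conformal x v : U x -> gnorm (conformal x) v = phi (r x) * gnorm (G x) v.
Proof.
move=> Ux; rewrite /gnorm /conformal qfZ sqrtrM ?sqr_ge0// sqrtr_sqr ger0_norm//.
by rewrite ltW// phi_gt0//; exact: Jr.
Qed.

Lemma dist_lipschitz x : U x -> exists2 K, 0 < K &
  \forall y \near x, `|r y - r x| <= K * `|y - x|.
Proof.
move=> Ux; exists (Num.sqrt (\sum_i \sum_j `|G x i j|) + 1).
  by rewrite ltr_wpDl// sqrtr_ge0.
apply: filterS (dist_near_le adm Ux ltr01) => y [h1 h2].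
have h3 := gnorm_le (G x) (y - x).
rewrite ler_norml mulrDl lerNl opprB; apply/andP; split.
  by apply: le_trans h2 _; rewrite lerD2r.
by apply: le_trans h1 _; rewrite lerD2r.
Qed.

Lemma primitive_incr s t : J s -> J t -> s <= t -> h s <= h t.
Proof.
move=> Js Jt; rewrite le_eqVlt => /orP[/eqP->//|st].
have Ju u : s <= u <= t -> J u by move=> sut; exact: (iJ Js Jt sut).
have [||x + hE] := MVT st (f := h) (df := phi).
- by move=> x; rewrite in_itv/= => /andP[/ltW sx /ltW xt]; apply/dh/Ju; rewrite sx.
- apply: derivable_within_continuous => x; rewrite in_itv/= => /Ju/dh dx.
  exact: is_derive_derivable dx.
rewrite in_itv/= => /andP[/ltW sx /ltW xt].
rewrite -subr_ge0 hE mulr_ge0// ?subr_ge0 ?(ltW st)//.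
by apply/ltW/phi_gt0/Ju; rewrite sx.
Qed.

(** Since [h' = phi] and [r] has slope at most one for [G], the function [h \o r] has slope at most
    one for the conformal metric, so no curve is shorter than its increment. *)
Lemma dist_conformal_ge Q : U Q -> reach U P Q ->
  h (r Q) <= geodesic_distance U conformal P Q.
Proof.
move=> UQ rQ; apply: (le_dist conformal_adm rQ) => a b c l [cab ca cb cU] hl.
have ab := pw_le cab; have [la _ _ _] := hl.
have := arclength_incr (phi := h \o r) cab hl (lexx a) ab (lexx b).
rewrite la subr0 ca cb /= (distP adm) h0 subr0; apply=> u.
  move=> /cU Uu.
  have := derivable_cvg (is_derive_derivable (dh (Jr Uu))).
  exact: continuous_for_comp (dist_cont adm Uu).
move=> /andP[au /ltW ub] e e0.
have Uu : U (c u) by apply: cU; rewrite au.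
have p0 := phi_gt0 (Jr Uu).
have [K K0 HK] := dist_lipschitz Uu.
have e1 : 0 < e / 2 / phi (r (c u)) by rewrite !divr_gt0.
have e2 : 0 < e / 2 / K by rewrite !divr_gt0.
have [dhu dE] := is_derive_diff (dh (Jr Uu)).
have H2 := dist_cont adm Uu (diff_eps dhu e2).
near=> y; rewrite gnorm_conformal//.
have h1 : `|h (r y) - h (r (c u)) - 'd h (r (c u)) (r y - r (c u))| <=
  e / 2 / K * `|r y - r (c u)| by near: y.
have h2 : `|r y - r (c u)| <= K * `|y - c u| by near: y.
have [h3 _] : r y - r (c u) <= gnorm (G (c u)) (y - c u) +
    e / 2 / phi (r (c u)) * `|y - c u| /\
  r (c u) - r y <= gnorm (G (c u)) (y - c u) +
    e / 2 / phi (r (c u)) * `|y - c u|.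
  by near: y; exact: dist_near_le.
move: h1; rewrite dE => /(le_trans (ler_norm _)) h1.
have h4 : e / 2 / K * `|r y - r (c u)| <= e / 2 * `|y - c u|.
  by rewrite -mulrA ler_pM2l ?divr_gt0// ler_pdivrMl.
have h5 : (r y - r (c u)) * phi (r (c u)) <=
    phi (r (c u)) * gnorm (G (c u)) (y - c u) + e / 2 * `|y - c u|.
  rewrite mulrC; apply: le_trans (_ : phi (r (c u)) *
    (gnorm (G (c u)) (y - c u) + e / 2 / phi (r (c u)) * `|y - c u|) <= _).
    by rewrite ler_pM2l.
  by rewrite mulrDr mulrA (mulrC (phi _) (_ / _)) divfK// gt_eqF.
rewrite lerBlDr in h1; apply: le_trans h1 _.
by apply: le_trans (lerD h4 h5) _; rewrite addrCA -mulrDl -splitr.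
Unshelve. all: by end_near. Qed.

(** Along an almost shortest curve for [G] the radius is close to the arc length [l], so the new
    length, the integral of [phi(r) dl], is close to that of [phi(l) dl], which is [h (l b)]. *)
Lemma dist_conformal_le Q : U Q -> reach U P Q ->
  geodesic_distance U conformal P Q <= h (r Q).
Proof.
move=> UQ rQ; set S := r Q; have JS : J S := Jr UQ.
have S0 : 0 <= S := dist_ge0 adm Q.
have /nbhs_ballP[d' /= d'0 Hd'] := open_nbhs_nbhs (conj oJ JS).
pose d := d' / 2; have d0 : 0 < d by rewrite divr_gt0.
have JSd s : 0 <= s <= S + d -> J s.
  move=> ss; apply: (iJ J0 _ ss); apply: Hd'.
  by rewrite /ball/= opprD addNKr normrN gtr0_norm// /d; lra.
have Sd1 : 0 < 1 + (S + d) + 1 by lra.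
(* The total error is [e'] from the continuity of [h] at [S] plus [e'] times a length of at most
   [S + d]. *)
apply/ler_addgt0Pr => e e0; pose e' := e / (1 + (S + d) + 1).
have e'0 : 0 < e' by rewrite divr_gt0.
have Hphi : \forall t \near 0^'+, forall s s', 0 <= s <= S + d ->
    `|s' - s| <= t -> `|phi s - phi s'| <= e'.
  by apply: heine_segment => // s /JSd; exact: cphi.
have Hh : \forall t \near 0^'+, h (S + t) <= h S + e'.
  have := rderiv_cvg (is_derive_rderiv (dh JS)).
  by move=> /cvgr_le; apply; rewrite ltrDl.
have [t [t0 td Ht Hht]] : exists t, [/\ 0 < t, t <= d, forall s s', 0 <= s <= S + d ->
    `|s' - s| <= t -> `|phi s - phi s'| <= e' & h (S + t) <= h S + e'].
  near (0 : R)^'+ => t'; exists t'; split; near: t' => //.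
    exact: nbhs_right_gt.
  exact: nbhs_right_le.
have [a [b [c [l [jc hl lb]]]]] := dist_near adm rQ t0.
have [cab ca cb cU] := jc; have ab := pw_le cab.
have [la _ lc ld] := hl.
have [l' hl'] := arclength_ex cab (fun u uab => conformal_cont (cU u uab)).
have [la' lb' lc' ld'] := hl'.
apply: le_trans (dist_le _ jc) _; rewrite -lb'.
have lS : l b <= S + d by apply: ltW (lt_le_trans lb _); rewrite lerD2l.
have lu u : a <= u <= b -> 0 <= l u <= S + d.
  move=> /andP[au ub]; rewrite -{1}la (arclength_le_end cab hl)//=.
  by apply: le_trans lS; exact: (arclength_le_end cab hl).
(* The right derivative is [phi (l u) + e' - phi (r (c u))] times the speed, nonnegative by uniform
   continuity of [phi]. *)
have key : h (l a) + e' * l a - l' a <= h (l b) + e' * l b - l' b.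
  apply: (dini_rderiv (G := fun u => h (l u) + e' * l u - l' u)) => //.
    move=> u uab; apply: cvgB; last exact: lc'.
    apply: cvgD; last by apply: cvgM; [exact: cvg_cst|exact: lc].
    have ch := derivable_cvg (is_derive_derivable (dh (JSd _ (lu _ uab)))).
    exact: (cvg_comp l h (lc u uab) ch).
  move=> u /andP[au ub]; have uab : a <= u <= b by rewrite au ltW.
  have uab' : a <= u < b by rewrite au.
  have [v cv] := pw_rderiv cab uab'.
  have Uu := cU u uab.
  exists (phi (l u) * gnorm (G (c u)) v + e' * gnorm (G (c u)) v -
     gnorm (conformal (c u)) v).
    rewrite gnorm_conformal// -mulrDl -mulrBl mulr_ge0 ?gnorm_ge0//.
    have [b1 b2] := dist_curve_bounds adm jc hl uab.
    have := Ht (l u) (r (c u)) (lu u uab).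
    rewrite ler0_norm ?subr_le0// opprB => H.
    have /H : l u - r (c u) <= t by move: b2 lb; rewrite -/S; lra.
    by rewrite ler_norml => /andP[]; lra.
  have lv := ld u uab' v cv; have lv' := ld' u uab' v cv.
  apply: rderivB => //; apply: rderivD; last exact: rderivZ.
  have [dhl dlE] := is_derive_diff (dh (JSd _ (lu _ uab))).
  by have := rderiv_comp dhl lv; rewrite dlE mulrC.
move: key; rewrite la la' h0 mulr0 addr0 subr0 subr_ge0 => key.
apply: le_trans key _.
have h1 : h (l b) <= h S + e'.
  apply: le_trans Hht; apply: primitive_incr; last exact: ltW.
    by apply: JSd; apply: lu; rewrite ab lexx.
  by apply: JSd; rewrite addr_ge0 ?(ltW t0)//= lerD2l.
have h2 : e' * l b <= e' * (S + d) by rewrite ler_pM2l.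
apply: le_trans (lerD h1 h2) _; rewrite -addrA lerD2l.
rewrite -[X in X + _]mulr1 -mulrDr /e' mulrAC ler_pdivrMr// ler_pM2l//; lra.
Unshelve. all: by end_near. Qed.

(** At a point not joined to [P] both distances are 0, in accordance with [h 0 = 0]. *)
Lemma dist_conformal Q : U Q -> geodesic_distance U conformal P Q = h (r Q).
Proof.
move=> UQ; have [rQ|nQ] := pselect (reach U P Q).
  by apply/le_anti; rewrite dist_conformal_le// dist_conformal_ge.
by rewrite !dist_unreach.
Qed.

End Conformal.

(** * Smooth functions *)

(** The order is the induction variable of the closure properties: partial derivatives of products,
    inverses and composites involve the original functions again, at one order less. *)
Definition Cn_on (R : realType) (m n : nat) (A : set 'rV[R]_m)
    (f : 'rV[R]_m -> R) : Prop :=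
  forall s : seq 'I_m, (size s <= n)%N -> forall x, A x ->
    differentiable (foldr (@partial R m) f s) x.

Section Smooth.
Context {R : realType} {m : nat}.
Context (A : set 'rV[R]_m).
Hypothesis oA : open A.
Implicit Types (f g : 'rV[R]_m -> R).

Lemma smooth_onP f : smooth_on A f <-> forall n, Cn_on n A f.
Proof.
split=> [H n s _ x|H s x]; first exact: H.
exact: (H (size s) s (leqnn _)).
Qed.

(** [foldr] applies the last index of the list first, so lists are taken apart from the right. *)
Lemma CnS n f : Cn_on n.+1 A f <->
  (forall x, A x -> differentiable f x) /\ forall i, Cn_on n A (partial i f).
Proof.
split=> [H|[H1 H2] s].
  split=> [x Ax|i s ss x Ax]; first exact: (H [::] isT).
  have := H (rcons s i); rewrite size_rcons foldr_rcons ltnS => /(_ ss x Ax).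
  by [].
case/lastP: s => [_ //|s i]; rewrite size_rcons foldr_rcons ltnS; exact: H2.
Qed.

Lemma Cn0 f : Cn_on 0 A f <-> forall x, A x -> differentiable f x.
Proof. by split=> [H x|H [|//] _ x]; [exact: (H [::])|exact: H]. Qed.

Lemma Cn_diff n f : Cn_on n A f -> forall x, A x -> differentiable f x.
Proof. by move=> H x; exact: (H [::]). Qed.

Lemma CnW n f : Cn_on n.+1 A f -> Cn_on n A f.
Proof. by move=> H s sn; apply: H; exact: leqW. Qed.

Lemma smooth_onS f : smooth_on A f <->
  (forall x, A x -> differentiable f x) /\ forall i, smooth_on A (partial i f).
Proof.
rewrite smooth_onP; split=> [H|[H1 H2] n].
  by split=> [|i]; [exact: Cn_diff (H 0%N)|apply/smooth_onP => n; apply (CnS n f).1].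
case: n => [|n]; first exact/Cn0.
by apply/CnS; split=> // i; exact: (smooth_onP _).1.
Qed.

Lemma near_eq_differentiable (V W : normedModType R) (f g : V -> W) x :
  (\forall y \near x, f y = g y) -> differentiable f x ->
  differentiable g x.
Proof.
move=> fg df; have fgx := nbhs_singleton fg.
have [||//] := @eps_diff _ _ _ g x ('d f x); first exact: diff_continuous.
move=> e e0; apply: filterS2 fg (diff_eps df e0) => y <-.
by rewrite fgx.
Qed.

Lemma near_open x (Q : 'rV[R]_m -> Prop) : (forall y, A y -> Q y) -> A x ->
  \forall y \near x, Q y.
Proof. by move=> AQ Ax; apply: filterS (open_nbhs_nbhs (conj oA Ax)). Qed.

Lemma eq_partial f g i x : (forall y, A y -> f y = g y) -> A x ->
  partial i f x = partial i g x.
Proof. by move=> fg Ax; apply: near_eq_derive; exact: near_open. Qed.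

Lemma eq_Cn n f g : (forall x, A x -> f x = g x) -> Cn_on n A f -> Cn_on n A g.
Proof.
elim: n f g => [|n IH] f g fg.
  move=> /Cn0 df; apply/Cn0 => x Ax; apply: near_eq_differentiable (df x Ax).
  exact: near_open.
move=> /CnS[df pf]; apply/CnS; split=> [x Ax|i].
  by apply: near_eq_differentiable (df x Ax); exact: near_open.
by apply: IH (pf i) => x; exact: eq_partial.
Qed.

Lemma eq_smooth f g : (forall x, A x -> f x = g x) -> smooth_on A f ->
  smooth_on A g.
Proof. by move=> fg /smooth_onP H; apply/smooth_onP => n; exact: eq_Cn (H n). Qed.

Lemma partialE f i x : differentiable f x -> partial i f x = 'd f x 'e_i.
Proof. exact: deriveE. Qed.

Lemma diff_partial f x v : differentiable f x ->
  'd f x v = \sum_i v 0 i * partial i f x.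
Proof.
move=> df; rewrite [in LHS](row_sum_delta v) linear_sum.
by apply: eq_bigr => i _; rewrite linearZ /= partialE.
Qed.

Lemma partialD f g i x : differentiable f x -> differentiable g x ->
  partial i (fun y => f y + g y) x = partial i f x + partial i g x.
Proof. by move=> df dg; exact: deriveD (diff_derivable df) (diff_derivable dg). Qed.

Lemma partialM f g i x : differentiable f x -> differentiable g x ->
  partial i (fun y => f y * g y) x = partial i f x * g x + f x * partial i g x.
Proof.
move=> df dg.
have := deriveM (diff_derivable (v := 'e_i) df) (diff_derivable (v := 'e_i) dg).
rewrite -/(partial i f x) -/(partial i g x) -[LHS]/(partial i (fun y => f y * g y) x).
by rewrite addrC (mulrC (partial i f x)).
Qed.

Lemma partial_comp (h : R -> R) f i x (l : R) : differentiable f x ->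
  is_derive (f x) 1 h l -> partial i (fun y => h (f y)) x = l * partial i f x.
Proof.
move=> df /is_derive_diff[dh hE].
rewrite partialE; last exact: (differentiable_comp df dh).
by rewrite (diff_comp df dh) /= hE partialE// mulrC.
Qed.

Lemma Cn_cst n (k : R) : Cn_on n A (fun _ => k).
Proof.
have pk i : partial i (fun _ : 'rV[R]_m => k) = fun _ => 0.
  by apply/funext => x; exact: derive_cst.
elim: n k pk => [|n IH] k pk; first by apply/Cn0 => x _; exact: differentiable_cst.
apply/CnS; split=> [x _|i]; first exact: differentiable_cst.
rewrite pk; apply: IH => j; apply/funext => x; exact: derive_cst.
Qed.

Lemma CnD n f g : Cn_on n A f -> Cn_on n A g -> Cn_on n A (fun x => f x + g x).
Proof.
elim: n f g => [|n IH] f g.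
  move=> /Cn0 df /Cn0 dg; apply/Cn0 => x Ax.
  exact: (differentiableD (df x Ax) (dg x Ax)).
move=> /CnS[df pf] /CnS[dg pg]; apply/CnS; split=> [x Ax|i].
  exact: (differentiableD (df x Ax) (dg x Ax)).
apply: eq_Cn (IH _ _ (pf i) (pg i)) => x Ax.
by rewrite partialD//; [exact: df|exact: dg].
Qed.

Lemma CnM n f g : Cn_on n A f -> Cn_on n A g -> Cn_on n A (fun x => f x * g x).
Proof.
elim: n f g => [|n IH] f g.
  move=> /Cn0 df /Cn0 dg; apply/Cn0 => x Ax.
  exact: (differentiableM (df x Ax) (dg x Ax)).
move=> Cf Cg; have /CnS[df pf] := Cf; have /CnS[dg pg] := Cg.
apply/CnS; split=> [x Ax|i].
  exact: (differentiableM (df x Ax) (dg x Ax)).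
apply: eq_Cn (CnD (IH _ _ (pf i) (CnW Cg)) (IH _ _ (CnW Cf) (pg i))) => x Ax.
by rewrite partialM//; [exact: df|exact: dg].
Qed.

Lemma Cn_comp n (B : set R) (h : R -> R) f : smooth_fun_on B h ->
  (forall x, A x -> B (f x)) -> Cn_on n A f -> Cn_on n A (fun x => h (f x)).
Proof.
move=> + AB; elim: n h => [|n IH] h Bh Cf.
  apply/Cn0 => x Ax; apply: (differentiable_comp (Cn_diff Cf Ax)).
  by apply/derivable1_diffP; exact: (Bh 0%N _ (AB x Ax)).
have dh x : A x -> derivable h (f x) 1 by move=> Ax; exact: (Bh 0%N _ (AB x Ax)).
have /CnS[df pf] := Cf; apply/CnS; split=> [x Ax|i].
  by apply: (differentiable_comp (df x Ax)); apply/derivable1_diffP; exact: dh.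
have Bh' : smooth_fun_on B (derive1 h).
  by move=> k t Bt; have := Bh k.+1 t Bt; rewrite derive1Sn.
apply: eq_Cn (CnM (IH _ Bh' (CnW Cf)) (pf i)) => x Ax.
have /derivableP dhx := dh x Ax.
by rewrite (partial_comp i (df x Ax) dhx) derive1E.
Qed.

Lemma CnV n f : (forall x, A x -> f x != 0) -> Cn_on n A f ->
  Cn_on n A (fun x => (f x)^-1).
Proof.
move=> f0; have dV x : A x -> is_derive (f x) 1 GRing.inv (- (f x) ^- 2 : R).
  move=> Ax; apply: is_derive_eq; first exact: (is_deriveV (f0 x Ax) (is_derive_id _ _)).
  by rewrite scaler1.
have dV' x : A x -> differentiable (@GRing.inv R) (f x).
  by move=> /dV/is_derive_diff[].
elim: n => [|n IH] Cf.
  by apply/Cn0 => x Ax; apply: (differentiable_comp (Cn_diff Cf Ax)); exact: dV'.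
have /CnS[df pf] := Cf; have CV := IH (CnW Cf); apply/CnS; split=> [x Ax|i].
  by apply: (differentiable_comp (df x Ax)); exact: dV'.
apply: eq_Cn (CnM (CnM (@Cn_cst n (-1)) (CnM CV CV)) (pf i)) => x Ax.
rewrite (partial_comp i (df x Ax) (dV x Ax)).
by rewrite mulN1r -invfM -expr2.
Qed.

Lemma Cn_sqrt n f : (forall x, A x -> 0 < f x) -> Cn_on n A f ->
  Cn_on n A (fun x => Num.sqrt (f x)).
Proof.
move=> f0.
have dS x : A x -> is_derive (f x) 1 Num.sqrt (2 * Num.sqrt (f x))^-1.
  move=> Ax; exact: is_derive1_sqrt (f0 x Ax).
have dS' x : A x -> differentiable (@Num.sqrt R) (f x).
  by move=> /dS/is_derive_diff[].
elim: n => [|n IH] Cf.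
  by apply/Cn0 => x Ax; apply: (differentiable_comp (Cn_diff Cf Ax)); exact: dS'.
have /CnS[df pf] := Cf; have CS := IH (CnW Cf); apply/CnS; split=> [x Ax|i].
  by apply: (differentiable_comp (df x Ax)); exact: dS'.
have CV := CnV (f := fun x => 2 * Num.sqrt (f x)) _ (CnM (@Cn_cst n 2) CS).
apply: eq_Cn (CnM (CV _) (pf i)) => x Ax.
  by rewrite (partial_comp i (df x Ax) (dS x Ax)).
by rewrite mulf_neq0// gt_eqF// sqrtr_gt0 f0.
Qed.

Lemma smooth_cst (k : R) : smooth_on A (fun _ => k).
Proof. by apply/smooth_onP => n; exact: Cn_cst. Qed.

Lemma smoothD f g : smooth_on A f -> smooth_on A g ->
  smooth_on A (fun x => f x + g x).
Proof. by move=> /smooth_onP F /smooth_onP G; apply/smooth_onP => n; exact: CnD. Qed.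

Lemma smoothM f g : smooth_on A f -> smooth_on A g ->
  smooth_on A (fun x => f x * g x).
Proof. by move=> /smooth_onP F /smooth_onP G; apply/smooth_onP => n; exact: CnM. Qed.

Lemma smoothX f k : smooth_on A f -> smooth_on A (fun x => f x ^+ k).
Proof.
move=> F; elim: k => [|k IH].
  by apply: eq_smooth (smooth_cst 1) => x _; rewrite expr0.
by apply: eq_smooth (smoothM F IH) => x _; rewrite exprS.
Qed.

Lemma smoothV f : (forall x, A x -> f x != 0) -> smooth_on A f ->
  smooth_on A (fun x => (f x)^-1).
Proof. by move=> f0 /smooth_onP F; apply/smooth_onP => n; exact: CnV. Qed.

Lemma smooth_sqrt f : (forall x, A x -> 0 < f x) -> smooth_on A f ->
  smooth_on A (fun x => Num.sqrt (f x)).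
Proof. by move=> f0 /smooth_onP F; apply/smooth_onP => n; exact: Cn_sqrt. Qed.

Lemma smooth_comp (B : set R) (h : R -> R) f : smooth_fun_on B h ->
  (forall x, A x -> B (f x)) -> smooth_on A f -> smooth_on A (fun x => h (f x)).
Proof.
by move=> Bh AB /smooth_onP F; apply/smooth_onP => n; exact: Cn_comp Bh AB _.
Qed.

Lemma smooth_sum (I : Type) (s : seq I) (F : I -> 'rV[R]_m -> R) :
  (forall i, smooth_on A (F i)) -> smooth_on A (fun x => \sum_(i <- s) F i x).
Proof.
move=> H; elim: s => [|i s IH].
  by apply: eq_smooth (smooth_cst 0) => x _; rewrite big_nil.
by apply: eq_smooth (smoothD (H i) IH) => x _; rewrite big_cons.
Qed.

Lemma smooth_prod (I : Type) (s : seq I) (F : I -> 'rV[R]_m -> R) :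
  (forall i, smooth_on A (F i)) -> smooth_on A (fun x => \prod_(i <- s) F i x).
Proof.
move=> H; elim: s => [|i s IH].
  by apply: eq_smooth (smooth_cst 1) => x _; rewrite big_nil.
by apply: eq_smooth (smoothM (H i) IH) => x _; rewrite big_cons.
Qed.

Lemma smooth_det n (G : 'rV[R]_m -> 'M[R]_n) :
  (forall i j, smooth_on A (fun x => G x i j)) ->
  smooth_on A (fun x => \det (G x)).
Proof.
move=> H; rewrite /determinant; apply: smooth_sum => s.
by apply: smoothM; [exact: smooth_cst|apply: smooth_prod => i; exact: H].
Qed.

Lemma smooth_invmx n (G : 'rV[R]_m -> 'M[R]_n) :
  (forall x, A x -> G x \in unitmx) ->
  (forall i j, smooth_on A (fun x => G x i j)) ->
  forall i j, smooth_on A (fun x => invmx (G x) i j).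
Proof.
move=> Gu H i j.
have H1 : smooth_on A (fun x => (\det (G x))^-1 * cofactor (G x) j i).
  apply: smoothM.
    apply: smoothV; last exact: smooth_det.
    by move=> x /Gu; rewrite unitmxE unitfE.
  apply: smoothM; first exact: smooth_cst.
  apply: smooth_det => k l.
  by apply: eq_smooth (H (lift j k) (lift i l)) => x _; rewrite !mxE.
by apply: eq_smooth H1 => x Ax; rewrite /invmx Gu// !mxE.
Qed.

Lemma smooth_continuous f x : smooth_on A f -> A x -> {for x, continuous f}.
Proof.
by move=> /smooth_onS[df _] Ax; exact: (differentiable_continuous (df x Ax)).
Qed.

End Smooth.

(** * Hopf's boundary point lemma *)

Section Hopf.
Context {R : realType}.

Lemma second_derivative_min (p p1 : R -> R) (l : R) :
  (\forall t \near (0 : R), is_derive (t : R) 1 p (p1 t)) -> is_derive (0 : R) 1 p1 l ->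
  (\forall t \near (0 : R), p 0 <= p t) -> p1 0 = 0 /\ 0 <= l.
Proof.
move=> dp dp1 pmin.
have /nbhs_ballP[d /= d0 Hd] : \forall t \near (0 : R),
    is_derive (t : R) 1 p (p1 t) /\ p 0 <= p t by near=> t; split; near: t.
have Hd' t : t \in `]-d, d[ -> is_derive (t : R) 1 p (p1 t) /\ p 0 <= p t.
  by rewrite in_itv/= => td; apply: Hd; rewrite /ball/= sub0r normrN ltr_norml.
have d00 : 0 \in `]-d, d[ by rewrite in_itv/= oppr_lt0 d0.
have p10 : p1 0 = 0.
  have [dp0 _] := Hd' 0 d00.
  have dq : is_derive (0 : R) 1 p 0.
    apply: (@derive1_at_min R p (-d) d) => //.
    - by apply: (@le_trans _ _ 0); rewrite ?oppr_le0 ltW.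
    - by move=> t /Hd'[/is_derive_derivable].
    - by move=> t /Hd'[].
  by case: dp0 => _ <-; case: dq.
split=> //; rewrite leNgt; apply/negP => l0.
have := is_derive_rderiv dp1; rewrite /rderiv => /cvgr_lt/(_ 0 l0) Hl.
have [e e0 He] : exists2 e, 0 < e < d & forall h, 0 < h <= e -> p1 h < 0.
  have [e' /= e'0 He'] := Hl; pose e := Num.min (e' / 2) (d / 2).
  have e0 : 0 < e by rewrite lt_min !divr_gt0.
  exists e; first by rewrite e0 gt_min; apply/orP; right; lra.
  move=> h /andP[h0]; rewrite le_min => /andP[he _].
  have := He' h; rewrite /ball_/= sub0r normrN gtr0_norm// => /(_ _ h0).
  by rewrite p10 add0r subr0 pmulr_rlt0 ?invr_gt0//; apply; lra.
case/andP: e0 => e0 ed.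
have [||x + pE] := @MVT R p p1 0 e e0.
- move=> x; rewrite in_itv/= => /andP[x0 xe].
  by have [|//] := Hd' x; rewrite in_itv/= (lt_trans xe ed) andbT; lra.
- apply: derivable_within_continuous => x; rewrite in_itv/= => /andP[x0 xe].
  by have [|/is_derive_derivable//] := Hd' x; rewrite in_itv/=; lra.
rewrite in_itv/= => /andP[x0 xe].
have [_ pe] : is_derive (e : R) 1 p (p1 e) /\ p 0 <= p e by apply: Hd'; rewrite in_itv/=; lra.
have : p e - p 0 < 0.
  by rewrite pE subr0 pmulr_llt0//; apply: He; rewrite x0 ltW.
by rewrite subr_lt0 ltNge pe.
Unshelve. all: by end_near. Qed.

(** On a line the Gaussian barrier of Hopf's lemma is the exponential of a quadratic polynomial;
    differentiating along lines replaces the calculus of its gradient and Hessian. *)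
Lemma gauss_derive (a b c : R) (t : R) :
  is_derive t 1 (fun s => expR (a + b * s + c * s ^+ 2))
    ((b + 2 * c * t) * expR (a + b * t + c * t ^+ 2)).
Proof.
have dq : is_derive t 1 (fun s : R => a + b * s + c * s ^+ 2) (b + 2 * c * t).
  have -> : (fun s : R => a + b * s + c * s ^+ 2) =
      ((cst a + b \*: id) + c \*: (id ^+ 2)).
    by apply/funext => s; rewrite !fctE.
  apply: is_derive_eq; rewrite /GRing.scale/=; ring.
have H := is_derive1_comp (is_derive_expR _) dq.
by apply: is_derive_eq H _; rewrite mulrC.
Qed.

Lemma gauss_derive2 (a b c : R) :
  is_derive (0 : R) 1 (fun s => (b + 2 * c * s) * expR (a + b * s + c * s ^+ 2))
    ((b ^+ 2 + 2 * c) * expR a).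
Proof.
have dl : is_derive (0 : R) 1 (fun s : R => b + 2 * c * s) (2 * c).
  have := is_derive_line b (2 * c) (0 : R).
  have -> // : (fun s : R => b + s *: (2 * c)) = (fun s : R => b + 2 * c * s).
  by apply/funext => s; rewrite /GRing.scale/= mulrC.
have := is_deriveM dl (gauss_derive a b c 0).
rewrite mulr0 expr0n/= !mulr0 !addr0 => H; apply: is_derive_eq H _.
by rewrite /GRing.scale/=; ring.
Qed.

Lemma line_derive m (f : 'rV[R]_m -> R) (y u : 'rV[R]_m) (t : R) :
  differentiable f (y + t *: u) ->
  is_derive t 1 (fun s => f (y + s *: u))
    (\sum_i u 0 i * partial i f (y + t *: u)).
Proof.
move=> df; have [dl lE] := is_derive_line y u t.
have dl' : differentiable (fun s : R => y + s *: u) t by exact/derivable1_diffP.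
have dc := differentiable_comp dl' df.
split; first exact/derivable1_diffP.
rewrite deriveE//; have -> : (fun s : R => f (y + s *: u)) = f \o (fun s : R => y + s *: u).
  by [].
rewrite (diff_comp dl' df) /= diff1E// scale1r derive1E lE.
by rewrite diff_partial.
Qed.

Lemma line_derive2 m (A : set 'rV[R]_m) (f : 'rV[R]_m -> R) (y u : 'rV[R]_m) :
  open A -> smooth_on A f -> A y ->
  is_derive (0 : R) 1 (fun s => \sum_i u 0 i * partial i f (y + s *: u))
    (\sum_i \sum_j u 0 i * u 0 j * partial j (partial i f) y).
Proof.
move=> oA /smooth_onS[_ sf] Ay.
pose F i := fun s : R => u 0 i * partial i f (y + s *: u).
have dF i : is_derive (0 : R) 1 (F i)
    (\sum_j u 0 i * u 0 j * partial j (partial i f) y).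
  have /smooth_onS[dpf _] := sf i.
  have y0 : y + (0 : R) *: u = y by rewrite scale0r addr0.
  have dpf0 : differentiable (partial i f) (y + (0 : R) *: u) by rewrite y0; exact: dpf.
  have H := is_deriveZ (u 0 i) (line_derive dpf0).
  have -> : F i = u 0 i \*: (fun s => partial i f (y + s *: u)) by [].
  apply: is_derive_eq H _; rewrite y0 /GRing.scale/= mulr_sumr.
  by apply: eq_bigr => j _; rewrite mulrA.
have := is_derive_sum dF.
by have -> // : \sum_(i < m) F i = (fun s => \sum_i u 0 i * partial i f (y + s *: u));
  apply/funext => s; rewrite fct_sumE.
Qed.

Lemma qf1_line m (d u : 'rV[R]_m) (s : R) :
  qf 1%:M (d + s *: u) (d + s *: u) =
  qf 1%:M d d + 2 * s * qf 1%:M d u + s ^+ 2 * qf 1%:M u u.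
Proof.
rewrite qfDl !qfDr !qfZl !qfZr (qfC u d (trmx1 _ _)); ring.
Qed.

Lemma sum_delta m (j : 'I_m) (F : 'I_m -> R) :
  \sum_i ('e_j : 'rV[R]_m) 0 i * F i = F j.
Proof.
rewrite (bigD1 j)//= mxE !eqxx mul1r big1 ?addr0// => i ij.
by rewrite mxE (negbTE ij) mul0r.
Qed.

Lemma norm_le_euclidean m (v : 'rV[R]_m) : `|v| <= Num.sqrt (qf 1%:M v v).
Proof.
rewrite [leLHS]mx_normrE; apply: bigmax_le; first exact: sqrtr_ge0.
move=> [i j] _ /=; rewrite (ord1 i) -sqrtr_sqr ler_wsqrtr// qf1E (bigD1 j)//=.
by rewrite expr2 lerDl sumr_ge0// => k _; rewrite -expr2 sqr_ge0.
Qed.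

Lemma qf1_continuous m (z y : 'rV[R]_m) :
  {for y, continuous (fun x : 'rV[R]_m => qf 1%:M (x - z) (x - z))}.
Proof.
have H : (x - z) @[x --> y] --> y - z.
  apply: (@cvgB _ _ _ (nbhs y)); [exact: cvg_id|exact: cvg_cst].
exact: (cvg_qf (A := fun _ => 1%:M) (fun i j => cvg_cst _) H H).
Qed.

Lemma euclidean_annulus_compact m (z : 'rV[R]_m) (s t : R) :
  compact [set y : 'rV[R]_m | s <= qf 1%:M (y - z) (y - z) <= t].
Proof.
apply: bounded_closed_compact.
  exists (Num.sqrt t + `|z|); split; first exact: num_real.
  move=> x hx y /= /andP[_ yt]; apply: ltW; apply: le_lt_trans hx.
  rewrite -(subrK z y); apply: le_trans (ler_normD _ _) _; rewrite lerD2r.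
  by apply: le_trans (norm_le_euclidean _) _; rewrite ler_wsqrtr.
have -> : [set y : 'rV[R]_m | s <= qf 1%:M (y - z) (y - z) <= t] =
    (fun y : 'rV[R]_m => qf 1%:M (y - z) (y - z)) @^-1` `[s, t]%classic.
  by apply/seteqP; split=> y /=; rewrite in_itv.
apply: preimage_closed; last exact: itv_closed.
by move=> y _; exact: qf1_continuous.
Qed.

(** For [V = exp (- al |d|^2)] with [d = y - z], the matrix subtracted from [D2] is the Hessian of
    [m0 * V] when [k = m0 * V], [c = 4 al^2] and [e = 2 al]. *)
Lemma trace_hessian_gauss m (a D2 : 'M[R]_m) (d : 'rV[R]_m) (k c e : R) :
  \sum_i \sum_j a i j * (D2 - k *: (c *: (d^T *m d) - e *: 1%:M)) i j =
  \sum_i \sum_j a i j * D2 i j - k * (c * qf a d d - e * \sum_i a i i).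
Proof.
have -> : \sum_i a i i = \sum_i \sum_j a i j * (1%:M : 'M[R]_m) i j.
  apply: eq_bigr => i _; rewrite (bigD1 i)//= mxE eqxx mulr1 big1 ?addr0// => j ji.
  by rewrite mxE eq_sym (negbTE ji) mulr0.
rewrite qfE !mulrBr !mulr_sumr -!sumrB; apply: eq_bigr => i _.
rewrite !mulr_sumr -!sumrB; apply: eq_bigr => j _.
rewrite !mxE big_ord1 !mxE; ring.
Qed.

Lemma qf_hessian_gauss m (D2 : 'M[R]_m) (d u : 'rV[R]_m) (k c e : R) :
  qf (D2 - k *: (c *: (d^T *m d) - e *: 1%:M)) u u =
  qf D2 u u - k * (c * qf 1%:M d u ^+ 2 - e * qf 1%:M u u).
Proof.
rewrite qfDm -scaleNr qfZ qfDm qfZ -scaleNr qfZ.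
have -> : qf (d^T *m d) u u = qf 1%:M d u ^+ 2.
  rewrite /qf mulmxA -[LHS]/((u *m d^T *m d *m u^T) 0 0) -mulmxA mxE big_ord1.
  rewrite mulmx1 expr2; congr (_ * _).
  by rewrite -[u *m d^T]trmxK trmx_mul trmxK mxE.
ring.
Qed.

(* Hopf's boundary point lemma, by comparison with the Gaussian barrier
   [exp (- al |y - z|^2)] on the annulus [|x - z|/2 <= |y - z| <= |x - z|]. *)
Lemma hopf m (A : set 'rV[R]_m) (w : 'rV[R]_m -> R) (a : 'rV[R]_m -> 'M[R]_m)
    (b : 'I_m -> 'rV[R]_m -> R) (z x : 'rV[R]_m) :
  open A -> smooth_on A w ->
  (forall y, A y -> posdef (a y)) -> (forall y, A y -> cont_at a y) ->
  (forall j y, A y -> {for y, continuous (b j)}) ->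
  (forall y, A y -> \sum_i \sum_j a y i j * partial i (partial j w) y +
    \sum_j b j y * partial j w y = 0) ->
  x != z -> w x = 0 ->
  (forall y, qf 1%:M (y - z) (y - z) <= qf 1%:M (x - z) (x - z) -> A y) ->
  (forall y, qf 1%:M (y - z) (y - z) <= qf 1%:M (x - z) (x - z) -> y != x ->
    0 < w y) ->
  ~ (forall j, partial j w x = 0).
Proof.
move=> oA sw pa ca cb Lw xz wx DA wD gx.
set q := fun y : 'rV[R]_m => qf 1%:M (y - z) (y - z).
pose Q := q x; have Q0 : 0 < Q by apply: qf1_gt0; rewrite subr_eq0.
have cq y : {for y, continuous q} by exact: qf1_continuous.
have Ax : A x by exact: DA.
pose K := [set y | Q / 4 <= q y <= Q].
have cK : compact K by exact: euclidean_annulus_compact.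
have Q4 : Q / 4 < Q by rewrite ltr_pdivrMr// ltr_pMr// (ltr_nat R 1).
have Kx : K x by rewrite /K/= lexx (ltW Q4).
have KA y : K y -> A y by move=> /andP[_]; exact: DA.
have w_ge0 y : q y <= Q -> 0 <= w y.
  by move=> yQ; have [->|yx] := eqVneq y x; [rewrite wx|exact/ltW/wD].
(* The operator maps the barrier [V] to [V * (4 al^2 qf a d d - 2 al tb)], with [d = y - z]. This is
   positive on the annulus once [al] exceeds the maximum of [f1]. *)
pose tb y := \sum_i a y i i + \sum_j b j y * (y - z) 0 j.
pose f1 y := tb y / (2 * qf (a y) (y - z) (y - z)).
have qa0 y : K y -> 0 < qf (a y) (y - z) (y - z).
  move=> Ky; apply: (pa _ (KA _ Ky)).2; apply/negP => /eqP yz.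
  have : q y = 0 by rewrite /q yz qf0l.
  case/andP: Ky => + _ => /[swap] ->.
  by rewrite leNgt divr_gt0.
have cf1 : {within K, continuous f1}.
  apply: continuous_in_subspaceT => y; rewrite inE => Ky; have Ay := KA _ Ky.
  have H : (y' - z) @[y' --> y] --> y - z.
    by apply: (@cvgB _ _ _ (nbhs y)); [exact: cvg_id|exact: cvg_cst].
  have c1 : tb y' @[y' --> y] --> tb y.
    apply: (@cvgD _ _ _ (nbhs y)).
      by apply: (@cvg_sumr R _ (nbhs y)) => i; exact: ca.
    apply: (@cvg_sumr R _ (nbhs y)) => j; apply: (@cvgM _ _ (nbhs y)).
      exact: cb.
    exact: (cvg_coord (F := nbhs y) H).
  have c2 : 2 * qf (a y') (y' - z) (y' - z) @[y' --> y] -->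
      2 * qf (a y) (y - z) (y - z).
    apply: (@cvgM _ _ (nbhs y)); first exact: cvg_cst.
    exact: (cvg_qf (ca y Ay) H H).
  apply: (@cvgM _ _ (nbhs y) _ _ _ _ _ c1); apply: (@cvgV _ _ (nbhs y)) c2.
  by rewrite mulf_neq0// gt_eqF// qa0.
have [y1 _ Hy1] := EVT_max_rV (ex_intro _ x Kx) cK cf1.
pose al := Num.max (f1 y1) 0 + 1.
have al0 : 0 < al by rewrite ltr_wpDl// le_max lexx orbT.
have KI y : K y -> 0 < 4 * al ^+ 2 * qf (a y) (y - z) (y - z) - 2 * al * tb y.
  move=> Ky; have : f1 y < al.
    rewrite /al; apply: le_lt_trans (_ : f1 y1 < _); first by apply: Hy1; rewrite inE.
    by rewrite (le_lt_trans (y := Num.max (f1 y1) 0))// ?le_max ?lexx// ltrDl.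
  have qy := qa0 _ Ky.
  rewrite /f1 ltr_pdivrMr ?mulr_gt0// => H.
  rewrite (_ : _ - _ = 2 * al * (al * (2 * qf (a y) (y - z) (y - z)) - tb y));
    last by ring.
  by rewrite !mulr_gt0// subr_gt0.
pose V y := expR (- al * q y); pose V0 := expR (- al * Q).
have V0x : V x = V0 by [].
have VleV0 y : q y = Q -> V y = V0 by rewrite /V => ->.
have V1 y : V y <= 1.
  by rewrite -expR0 ler_expR mulNr oppr_le0 mulr_ge0 ?(ltW al0)// qf1_ge0.
have V00 : 0 < V0 := expR_gt0 _.
have cw y : A y -> {for y, continuous w} by move=> Ay; exact: smooth_continuous sw Ay.
(* The inner sphere, written as an annulus so that its compactness is at hand. It misses [x], so [w]
   has a positive minimum [m0] there; as [V - V0 <= 1], this gives [W >= 0] on it. *)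
pose K1 := [set y | Q / 4 <= q y <= Q / 4].
have K1K y : K1 y -> K y.
  by rewrite /K/= /K1/= => /andP[-> /le_trans]; apply; exact: ltW.
have [m0 m00 Hm0] : exists2 m0, 0 < m0 & forall y, K1 y -> m0 <= w y.
  have [K10|K10] := pselect (K1 !=set0); last by exists 1 => // y Ky; case: K10; exists y.
  have cK1 : compact K1 by exact: euclidean_annulus_compact.
  have cw1 : {within K1, continuous w}.
    by apply: continuous_in_subspaceT => y; rewrite inE => Ky; exact/cw/KA/K1K.
  have [y2 + Hy2] := EVT_min_rV K10 cK1 cw1; rewrite inE => Ky2.
  exists (w y2); last by move=> y Ky; apply: Hy2; rewrite inE.
  apply: wD; first by case/andP: (K1K _ Ky2).
  apply/negP => /eqP yx; move: Ky2; rewrite /K1/= yx => /andP[_].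
  by rewrite leNgt Q4.
pose W y := w y - m0 * (V y - V0).
have cV y : {for y, continuous V}.
  apply: (@continuous_for_comp _ _ _ (fun y => - al * q y) expR).
    by apply: continuous_forM; [exact: cst_continuous|exact: cq].
  exact: continuous_expR.
have cW : {within K, continuous W}.
  apply: continuous_in_subspaceT => y; rewrite inE => Ky.
  apply: (@cvgB _ _ _ (nbhs y)); first exact/cw/KA.
  apply: (@cvgM _ _ (nbhs y)); first exact: cvg_cst.
  by apply: (@cvgB _ _ _ (nbhs y)); [exact: cV|exact: cvg_cst].
have Wx : W x = 0 by rewrite /W wx V0x subrr mulr0 subr0.
have [y0 + Hy0] := EVT_min_rV (ex_intro _ x Kx) cK cW; rewrite inE => Ky0.
(* A negative minimum would be interior, because [W >= 0] on both boundary spheres. There the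
   gradient of [W] vanishes and its Hessian is nonnegative, so the operator is nonnegative on [W];
   but it maps [W] to [- m0] times its value on [V], which is negative. *)
have W_ge0 : 0 <= W y0.
  rewrite leNgt; apply/negP => Wneg; have /andP[q1 q2] := Ky0.
  have q2' : q y0 < Q.
    rewrite lt_neqAle q2 andbT; apply/negP => /eqP e; move: Wneg.
    by rewrite /W VleV0// subrr mulr0 subr0 ltNge w_ge0.
  have q1' : Q / 4 < q y0.
    rewrite lt_neqAle q1 andbT; apply/negP => /eqP e; move: Wneg.
    have /Hm0 m0w : K1 y0 by rewrite /K1/= e lexx.
    rewrite ltNge /W subr_ge0 (le_trans _ m0w)// ger_pMr// lerBlDr.
    by rewrite (le_trans (V1 _))// lerDl ltW.
  have nK : \forall y \near y0, K y.
    have n1 := cvgr_gt _ (cq y0) _ q1'; have n2 := cvgr_lt _ (cq y0) _ q2'.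
    by apply: filterS2 (n1 _) (n2 _) => y h1 h2; rewrite /K/= !ltW.
  have nl u : \forall s \near (0 : R), K (y0 + s *: u).
    have := derivable_cvg (is_derive_derivable (is_derive_line y0 u 0)).
    by rewrite scale0r addr0; apply.
  pose d := y0 - z; pose D2 := \matrix_(i, j) partial i (partial j w) y0.
  have Ay0 := KA _ Ky0.
  have key (u : 'rV[R]_m) : \sum_i u 0 i * partial i w y0 =
        m0 * (- 2 * al * qf 1%:M d u * V y0) /\
      0 <= qf (D2 - (m0 * V y0) *: ((4 * al ^+ 2) *: (d^T *m d) -
        (2 * al) *: 1%:M)) u u.
    pose A0 := - al * q y0; pose B0 := - 2 * al * qf 1%:M d u.
    pose C0 := - al * qf 1%:M u u.
    have VE s : V (y0 + s *: u) = expR (A0 + B0 * s + C0 * s ^+ 2).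
      rewrite /V /q addrAC -/d qf1_line /A0 /B0 /C0 -[q y0]/(qf 1%:M d d).
      by congr expR; ring.
    pose p1 s := \sum_i u 0 i * partial i w (y0 + s *: u) -
      m0 * ((B0 + 2 * C0 * s) * expR (A0 + B0 * s + C0 * s ^+ 2)).
    have WE : (fun s => W (y0 + s *: u)) = (fun s => w (y0 + s *: u)) -
       (m0 \*: ((fun s => expR (A0 + B0 * s + C0 * s ^+ 2)) - cst V0)).
      by apply/funext => s; rewrite /W VE !fctE.
    have /smooth_onS[dw _] := sw.
    have [|||] := @second_derivative_min (fun s => W (y0 + s *: u)) p1
      (\sum_i \sum_j u 0 i * u 0 j * partial j (partial i w) y0 -
        m0 * ((B0 ^+ 2 + 2 * C0) * expR A0)).
    - apply: filterS (nl u) => t Kt; rewrite WE.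
      have L := line_derive (dw _ (KA _ Kt)).
      have H := is_deriveB L (is_deriveZ m0 (is_deriveB
        (gauss_derive A0 B0 C0 t) (is_derive_cst V0 t 1))).
      by apply: is_derive_eq H _; rewrite subr0.
    - have L2 := line_derive2 u oA sw Ay0.
      have := is_deriveB L2 (is_deriveZ m0 (gauss_derive2 A0 B0 C0)).
      by have -> : p1 = (fun s => \sum_i u 0 i * partial i w (y0 + s *: u)) -
        (m0 \*: (fun s => (B0 + 2 * C0 * s) * expR (A0 + B0 * s + C0 * s ^+ 2)))
        by apply/funext => s; rewrite /p1 !fctE.
    - apply: filterS (nl u) => t Kt; rewrite scale0r addr0.
      by apply: Hy0; rewrite inE.
    have V0E : expR A0 = V y0 by [].
    rewrite /p1 scale0r addr0 mulr0 expr0n/= !mulr0 !addr0 V0E => e1 e2; split.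
      by apply/eqP; rewrite -subr_eq0 e1.
    rewrite qf_hessian_gauss; apply: le_trans e2 _; rewrite le_eqVlt.
    apply/orP; left; apply/eqP; congr (_ - _); last by rewrite /B0 /C0; ring.
    rewrite qfE exchange_big/=; apply: eq_bigr => i _; apply: eq_bigr => j _.
    by rewrite mxE; ring.
  have T := posdef_trace (pa _ Ay0) (fun u => (key u).2).
  rewrite trace_hessian_gauss in T.
  have E : \sum_j b j y0 * partial j w y0 =
      m0 * (- 2 * al * V y0 * \sum_j b j y0 * d 0 j).
    rewrite !mulr_sumr; apply: eq_bigr => j _.
    have := (key 'e_j).1.
    rewrite (sum_delta j (fun i => partial i w y0)) qf1E.
    under eq_bigr do rewrite mulrC.
    rewrite (sum_delta j (fun i => d 0 i)) => ->.
    by ring.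
  have := Lw y0 Ay0; rewrite E => L0.
  have := KI y0 Ky0; rewrite -/d /tb -/d => I0.
  have mV : 0 < m0 * V y0 by rewrite mulr_gt0// expR_gt0.
  have TE : \sum_i \sum_j a y0 i j * D2 i j =
     \sum_i \sum_j a y0 i j * partial i (partial j w) y0.
    by apply: eq_bigr => i _; apply: eq_bigr => j _; rewrite mxE.
  rewrite TE in T;
  have : 0 < m0 * V y0 * (4 * al ^+ 2 * qf (a y0) d d -
     2 * al * (\sum_i a y0 i i + \sum_j b j y0 * d 0 j)) by rewrite mulr_gt0.
  rewrite ltNge => /negP; apply; rewrite -oppr_ge0.
  move: L0 T; set X := \sum_i \sum_j _; set Y := \sum_j _; set Z := \sum_i _.
  move=> L0 T; rewrite [leRHS](_ : _ = (X - m0 * V y0 *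
      (4 * al ^+ 2 * qf (a y0) d d - 2 * al * Z)) -
    (X + m0 * (- 2 * al * V y0 * Y))); last by ring.
  by rewrite L0 subr0.
(* From [x] towards the centre: the derivative of [w] is 0 by assumption and that of [V] is
   positive, so [W] becomes negative right after [W x = 0]. *)
pose u := z - x; pose d := x - z.
have ud : u = - d by rewrite /u /d opprB.
pose A0 := - al * Q; pose B0 := 2 * al * Q; pose C0 := - al * Q.
have qd : qf 1%:M d d = Q by [].
have qE s : q (x + s *: u) = (1 - s) ^+ 2 * Q.
  rewrite /q addrAC -/d qf1_line ud.
  have -> : - d = (-1) *: d by rewrite scaleN1r.
  by rewrite !qfZr !qfZl qd; ring.
have VE s : V (x + s *: u) = expR (A0 + B0 * s + C0 * s ^+ 2).
  by rewrite /V qE /A0 /B0 /C0; congr expR; ring.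
have WE : (fun s => W (x + s *: u)) = (fun s => w (x + s *: u)) -
    (m0 \*: ((fun s => expR (A0 + B0 * s + C0 * s ^+ 2)) - cst V0)).
  by apply/funext => s; rewrite /W VE !fctE.
have x0 : x + (0 : R) *: u = x by rewrite scale0r addr0.
have /smooth_onS[dw _] := sw.
have dw0 : differentiable w (x + (0 : R) *: u) by rewrite x0; exact: dw.
have dW : is_derive (0 : R) 1 (fun s => W (x + s *: u)) (- (m0 * (B0 * V0))).
  rewrite WE; have H := is_deriveB (line_derive dw0) (is_deriveZ m0 (is_deriveB
    (gauss_derive A0 B0 C0 0) (is_derive_cst V0 (0 : R) 1))).
  apply: is_derive_eq H _; rewrite x0 big1 => [|i _]; last by rewrite gx mulr0.
  by rewrite mulr0 expr0n/= !mulr0 !addr0 sub0r subr0.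
have := is_derive_rderiv dW; rewrite /rderiv => /cvgr_lt/(_ 0).
rewrite oppr_lt0 !mulr_gt0// => /(_ isT) Hn.
near (0 : R)^'+ => s.
have s0 : 0 < s by near: s; exact: nbhs_right_gt.
have s2 : s < 1 / 2 by near: s; apply: nbhs_right_lt; rewrite divr_gt0.
have : s^-1 * (W (x + (0 + s) *: u) - W (x + 0 *: u)) < 0 by near: s.
rewrite add0r x0 Wx subr0 pmulr_rlt0 ?invr_gt0// ltNge => /negP; apply.
apply: le_trans W_ge0 _; apply: Hy0; rewrite inE /K/= qE.
have -> : Q / 4 = (1 / 2) ^+ 2 * Q by field.
rewrite ler_pM2r// ger_pMl//; apply/andP; split; nra.
Unshelve. all: by end_near. Qed.

End Hopf.

(** * Radial harmonic functions *)

Definition grad (R : realType) (m : nat) (f : 'rV[R]_m -> R) (x : 'rV[R]_m) :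
  'rV[R]_m := \row_i partial i f x.

Definition gradnorm (R : realType) (m : nat) (G : 'rV[R]_m -> 'M[R]_m)
    (f : 'rV[R]_m -> R) (x : 'rV[R]_m) : R := gnorm (invmx (G x)) (grad f x).

Lemma last_crossing (R : realType) (phi : R -> R) (al be a : R) : al <= be ->
  cts al be phi -> phi al <= a -> a < phi be ->
  exists t, [/\ al <= t <= be, phi t = a &
    forall u, t <= u <= be -> a <= phi u].
Proof.
move=> ab cphi pa pb.
pose S := [set t | al <= t <= be /\ phi t <= a].
have Sal : S al by split=> //; rewrite lexx.
have supS : has_sup S by split; [exists al|exists be => t [/andP[]]].
pose t := sup S.
have alt : al <= t by exact: (ub_le_sup supS.2).
have tbe : t <= be by apply: ge_sup; [exists al|move=> u [/andP[]]].
have tab : al <= t <= be by rewrite alt tbe.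
have St : phi t <= a.
  rewrite leNgt; apply/negP => at_.
  have := cvgr_gt _ (cphi t tab) _ at_ => /(_ _).
  rewrite near_withinE => /nbhs_ballP[d /= d0 Hd].
  have [u [uab ua] ut] := sup_adherent d0 supS.
  have ut' : u <= t by exact: (ub_le_sup supS.2).
  have := Hd u; rewrite /ball/= in_itv/= ger0_norm ?subr_ge0// -/t => H.
  have : a < phi u by apply: H => //; rewrite ltrBlDl -ltrBlDr.
  by rewrite ltNge ua.
have gt_t u : t < u -> u <= be -> a < phi u.
  move=> tu ub; rewrite ltNge; apply/negP => ua.
  have : u <= t by apply: (ub_le_sup supS.2); rewrite /S/= ub ua (le_trans alt (ltW tu)).
  by rewrite leNgt tu.
have tb : t < be.
  by rewrite lt_neqAle tbe andbT; apply/negP => /eqP E; move: pb; rewrite -E ltNge St.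
have pta : phi t = a.
  apply/le_anti; rewrite St /= leNgt; apply/negP => at_.
  have := cvgr_lt _ (cphi t tab) _ at_ => /(_ _).
  rewrite near_withinE => /nbhs_ballP[d /= d0 Hd].
  pose h := Num.min (d / 2) (be - t).
  have h0 : 0 < h by rewrite lt_min divr_gt0// subr_gt0.
  have hd : h < d by rewrite gt_min; apply/orP; left; lra.
  have hb : t + h <= be by rewrite -lerBrDl ge_min lexx orbT.
  have := Hd (t + h); rewrite /ball/= in_itv/= opprD addNKr normrN gtr0_norm//.
  rewrite hb (le_trans alt) ?lerDl ?(ltW h0)// => /(_ hd isT).
  by rewrite ltNge (ltW (gt_t _ _ hb))// ltrDl.
exists t; split=> // u /andP[tu ub].
have [<-|ne] := eqVneq t u; first by rewrite pta.
by apply/ltW/gt_t => //; rewrite lt_neqAle ne.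
Qed.

(** Let [x] be a point of [r >= c] nearest to [z]. The open ball about [z] through [x] lies in
    [r < c], but its sphere may meet [r = c] elsewhere; the ball about the midpoint [z'] through [x]
    touches that sphere only at [x]. *)
Lemma touching_ball (R : realType) m (r : 'rV[R]_m -> R) z x0 c :
  (forall y, qf 1%:M (y - z) (y - z) <= qf 1%:M (x0 - z) (x0 - z) ->
    {for y, continuous r}) -> r z < c -> r x0 = c ->
  exists z' x, [/\ x != z', r x = c,
    qf 1%:M (x - z) (x - z) <= qf 1%:M (x0 - z) (x0 - z) &
    forall y, qf 1%:M (y - z') (y - z') <= qf 1%:M (x - z') (x - z') ->
      qf 1%:M (y - z) (y - z) <= qf 1%:M (x0 - z) (x0 - z) /\
      (y != x -> r y < c)].
Proof.
move=> cr rz rx0; pose q y := qf 1%:M (y - z) (y - z); pose Q := q x0.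
pose K := [set y | q y <= Q /\ c <= r y].
have Kx0 : K x0 by rewrite /K/= rx0 !lexx.
have cB : compact [set y : 'rV[R]_m | 0 <= q y <= Q].
  exact: euclidean_annulus_compact.
have cK : compact K.
  apply: (subclosed_compact _ cB); last by move=> y [yQ _]; rewrite /= qf1_ge0.
  move=> y clKy.
  have yQ : q y <= Q.
    have clB : closed [set y : 'rV[R]_m | 0 <= q y <= Q].
      by apply: compact_closed cB; exact: norm_hausdorff.
    suff /andP[] : 0 <= q y <= Q by [].
    apply: clB; apply: closureS clKy => u [uQ _]; by rewrite /= qf1_ge0.
  split=> //; rewrite leNgt; apply/negP => yc.
  have n1 := cvgr_lt _ (cr y yQ) _ yc.
  by have [u [[_ +] ] ] := clKy _ (n1 _); rewrite leNgt => /negP.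
have cq : {within K, continuous q}.
  by apply: continuous_in_subspaceT => y _; exact: qf1_continuous.
have [x + xmin] := EVT_min_rV (ex_intro _ x0 Kx0) cK cq; rewrite inE => -[xQ xc].
have lt_c y : q y < q x -> r y < c.
  move=> yx; rewrite ltNge; apply/negP => cy.
  have : q x <= q y by apply: xmin; rewrite inE; split=> //; rewrite (le_trans (ltW yx)).
  by rewrite leNgt yx.
have xz : x != z by apply: contraTneq xc => ->; rewrite -ltNge.
have q0 : 0 < q x by rewrite qf1_gt0// subr_eq0.
(* If [r x > c], a small move towards [z] would stay in [r > c] and be nearer to [z]. *)
have rx : r x = c.
  apply/le_anti; rewrite xc andbT leNgt; apply/negP => cx.
  have cl : {for (0 : R), continuous (fun t : R => x + t *: (z - x))}.
    exact: derivable_cvg (is_derive_derivable (is_derive_line x (z - x) 0)).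
  have crx : {for x + (0 : R) *: (z - x), continuous r}.
    by rewrite scale0r addr0; exact: cr.
  have := cvgr_gt _ (continuous_for_comp cl crx) c.
  rewrite /= scale0r addr0 => /(_ _ cx) n1.
  have n2 : \forall t \near (0 : R)^'+, c < r (x + t *: (z - x)).
    by apply: cvg_at_right_filter; [exact: cvg_id|exact: n1].
  near (0 : R)^'+ => t.
  have t0 : 0 < t by near: t; exact: nbhs_right_gt.
  have t1 : t < 1 by near: t; exact: nbhs_right_lt.
  have : c < r (x + t *: (z - x)) by near: t.
  rewrite ltNge => /negP; apply; apply/ltW/lt_c.
  have -> : q (x + t *: (z - x)) = (1 - t) ^+ 2 * q x.
    rewrite /q; have -> : x + t *: (z - x) - z = (1 - t) *: (x - z).
      by rewrite -(opprB x z) scalerN scalerBl scale1r addrAC.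
    by rewrite qfZl qfZr mulrA.
  by rewrite gtr_pMl// expr_lt1 ?subr_ge0 ?(ltW t1)// ltrBlDr ltrDl.
pose h := 2^-1 *: (x - z); pose z' := z + h.
have xz'E : x - z' = h.
  rewrite /z' opprD addrA -{1}[x - z]scale1r -scalerBl.
  by congr (_ *: _); field.
have h0 : h != 0 by rewrite scaler_eq0 subr_eq0 (negPf xz) orbF invr_eq0 pnatr_eq0.
exists z', x; split=> //; first by rewrite -subr_eq0 xz'E.
move=> y; rewrite xz'E => yz'.
have qxE : q x = 4 * qf 1%:M h h.
  by rewrite /q /h qfZl qfZr -[qf _ _ _]/(q x); field.
(* The parallelogram law: in the small ball it gives [q y <= q x - |y - x|^2]. *)
have qyE : q y + qf 1%:M (y - x) (y - x) =
    2 * qf 1%:M (y - z') (y - z') + 2 * qf 1%:M h h.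
  have -> : y - x = (y - z') + (-1) *: h by rewrite scaleN1r -xz'E opprB addrA subrK.
  have -> : q y = qf 1%:M ((y - z') + h) ((y - z') + h).
    by rewrite /q /z' opprD addrA subrK.
  by rewrite !qfDl !qfDr !qfZr !qfZl; ring.
split.
  apply: le_trans xQ; rewrite -/(q y) -/(q x) qxE.
  by have := qf1_ge0 (y - x); lra.
move=> yx; apply: lt_c; rewrite qxE.
have : 0 < qf 1%:M (y - x) (y - x) by rewrite qf1_gt0// subr_eq0.
by lra.
Unshelve. all: by end_near. Qed.

(** Rolle's theorem makes [F] injective without continuity of its derivative. The sign [s = 1] is
    the decreasing case, so that [s * (F u - F c)] is positive below [c], as Hopf's lemma wants. *)
Lemma nonzero_derive_monotone (R : realType) (F : R -> R) (a c : R) : a < c ->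
  (forall v : R, a <= v < c -> exists2 l : R, l != 0 & is_derive v (1 : R) F l) ->
  F v @[v --> c^'-] --> F c ->
  exists2 s : R, (s = 1 \/ s = -1) &
    forall u v, a <= u -> u < v -> v <= c -> 0 < s * (F u - F v).
Proof.
move=> ac dF Fc.
have dFv v : a <= v < c -> derivable F v 1.
  by move=> /dF[l _ dl]; exact: is_derive_derivable dl.
have cF v : a <= v < c -> {for v, continuous F}.
  by move=> /dFv dv; exact: derivable_cvg.
have cFw u v : a <= u -> u < v -> v <= c -> {within `[u, v], continuous F}.
  move=> au uv vc; apply/continuous_within_itvP => //; split.
  - move=> w; rewrite in_itv/= => /andP[uw wv].
    by apply: cF; rewrite (le_trans au (ltW uw)) (lt_le_trans wv vc).
  - by apply: cvg_at_right_filter; apply: cF; rewrite au (lt_le_trans uv vc).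
  - move: vc; rewrite le_eqVlt => /orP[/eqP->//|vc].
    by apply: cvg_at_left_filter; apply: cF; rewrite vc (le_trans au (ltW uv)).
have noeq u v : a <= u -> u < v -> v <= c -> F u <> F v.
  move=> au uv vc Fuv; have [|w] := Rolle uv _ (cFw u v au uv vc) Fuv.
    move=> w; rewrite in_itv/= => /andP[uw wv].
    by apply: dFv; rewrite (le_trans au (ltW uw)) (lt_le_trans wv vc).
  rewrite in_itv/= => /andP[uw wv] [_ dw0].
  have [|l /negP l0 [_ dwl]] := dF w; last by apply: l0; rewrite -dwl dw0.
  by rewrite (le_trans au (ltW uw)) (lt_le_trans wv vc).
have injF : {in `[a, c] &, injective F}.
  move=> u v; rewrite !in_itv/= => /andP[au uc] /andP[av vc] Fuv.
  have [uv|vu|//] := ltgtP u v.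
    by have := noeq _ _ au uv vc.
  by have := noeq _ _ av vu uc; move=> /(_ (esym Fuv)).
have [h|h] := itv_continuous_inj_mono (cFw a c (lexx a) ac (lexx c)) injF;
  [exists (-1); first by right|exists 1; first by left] => u v au uv vc;
  rewrite ?mul1r ?mulN1r ?oppr_gt0 ?subr_gt0 ?subr_lt0; apply: h => //;
  by rewrite in_itv/= ?au ?vc (le_trans (ltW uv), le_trans au (ltW uv)).
Qed.

(** * The Laplace equation in divergence form and expanded *)

Definition symbol (R : realType) (m : nat) (G : 'rV[R]_m -> 'M[R]_m) y : 'M[R]_m :=
  Num.sqrt (\det (G y)) *: invmx (G y).

Section Operator.
Context {R : realType} {m : nat} (A : set 'rV[R]_m) (G : 'rV[R]_m -> 'M[R]_m).
Hypothesis oA : open A.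
Hypothesis pG : forall x, A x -> posdef (G x).
Hypothesis sG : forall i j, smooth_on A (fun x => G x i j).

Lemma symbol_posdef x : A x -> posdef (symbol G x).
Proof.
move=> Ax; have [iT ip] := posdef_inv (pG Ax); split; first by rewrite linearZ/= iT.
move=> v v0; rewrite /symbol qfZ mulr_gt0 ?ip// sqrtr_gt0.
exact/posdef_det/pG.
Qed.

Lemma symbol_smooth i j : smooth_on A (fun x => symbol G x i j).
Proof.
apply: (eq_smooth oA (f := fun x => Num.sqrt (\det (G x)) * invmx (G x) i j)).
  by move=> x _; rewrite mxE.
apply: smoothM => //.
  apply: smooth_sqrt => //; last exact: smooth_det.
  by move=> x Ax; exact/posdef_det/pG.
by apply: smooth_invmx => // x Ax; exact/posdef_unit/pG.
Qed.

Lemma laplace_beltrami_eq0 f x : A x -> laplace_beltrami G f x = 0 <->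
  \sum_i \sum_j partial i (fun y => symbol G y i j * partial j f y) x = 0.
Proof.
move=> Ax; rewrite /laplace_beltrami.
have -> : \sum_(i < m) \sum_(j < m) partial i (fun y => Num.sqrt (\det (G y)) *
      invmx (G y) i j * partial j f y) x =
    \sum_i \sum_j partial i (fun y => symbol G y i j * partial j f y) x.
  apply: eq_bigr => i _; apply: eq_bigr => j _.
  by congr (partial i _ x); apply/funext => y; rewrite [symbol G y i j]mxE.
split=> [/eqP|->]; last by rewrite mulr0.
rewrite mulf_eq0 invr_eq0 gt_eqF ?sqrtr_gt0; last exact/posdef_det/pG.
by move=> /eqP.
Qed.

Definition drift j y := \sum_i partial i (fun y => symbol G y i j) y.

Lemma drift_continuous j x : A x -> {for x, continuous (drift j)}.
Proof.
move=> Ax; apply: smooth_continuous Ax; apply: smooth_sum => // i.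
by have /smooth_onS[_] := symbol_smooth i j.
Qed.

Lemma operator_expand f x : smooth_on A f -> A x ->
  \sum_i \sum_j partial i (fun y => symbol G y i j * partial j f y) x =
  \sum_i \sum_j symbol G x i j * partial i (partial j f) x +
  \sum_j drift j x * partial j f x.
Proof.
move=> /smooth_onS[_ sf] Ax.
rewrite [X in _ = _ + X](_ : _ = \sum_i \sum_j
    partial i (fun y => symbol G y i j) x * partial j f x); last first.
  by rewrite exchange_big/=; apply: eq_bigr => j _; rewrite mulr_suml.
rewrite -big_split/=; apply: eq_bigr => i _; rewrite -big_split/=.
apply: eq_bigr => j _; rewrite partialM.
- by rewrite addrC.
- by have /smooth_onS[d _] := symbol_smooth i j; exact: d.
- by have /smooth_onS[d _] := sf j; exact: d.
Qed.

End Operator.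

(** * Small punctured balls and almost shortest curves in them *)

Section Shell.
Context {R : realType} {m : nat}.
Context (U : set 'rV[R]_m) (P : 'rV[R]_m) (G : 'rV[R]_m -> 'M[R]_m).
Hypothesis adm : admissible U P G.
Hypothesis pG : forall x, U x -> posdef (G x).
Hypothesis sG : forall i j, smooth_on U (fun x => G x i j).
Context (k rho e : R).
Hypotheses (k0 : 0 < k) (rho0 : 0 < rho).
Hypothesis kG : forall x, `|x - P| < rho -> U x /\ forall v, k * `|v| <= gnorm (G x) v.
(* Curves from [P] of length below [k * rho] stay in the coordinate ball
   [`|x - P| < rho], on which the metric dominates [k] times the norm. *)
Hypothesis ek : e <= k * rho.

Local Notation r := (geodesic_distance U G P).
Local Notation A := (punctured_ball U P G e).
Implicit Types (c : R -> 'rV[R]_m) (Q x y z v w : 'rV[R]_m).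

Lemma shell_open : open A.
Proof.
rewrite openE => x [Ux /andP[r0 re]]; have [oU _ _] := adm.
have n1 := cvgr_gt _ (dist_cont adm Ux) _ r0.
have n2 := cvgr_lt _ (dist_cont adm Ux) _ re.
apply: filterS3 (open_nbhs_nbhs (conj oU Ux)) (n1 _) (n2 _) => y Uy h1 h2.
by split=> //; rewrite h1 h2.
Qed.

Lemma smooth_sub g : smooth_on U g -> smooth_on A g.
Proof. by move=> sg s x [Ux _]; exact: sg. Qed.

Lemma shell_near x : reach U P x -> r x < e -> `|x - P| < rho.
Proof.
move=> rx re; have kG' y (yP : `|y - P| < rho) := (kG yP).2.
have := euclidean_dist adm k0 rho0 kG' rx.
move=> /le_lt_trans/(_ (lt_le_trans re ek)); rewrite ltr_pM2l// gt_min ltxx orbF.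
exact.
Qed.

Lemma shell_reach x : A x -> reach U P x.
Proof.
move=> [_ /andP[r0 _]]; apply: contrapT => /(dist_unreach G) rx.
by move: r0; rewrite rx ltxx.
Qed.

Lemma shell_near' x : A x -> `|x - P| < rho.
Proof. by move=> Ax; apply: shell_near (shell_reach Ax) _; case: Ax => _ /andP[]. Qed.

Lemma shell_cts x : A x -> {for x, continuous r}.
Proof. by move=> [Ux _]; exact: dist_cont. Qed.

(** The replacement for a minimal geodesic from radius [a] to [x]: the part of an almost shortest
    curve from [P] to [x] after its last passage at radius [a]. Being short, it is also close to [x]
    in norm. *)
Lemma descent x a d : A x -> 0 < a -> a < r x -> 0 < d ->
  exists al be t c l, [/\ joins U P x al be c, arclength G al be c l,
    al <= t <= be, r (c t) = a &
    l be - l t <= r x - a + d /\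
    forall u, t <= u <= be -> [/\ A (c u), a <= r (c u) <= r x + d &
      k * `|x - c u| <= r x - a + d]].
Proof.
move=> Ax a0 ax d0; have rx := shell_reach Ax; have [Ux /andP[x0 xe]] := Ax.
(* The second bound keeps the curve inside the shell. *)
pose d' := Num.min d (e - r x).
have d'0 : 0 < d' by rewrite lt_min d0 subr_gt0.
have d'd : d' <= d by rewrite ge_min lexx.
have d'e : r x + d' <= e by rewrite -lerBrDl ge_min lexx orbT.
have [al [be [c [l [jc hl lb]]]]] := dist_near adm rx d'0.
have [cab ca cb cU] := jc; have ab := pw_le cab.
have [t [tab rt rge]] : exists t, [/\ al <= t <= be, r (c t) = a &
    forall u, t <= u <= be -> a <= r (c u)].
  apply: (last_crossing (phi := r \o c) ab (dist_curve_cts adm jc)).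
    by rewrite /= ca distP// ltW.
  by rewrite /= cb.
have /andP[at_ tb] := tab.
have [b1 b2] := dist_curve_bounds adm jc hl tab.
have Ac u : t <= u <= be -> A (c u) /\ r (c u) <= r x + d'.
  move=> /andP[tu ub]; have uab : al <= u <= be by rewrite (le_trans at_ tu).
  have [b1' _] := dist_curve_bounds adm jc hl uab.
  have lu : l u <= l be by exact: (arclength_le_end cab hl (le_trans at_ tu)).
  have ru : a <= r (c u) by apply: rge; rewrite tu.
  split; last by rewrite (le_trans b1')// (le_trans lu)// ltW.
  split; first exact: cU.
  rewrite (lt_le_trans a0 ru) (le_lt_trans b1')// (le_lt_trans lu)//.
  exact: lt_le_trans lb _.
exists al, be, t, c, l; split=> //; split.
  have : l be - l t <= r x + d' - a.
    by apply: lerB; [exact: ltW|rewrite -rt].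
  by move/le_trans; apply; rewrite addrAC lerD2l.
move=> u /andP[tu ub]; have tub : t <= u <= be by rewrite tu.
have [Au ru] := Ac u tub; split=> //.
  by rewrite rge// (le_trans ru)// lerD2l.
have kG' y (yP : `|y - P| < rho) := (kG yP).2.
rewrite -cb; apply: le_trans (euclidean_arclength k0 kG' jc hl _ ub (lexx be) _) _.
- exact: le_trans tu.
- move=> v /andP[uv vb]; apply: shell_near'.
  by have [] := Ac v; rewrite ?(le_trans tu uv).
have lt_ : l t <= l u by exact: (arclength_le_end cab hl).
apply: le_trans (_ : l be - l t <= _); first by rewrite lerD2l lerN2.
have : l be - l t <= r x + d' - a.
  by apply: lerB; [exact: ltW|rewrite -rt].
by rewrite cb; move/le_trans; apply; rewrite addrAC lerD2l.
Qed.

(** * Radial functions and the length of their differential *)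

Section RadialFunction.
Context (f : 'rV[R]_m -> R) (F : R -> R).
Hypothesis sf : smooth_on A f.
Hypothesis fF : forall x, A x -> f x = F (r x).
Local Notation N := (gradnorm G f).

Lemma shell_diff x : A x -> differentiable f x.
Proof. by case/smooth_onS: sf => + _; exact. Qed.

Lemma grad_posdef x : A x -> posdef (invmx (G x)).
Proof. by move=> [Ux _]; exact/posdef_inv/pG. Qed.

Lemma gradnorm_ge0 x : 0 <= N x.
Proof. exact: gnorm_ge0. Qed.

Definition gradient x := grad f x *m invmx (G x).

Lemma gradient_diff x v : A x -> 'd f x v = qf (G x) (gradient x) v.
Proof.
move=> Ax; rewrite diff_partial; last exact: shell_diff.
have [Ux _] := Ax.
rewrite /qf /gradient mulmxKV; last exact/posdef_unit/pG.
by rewrite mxE; apply: eq_bigr => i _; rewrite !mxE mulrC.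
Qed.

Lemma gradient_norm x : A x -> gnorm (G x) (gradient x) = N x.
Proof.
move=> [Ux _]; have pGx := pG Ux; rewrite /gnorm /gradnorm /gnorm /qf /gradient.
rewrite mulmxKV; last exact: posdef_unit.
by rewrite trmx_mul (posdef_inv pGx).1 mulmxA.
Qed.

Lemma diff_le_gradnorm x v : A x -> 'd f x v <= N x * gnorm (G x) v.
Proof.
move=> Ax; rewrite gradient_diff// -gradient_norm//.
by case: Ax => Ux _; exact/posdef_CauchySchwarz/pG.
Qed.

Lemma gradnorm_cont x : A x -> {for x, continuous N}.
Proof.
move=> Ax; apply: (@continuous_for_comp _ _ _
  (fun y => qf (invmx (G y)) (grad f y) (grad f y)) Num.sqrt); last first.
  exact: sqrt_continuous.
have cg i : {for x, continuous (fun y => grad f y 0 i)}.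
  have -> : (fun y => grad f y 0 i) = partial i f by apply/funext => y; rewrite mxE.
  have /smooth_onS[_ spf] := sf; exact: smooth_continuous (spf i) Ax.
have sI : forall i j, smooth_on A (fun y => invmx (G y) i j).
  apply: smooth_invmx; first exact: shell_open.
    by move=> y [Uy _]; exact/posdef_unit/pG.
  by move=> i j; exact: smooth_sub.
have -> : (fun y => qf (invmx (G y)) (grad f y) (grad f y)) =
    (fun y => \sum_i \sum_j grad f y 0 i * invmx (G y) i j * grad f y 0 j).
  by apply/funext => y; rewrite qfE.
apply: (@cvg_sumr R _ (nbhs x)) => i; apply: (@cvg_sumr R _ (nbhs x)) => j.
apply: (@cvgM _ _ (nbhs x)); last exact: cg.
apply: (@cvgM _ _ (nbhs x)); first exact: cg.
exact: smooth_continuous (sI i j) Ax.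
Qed.

Lemma gradnorm_eq0 x : A x -> N x = 0 -> forall i, partial i f x = 0.
Proof.
move=> Ax N0 i; have pI := grad_posdef Ax.
have g0 : grad f x = 0.
  apply: contra_eq (N0) => g0; rewrite gt_eqF// /gradnorm /gnorm sqrtr_gt0.
  exact: pI.2.
by have := congr1 (fun M : 'rV[R]_m => M 0 i) g0; rewrite !mxE.
Qed.

(** Along the curve of [descent], [f] changes by at most [M] times the length. The bound on [N] is
    asked only where that curve can pass, so it may be local. *)
Lemma radial_lip x a d M : A x -> 0 < a -> a <= r x -> 0 < d -> 0 <= M ->
  (forall y, A y -> a <= r y <= r x + d -> k * `|x - y| <= r x - a + d ->
     N y <= M) ->
  `|F (r x) - F a| <= M * (r x - a).
Proof.
move=> Ax a0; rewrite le_eqVlt => /orP[/eqP->|ax] d0 M0 HM.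
  by rewrite !subrr normr0 mulr0.
have D0 : 0 < r x - a by rewrite subr_gt0.
suff H eta : 0 < eta -> eta <= d ->
    `|F (r x) - F a| <= (M + eta) * (r x - a + eta).
  apply/ler_addgt0Pr => eps eps0.
  pose eta := Num.min (Num.min d 1) (eps / (M + (r x - a) + 1)).
  have s0 : 0 < M + (r x - a) + 1 by rewrite ltr_wpDl// addr_ge0// ltW.
  have eta0 : 0 < eta by rewrite !lt_min d0 ltr01 divr_gt0.
  have eta1 : eta <= 1 by rewrite !ge_min lexx orbT.
  have etad : eta <= d by rewrite !ge_min lexx.
  have etae : eta * (M + (r x - a) + 1) <= eps.
    by rewrite -ler_pdivlMr// ge_min lexx orbT.
  apply: le_trans (H _ eta0 etad) _; nra.
move=> eta0 etad.
have [al [be [t [c [l [jc hl tab rt [ll Hu]]]]]]] := descent Ax a0 ax eta0.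
have [cab ca cb cU] := jc; have /andP[at_ tb] := tab.
have Me : 0 < M + eta by rewrite ltr_wpDl.
have tt : t <= t <= be by rewrite lexx.
have bb : t <= be <= be by rewrite tb lexx.
have [At _ _] := Hu t tt; have [Ab _ _] := Hu be bb.
(* [f] is rescaled to slope at most one; [eta] avoids a division by [M = 0]. *)
have key s : (s = 1 \/ s = -1) -> s * (f x - f (c t)) <= (M + eta) * (l be - l t).
  move=> s1; rewrite mulrC -ler_pdivrMl// mulrA.
  have := arclength_incr (phi := fun y => (M + eta)^-1 * s * f y) cab hl at_ tb (lexx be).
  rewrite cb => H; rewrite (_ : _ * _ * s =
    (M + eta)^-1 * s * f x - (M + eta)^-1 * s * f (c t)); last by ring.
  apply: H => u.
    move=> /Hu[Au _ _]; apply: continuous_forM; first exact: cst_continuous.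
    exact: (differentiable_continuous (shell_diff Au)).
  move=> /andP[tu ub] eps eps0.
  have [Au ru ku] : [/\ A (c u), a <= r (c u) <= r x + eta &
      k * `|x - c u| <= r x - a + eta] by apply: Hu; rewrite tu ltW.
  have NM : N (c u) <= M.
    apply: HM => //; last by rewrite (le_trans ku)// lerD2l.
    by case/andP: ru => -> /le_trans -> //; rewrite lerD2l.
  have ee0 : 0 < (M + eta) * eps by rewrite mulr_gt0.
  apply: filterS (diff_eps (shell_diff Au) ee0) => y Hy.
  rewrite -mulrBr -mulrA ler_pdivrMl// [leRHS]mulrDr.
  have g0 := gnorm_ge0 (G (c u)) (y - c u).
  have sd : s * 'd f (c u) (y - c u) <= M * gnorm (G (c u)) (y - c u).
    apply: le_trans (_ : N (c u) * gnorm (G (c u)) (y - c u) <= _); last first.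
      exact: ler_wpM2r.
    case: s1 => ->; first by rewrite mul1r diff_le_gradnorm.
    rewrite mulN1r -linearN; apply: le_trans (diff_le_gradnorm _ Au) _.
    by rewrite -scaleN1r gnormZ normrN1 mul1r.
  have sd2 : s * (f y - f (c u) - 'd f (c u) (y - c u)) <=
     (M + eta) * eps * `|y - c u|.
    apply: le_trans Hy; apply: le_trans (ler_norm _) _.
    by rewrite normrM; case: s1 => ->; rewrite ?normrN1 ?normr1 mul1r.
  have -> : s * (f y - f (c u)) = s * 'd f (c u) (y - c u) +
    s * (f y - f (c u) - 'd f (c u) (y - c u)) by ring.
  rewrite (mulrA (M + eta) eps); apply: lerD => //; apply: le_trans sd _.
  by rewrite ler_wpM2r// lerDl ltW.
have fE : f x - f (c t) = F (r x) - F a by rewrite !fF// rt.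
have lle : (M + eta) * (l be - l t) <= (M + eta) * (r x - a + eta).
  by rewrite ler_pM2l.
rewrite -fE ler_norml lerNl; apply/andP; split; apply: le_trans lle.
  by have := key (-1) (or_intror erefl); rewrite mulN1r.
by have := key 1 (or_introl erefl); rewrite mul1r.
Qed.

Lemma near_below x a d : A x -> 0 < a -> a < r x -> 0 < d ->
  exists y, [/\ A y, r y = a & k * `|x - y| <= r x - a + d].
Proof.
move=> Ax a0 ax d0; have [al [be [t [c [l [_ _ tab rt [_ Hu]]]]]]] := descent Ax a0 ax d0.
have [|At _ kt] := Hu t; first by case/andP: tab => _ ->; rewrite lexx.
by exists (c t).
Qed.

Lemma gradnorm_ball x M : A x -> N x < M ->
  exists2 d, 0 < d & forall y, ball x d y -> A y /\ N y <= M.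
Proof.
move=> Ax NM; have n1 := cvgr_lt _ (gradnorm_cont Ax) _ NM.
have /nbhs_ballP[d /= d0 Hd] : \forall y \near x, A y /\ N y <= M.
  apply: filterS2 (open_nbhs_nbhs (conj shell_open Ax)) (n1 _) => y Ay /ltW.
  by split.
by exists d.
Qed.

Lemma radial_left_lip x M : A x -> N x < M -> exists2 d, 0 < d &
  forall a, 0 < a -> r x - d < a -> a <= r x ->
    `|F (r x) - F a| <= M * (r x - a).
Proof.
move=> Ax NM; have [d d0 Hd] := gradnorm_ball Ax NM.
(* Radius drop and excess are each at most [k * d / 4], so the curve stays within norm distance [d]
   of [x]. *)
have kd4 : 0 < k * d / 4 by rewrite divr_gt0// mulr_gt0.
have M0 : 0 <= M by rewrite (le_trans (gradnorm_ge0 x))// ltW.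
exists (k * d / 4) => // a a0 xa ax; apply: (radial_lip Ax a0 ax kd4 M0) => y Ay _ H.
have [] // := Hd y; rewrite -ball_normE /ball_/=.
rewrite -(ltr_pM2l k0); apply: le_lt_trans H _.
have : 0 < k * d by rewrite mulr_gt0.
by move: xa; lra.
Qed.

Lemma local_lip x M : A x -> N x < M ->
  \forall y \near x, A y /\ `|f y - f x| <= M * `|r y - r x|.
Proof.
move=> Ax NM; have [d d0 Hd] := gradnorm_ball Ax NM.
have [d' d'0 Hd'] := radial_left_lip Ax NM.
have kd4 : 0 < k * d / 4 by rewrite divr_gt0// mulr_gt0.
have M0 : 0 <= M by rewrite (le_trans (gradnorm_ge0 x))// ltW.
have m0 : 0 < Num.min d' (k * d / 4) by rewrite lt_min d'0.
have d20 : 0 < d / 2 by rewrite divr_gt0.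
have n1 : \forall y \near x, `|r x - r y| < Num.min d' (k * d / 4).
  by have /(@cvgrPdist_lt _ _ _ (nbhs x)) := shell_cts Ax; apply.
apply: filterS2 n1 (nbhsx_ballx x _ d20) => y.
rewrite lt_min => /andP[h1 h2] xy.
have xy2 : `|x - y| < d / 2 by move: xy; rewrite -ball_normE.
have [Ay _] : A y /\ N y <= M.
  by apply: Hd; rewrite -ball_normE /ball_/=; lra.
split=> //; rewrite !fF//; have [_ /andP[y0 _]] := Ay; have [_ /andP[x0 _]] := Ax.
have [xr|yr] := leP (r x) (r y).
  rewrite [X in _ <= _ * X]ger0_norm ?subr_ge0//; apply: (radial_lip Ay x0 xr kd4 M0) => z Az _ H.
  have [] // := Hd z; rewrite -ball_normE /ball_/=.
  have yz : `|y - z| < d / 2.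
    rewrite -(ltr_pM2l k0); apply: le_lt_trans H _.
    by move: h2; rewrite distrC ger0_norm ?subr_ge0//; lra.
  by apply: le_lt_trans (ler_distD y x z) _; lra.
rewrite distrC (distrC (r y)) [X in _ <= _ * X]gtr0_norm ?subr_gt0//.
apply: Hd' => //; last exact: ltW.
by move: h1; rewrite gtr0_norm ?subr_gt0//; lra.
Qed.

(* Along the gradient line through a noncritical point, [f] is strictly monotone,
   hence so is [r], since [f = F r]; and [r] moves at most at unit speed. *)
Lemma noncritical_radii x : A x -> 0 < N x ->
  exists2 s, (s = 1 \/ s = -1) & forall eps, 0 < eps ->
    \forall v \near r x, exists y, [/\ A y, ball x eps y, r y = v,
      0 <= s * (v - r x) * (f y - f x) &
      `| `|f y - f x| - N x * `|v - r x| | <= eps * `|v - r x| ].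
Proof.
move=> Ax N0; pose u := (N x)^-1 *: gradient x.
have gu : gnorm (G x) u = 1.
  by rewrite /u gnormZ gradient_norm// ger0_norm ?invr_ge0 ?ltW// mulVf// gt_eqF.
have du : 'd f x u = N x.
  rewrite gradient_diff// /u qfZr -(gradient_norm Ax).
  have -> : qf (G x) (gradient x) (gradient x) = gnorm (G x) (gradient x) ^+ 2.
    by rewrite sqr_sqrtr// qf_ge0//; case: Ax => Ux _; exact: pG.
  by rewrite expr2 mulKf// gradient_norm// gt_eqF.
pose ga (t : R) := x + t *: u; pose p t := f (ga t); pose q t := r (ga t).
have ga0 : ga 0 = x by rewrite /ga scale0r addr0.
have cga t : {for t, continuous ga}.
  exact: derivable_cvg (is_derive_derivable (is_derive_line x u t)).
pose dp t := \sum_i u 0 i * partial i f (ga t).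
have dp0 : dp 0 = N x by rewrite /dp ga0 -du diff_partial//; exact: shell_diff.
have Dp (t : R) : A (ga t) -> is_derive t 1 p (dp t).
  by move=> /shell_diff d; exact: line_derive.
have cdp : {for 0, continuous dp}.
  apply: cvg_sumr => i; apply: cvgM; first exact: cvg_cst.
  have c1 : {for ga 0, continuous (partial i f)}.
    by rewrite ga0; have /smooth_onS[_ sp] := sf; exact: smooth_continuous (sp i) Ax.
  exact: (continuous_for_comp (cga 0) c1).
have nga (S : 'rV[R]_m -> Prop) : (\forall y \near x, S y) ->
    \forall t \near (0 : R), S (ga t).
  by move=> H; apply: (cga 0); rewrite ga0.
have nA := nga _ (open_nbhs_nbhs (conj shell_open Ax)).
have /nbhs_ballP[t1 /= t10 Ht1] : \forall t \near (0 : R), A (ga t) /\ 0 < dp t.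
  have n2 : \forall t \near (0 : R), 0 < dp t.
    by have := cvgr_gt _ cdp 0; rewrite dp0; apply.
  by apply: filterS2 nA n2.
pose tau := t1 / 2; have tau0 : 0 < tau by rewrite divr_gt0.
have Ht t : -tau <= t <= tau -> A (ga t) /\ 0 < dp t.
  move=> /andP[a b]; apply: Ht1; rewrite /ball/= sub0r normrN.
  by rewrite ltr_norml; rewrite /tau in a b tau0; apply/andP; split; lra.
have pinc a b : -tau <= a -> a < b -> b <= tau -> p a < p b.
  move=> ta ab bt; have Hab t : a <= t <= b -> A (ga t) /\ 0 < dp t.
    by move=> /andP[h1 h2]; apply: Ht; rewrite (le_trans ta h1) (le_trans h2 bt).
  have [||c + pE] := @MVT R p dp a b ab.
  - by move=> t; rewrite in_itv/= => /andP[/ltW h1 /ltW h2]; apply: Dp; apply: (Hab t _).1; rewrite h1.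
  - apply: derivable_within_continuous => t; rewrite in_itv/= => /Hab[At _].
    exact: is_derive_derivable (Dp t At).
  rewrite in_itv/= => /andP[/ltW h1 /ltW h2].
  by rewrite -subr_gt0 pE mulr_gt0 ?subr_gt0//; apply: (Hab c _).2; rewrite h1.
(* Equal radii give equal values of [f], which is strictly increasing on the line. *)
have qinj : {in `[-tau, tau] &, injective q}.
  move=> a b ia ib qab; have Aa := (Ht a ia).1; have Ab := (Ht b ib).1.
  have pab : p a = p b by rewrite /p !fF// -/(q a) qab.
  move: ia ib; rewrite !in_itv/= => /andP[a1 a2] /andP[b1 b2].
  have [ab|ba|//] := ltgtP a b.
    by have := pinc _ _ a1 ab b2; rewrite pab ltxx.
  by have := pinc _ _ b1 ba a2; rewrite pab ltxx.
have cq : {within `[-tau, tau], continuous q}.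
  apply: continuous_in_subspaceT => t; rewrite inE => /Ht[At _].
  exact: (continuous_for_comp (cga t) (shell_cts At)).
have q0 : q 0 = r x by rewrite /q ga0.
have [s s1 Hs] : exists2 s, (s = 1 \/ s = -1) &
    forall a b, -tau <= a -> a < b -> b <= tau -> 0 < s * (q b - q a).
  have [h|h] := itv_continuous_inj_mono cq qinj; [exists 1; first by left|exists (-1); first by right];
    move=> a b ta ab tb; rewrite ?mul1r ?mulN1r ?oppr_gt0 ?subr_gt0 ?subr_lt0;
    by apply: h => //; rewrite in_itv/= ?ta ?tb ?(le_trans (ltW ab))// (le_trans ta (ltW ab)).
exists s => // eps eps0.
pose e2 := eps / (2 * (N x) * (`|u| + 1)).
have u1 : 0 < `|u| + 1 by rewrite ltr_wpDl.
have e20 : 0 < e2 by rewrite divr_gt0// !mulr_gt0.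
have e10 : 0 < eps / 2 by rewrite divr_gt0.
(* [n1] and [n2] combine to the lower bound on the change of [f] in terms of that of [r], with [e2]
   chosen so that the loss is at most [eps]; [n3] is the upper bound. *)
have n1 : \forall t \near (0 : R), (N x - eps / 2) * `|t| <= `|p t - p 0|.
  have A0 : A (ga 0) by rewrite ga0.
  have [dp' dpE] := is_derive_diff (Dp 0 A0).
  apply: filterS (diff_eps dp' e10) => t.
  rewrite dpE dp0 subr0 mulrBl => H.
  have := ler_distD (p t - p 0) 0 (t * N x).
  rewrite !sub0r !normrN normrM (gtr0_norm N0) => H2.
  by move: H2 H; lra.
have n2 : \forall t \near (0 : R), `|q t - q 0| <= `|t| * (1 + e2 * `|u|).
  have Ux : U x by case: Ax.
  have nd := nga _ (dist_near_le adm Ux e20).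
  apply: filterS nd => t; rewrite q0 (_ : ga t - x = t *: u); last first.
    by rewrite /ga addrAC subrr add0r.
  rewrite (_ : gnorm (G x) (t *: u) + e2 * `|t *: u| = `|t| * (1 + e2 * `|u|)).
  2: by rewrite gnormZ gu normrZ; ring.
  move=> -[h1 h2].
  by rewrite ler_norml lerNl opprB h1 h2.
have n3 : \forall t \near (0 : R), `|f (ga t) - f x| <= (N x + eps) * `|r (ga t) - r x|.
  have NN : N x < N x + eps by rewrite ltrDl.
  by apply: filterS (nga _ (local_lip Ax NN)) => t [].
have n4 := nga _ (nbhsx_ballx x _ eps0).
have /nbhs_ballP[d /= d0 Hd] : \forall t \near (0 : R), [/\ ball x eps (ga t),
    (N x - eps / 2) * `|t| <= `|p t - p 0|,
    `|q t - q 0| <= `|t| * (1 + e2 * `|u|) &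
    `|f (ga t) - f x| <= (N x + eps) * `|r (ga t) - r x|].
  by near=> t; split; near: t.
pose t2 := Num.min (d / 2) tau.
have t20 : 0 < t2 by rewrite lt_min tau0 divr_gt0.
have t2t : t2 <= tau by rewrite ge_min lexx orbT.
have t2d : t2 < d by rewrite gt_min; apply/orP; left; lra.
have sp : 0 < s * (q t2 - q 0) by apply: Hs => //; rewrite oppr_le0 ltW.
have sm : 0 < s * (q 0 - q (- t2)) by apply: Hs; rewrite ?lerN2 ?oppr_lt0// ltW.
have nv : \forall v \near r x, 0 < s * (q t2 - v) /\ 0 < s * (v - q (- t2)).
  have cv (c c' : R) : s * (c - v) + c' @[v --> r x] --> s * (c - r x) + c'.
    apply: cvgD; last exact: cvg_cst.
    by apply: cvgM; [exact: cvg_cst|apply: cvgB; [exact: cvg_cst|exact: cvg_id]].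
  have m1 : 0 < s * (q t2 - r x) + 0 by rewrite addr0 -q0.
  have m2 : s * (q (- t2) - r x) + 0 < 0 by rewrite addr0 -q0 -opprB mulrN oppr_lt0.
  apply: filterS2 (cvgr_gt _ (cv (q t2) 0) _ m1) (cvgr_lt _ (cv (q (- t2)) 0) _ m2) => v.
  by rewrite !addr0 => -> h2; split=> //; rewrite -opprB mulrN oppr_gt0.
apply: filterS nv => v [v1 v2].
have cq2 : {within `[-t2, t2], continuous q}.
  by apply: continuous_subspaceW cq; apply: subset_itv; rewrite bnd_simp ?lerN2.
have [||t + qt] := @IVT R q (-t2) t2 v _ cq2.
- by rewrite (@le_trans _ _ 0)// ?oppr_le0 ltW.
- rewrite ge_min le_max; case: s1 v1 v2 => ->; rewrite ?mul1r ?mulN1r ?oppr_gt0 ?subr_gt0 ?subr_lt0.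
    by move=> /ltW-> /ltW->; rewrite orbT.
  by move=> /ltW-> /ltW->; rewrite orbT.
rewrite in_itv/= => /andP[tl tr].
have ttau : -tau <= t <= tau by rewrite (le_trans _ tl) ?lerN2// (le_trans tr).
have [At _] := Ht t ttau.
have [b1 b2 b3 b4] : [/\ ball x eps (ga t),
    (N x - eps / 2) * `|t| <= `|p t - p 0|,
    `|q t - q 0| <= `|t| * (1 + e2 * `|u|) &
    `|f (ga t) - f x| <= (N x + eps) * `|r (ga t) - r x|].
  apply: Hd; rewrite /ball/= sub0r normrN ltr_norml (le_lt_trans tr t2d) andbT.
  by rewrite (lt_le_trans _ tl)// ltrN2.
have pt : p t - p 0 = f (ga t) - f x by rewrite /p ga0.
exists (ga t); split=> //.
  rewrite -qt -q0 -pt; case/andP: ttau => tt1 tt2.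
  have [t0|t0|->] := ltgtP t 0; last by rewrite subrr mulr0 mul0r.
    rewrite mulr_le0//.
      by rewrite -oppr_ge0 -mulrN opprB ltW// Hs// ltW.
    by rewrite subr_le0 ltW// pinc// ltW.
  by rewrite mulr_ge0// ?subr_ge0 ltW// ?Hs ?pinc// oppr_le0 ltW.
rewrite -qt -q0 -pt ler_norml lerBlDr lerBrDr; apply/andP; split; last first.
  by rewrite pt q0 -mulrDl [eps + _]addrC.
rewrite -mulNr -mulrDl [- eps + _]addrC.
have [Ne|Ne] := leP (N x - eps) 0.
  by apply: le_trans (normr_ge0 _); rewrite mulr_le0_ge0.
apply: le_trans b2; apply: le_trans (_ : (N x - eps) * (`|t| * (1 + e2 * `|u|)) <= _).
  by rewrite ler_pM2l.
rewrite mulrCA mulrC ler_wpM2r//.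
have : N x * (e2 * `|u|) <= eps / 2.
  apply: le_trans (_ : N x * (e2 * (`|u| + 1)) <= _).
    by rewrite !ler_pM2l// lerDl.
  rewrite le_eqVlt; apply/orP; left; apply/eqP; rewrite /e2; field.
  by rewrite !gt_eqF.
have : 0 <= eps * (e2 * `|u|).
  exact: mulr_ge0 (ltW eps0) (mulr_ge0 (ltW e20) (normr_ge0 u)).
by move: Ne; lra.
Unshelve. all: by end_near. Qed.

Lemma eps_derive (g : R -> R) (t l : R) :
  (forall d, 0 < d -> \forall v \near t, `|g v - g t - l * (v - t)| <= d * `|v - t|) ->
  is_derive t (1 : R) g l.
Proof.
move=> H; pose L : {linear R -> R} := ( *:%R l : R -> R).
have cL : continuous L by move=> z; apply: cvgM; [exact: cvg_cst|exact: cvg_id].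
have [dg gE] := eps_diff cL H.
have -> : l = 'd g t 1 by rewrite gE /= /GRing.scale/= mulr1.
by split; [exact/derivable1_diffP|rewrite deriveE].
Qed.

Lemma dist_same_sign (X Y M : R) : 0 <= Y * X ->
  `| `|X| - M * `|Y| | = `|X - M * Y|.
Proof.
have [Y0|Y0|->] := ltgtP Y 0.
- rewrite nmulr_rge0// => X0; rewrite (ler0_norm X0) (ltr0_norm Y0).
  by rewrite mulrN -opprD normrN.
- by rewrite pmulr_rge0// => X0; rewrite (ger0_norm X0) (gtr0_norm Y0).
- by rewrite normr0 mulr0 !subr0 normr_id.
Qed.

Lemma noncritical_derive x : A x -> 0 < N x ->
  exists2 s, (s = 1 \/ s = -1) & is_derive (r x) (1 : R) F (s * N x).
Proof.
move=> Ax N0; have [s s1 Hs] := noncritical_radii Ax N0.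
exists s => //; apply: eps_derive => eps eps0.
apply: filterS (Hs _ eps0) => v [y [Ay _ ry sy]] H.
rewrite -(fF Ax) -{1}ry -(fF Ay) (mulrC s) -mulrA -(dist_same_sign _ sy) normrM.
suff -> : `|s| = 1 by rewrite mul1r.
by case: s1 => ->; rewrite ?normrN normr1.
Qed.

Lemma noncritical_open x : A x -> 0 < N x ->
  \forall v \near r x, exists y, [/\ A y, 0 < N y & r y = v].
Proof.
move=> Ax N0; have n1 := cvgr_gt _ (gradnorm_cont Ax) _ N0.
have /nbhs_ballP[d /= d0 Hd] : \forall y \near x, 0 < N y by exact: n1.
have [s _ Hs] := noncritical_radii Ax N0.
apply: filterS (Hs _ d0) => v [y [Ay yd ry _ _]].
by exists y; split; [exact: Ay|exact: Hd|exact: ry].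
Qed.

Lemma critical_sphere x y : A x -> A y -> r x = r y -> N x = 0 -> N y = 0.
Proof.
move=> Ax Ay rxy Nx; apply/eqP; rewrite eq_le gradnorm_ge0 andbT leNgt; apply/negP => Ny.
(* Just below the common radius, [x] bounds the slope of [F] by [N y / 4] from above and [y] bounds
   it by [3 N y / 4] from below. *)
have N4 : 0 < N y / 4 by rewrite divr_gt0.
have NxM : N x < N y / 4 by rewrite Nx.
have [d d0 Hd] := radial_left_lip Ax NxM.
have [s _ Hs] := noncritical_radii Ay Ny.
have ry0 : 0 < r y by case: Ay => _ /andP[].
have n1 := cvg_at_left_filter cvg_id (Hs _ N4).
near (r y)^'- => a.
have ary : a < r y by near: a; exact: nbhs_left_lt.
have a0 : 0 < a by near: a; exact: nbhs_left_gt.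
have ad : r y - d < a by near: a; apply: nbhs_left_gt; rewrite ltrBlDr ltrDl.
have := Hd a a0; rewrite rxy => /(_ ad (ltW ary)) H1.
have [y' [Ay' _ ry' _]] : exists y', [/\ A y', ball y (N y / 4) y', r y' = a,
      0 <= s * (a - r y) * (f y' - f y)
    & `| `|f y' - f y| - N y * `|a - r y| | <= N y / 4 * `|a - r y|] by near: a.
rewrite (fF Ay') (fF Ay) ry' (distrC (F a)) (distrC a) (gtr0_norm (_ : 0 < r y - a)) ?subr_gt0//.
rewrite ler_norml => /andP[H2 _].
have : 0 < N y * (r y - a) by rewrite mulr_gt0// subr_gt0.
by lra.
Unshelve. all: by end_near. Qed.

(** * Absence of critical points *)

Hypothesis harm : forall x, A x -> laplace_beltrami G f x = 0.

Lemma no_touching x0 s1 s : A x0 -> 0 < s1 -> s1 < r x0 -> (s = 1 \/ s = -1) ->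
  (forall y, A y -> s1 < r y < r x0 -> 0 < s * (f y - f x0)) ->
  (forall y, A y -> r y = r x0 -> N y = 0) -> False.
Proof.
move=> Ax0 s10 s1c ss pos crit; pose c := r x0.
have pA y : A y -> posdef (G y) by move=> [Uy _]; exact: pG.
have sA i j : smooth_on A (fun y => G y i j) by exact: smooth_sub.
have oA := shell_open.
pose w y := s * (f y - f x0).
have sfc : smooth_on A (fun y => f y - f x0) by apply: smoothD => //; exact: smooth_cst.
have sw : smooth_on A w by apply: smoothM => //; exact: smooth_cst.
have pw j y : A y -> partial j w y = s * partial j f y.
  move=> Ay; apply: (partial_comp (h := fun t => s * (t - f x0))).
    exact: shell_diff.
  apply: eps_derive => d d0; near=> v.
  rewrite (_ : _ - _ - _ = 0) ?normr0 ?mulr_ge0 ?(ltW d0)//.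
  by ring.
have Lw y : A y -> \sum_i \sum_j symbol G y i j * partial i (partial j w) y +
    \sum_j drift G j y * partial j w y = 0.
  move=> Ay; rewrite -(operator_expand oA pA sA sw Ay).
  transitivity (s * \sum_i \sum_j
      partial i (fun y => symbol G y i j * partial j f y) y); last first.
    by have := harm Ay; rewrite (laplace_beltrami_eq0 pA)// => ->; rewrite mulr0.
  rewrite mulr_sumr; apply: eq_bigr => i _; rewrite mulr_sumr; apply: eq_bigr => j _.
  have /smooth_onS[/(_ y Ay) dy _] : smooth_on A (fun y => symbol G y i j * partial j f y).
    apply: smoothM => //; first exact: symbol_smooth.
    by have /smooth_onS[] := sf.
  have ds : is_derive (symbol G y i j * partial j f y) (1 : R) (fun t : R => s * t) s.
    apply: eps_derive => d d0; near=> v.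
    rewrite (_ : _ - _ - _ = 0) ?normr0 ?mulr_ge0 ?(ltW d0)//.
    by ring.
  apply: etrans (partial_comp i dy ds).
  by apply: eq_partial Ay => // u Au; rewrite pw// mulrCA.
have n1 := cvgr_gt _ (shell_cts Ax0) _ s1c.
have /nbhs_ballP[d /= d0 Hd] : \forall y \near x0, A y /\ s1 < r y.
  by apply: filterS2 (open_nbhs_nbhs (conj oA Ax0)) (n1 _) => y.
(* [sqrt C0] bounds the Euclidean norm by the sup norm. The added 1 in [C1] pays for the distance
   from [z] to [x0]. *)
pose C0 : R := \sum_(i < m) \sum_(j < m) `|(1%:M : 'M[R]_m) i j|.
pose C1 := Num.sqrt C0 + 1; have C10 : 0 < C1 by rewrite ltr_wpDl.
have EC (v : 'rV[R]_m) : Num.sqrt (qf 1%:M v v) <= Num.sqrt C0 * `|v|.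
  rewrite -[X in _ * X]normr_id -sqrtr_sqr -sqrtrM; last first.
    by apply: sumr_ge0 => i _; apply: sumr_ge0.
  apply: ler_wsqrtr; apply: le_trans (ler_norm _) _.
  by rewrite expr2 mulrA; exact: qf_bound.
pose eta := d / C1; have eta0 : 0 < eta by rewrite divr_gt0.
have c0 : 0 < c by rewrite (lt_trans s10).
have ke0 : 0 < k * eta / 4 by rewrite divr_gt0// mulr_gt0.
(* [c / 2] keeps the radius positive; [k * eta / 4] puts [z] so close to [x0] that the round ball
   about [z] through [x0] stays in the shell above [s1]. *)
pose a := c - Num.min (c / 2) (k * eta / 4).
have a0 : 0 < a.
  by rewrite subr_gt0 (le_lt_trans (y := c / 2))// ?ge_min ?lexx// ltr_pdivrMr// ltr_pMr// ltr1n.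
have ac : a < c by rewrite ltrBlDr ltrDl lt_min ke0 divr_gt0.
have [z [Az rz kz]] := near_below Ax0 a0 ac ke0.
have zeta : `|x0 - z| <= eta / 2.
  rewrite -(ler_pM2l k0); apply: le_trans kz _; rewrite -/c /a opprB addrCA subrr addr0.
  apply: le_trans (_ : k * eta / 4 + k * eta / 4 <= _).
    by rewrite lerD2r ge_min lexx orbT.
  by rewrite le_eqVlt; apply/orP; left; apply/eqP; field.
have HB y : qf 1%:M (y - z) (y - z) <= qf 1%:M (x0 - z) (x0 - z) -> A y /\ s1 < r y.
  move=> yz; apply: Hd; rewrite -ball_normE /= -[x0](subrK z) -addrA.
  apply: le_lt_trans (ler_normD _ _) _; rewrite (distrC z).
  have : `|y - z| <= Num.sqrt C0 * `|x0 - z|.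
    apply: le_trans (norm_le_euclidean _) _; apply: le_trans (EC _).
    exact: ler_wsqrtr.
  move=> h; apply: le_lt_trans (_ : C1 * `|x0 - z| < d).
    by rewrite /C1 mulrDl mul1r addrC lerD2r.
  rewrite -ltr_pdivlMl// mulrC; apply: le_lt_trans zeta _.
  by rewrite ltr_pdivrMr// ltr_pMr// ltr1n.
have crB y : qf 1%:M (y - z) (y - z) <= qf 1%:M (x0 - z) (x0 - z) ->
    {for y, continuous r} by move=> /HB[Ay _]; exact: shell_cts.
have rzc : r z < c by rewrite rz.
have [z' [x [xz' rx xQ Hx]]] := touching_ball crB rzc erefl.
have [Ax _] := HB _ xQ.
have fr u v : A u -> A v -> r u = r v -> f u = f v.
  by move=> Au Av uv; rewrite (fF Au) (fF Av) uv.
apply: (hopf (A := A) (w := w) (a := symbol G) (b := drift G) (z := z') (x := x)) => //.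
- by move=> y Ay; exact: symbol_posdef Ay.
- by move=> y Ay i j; apply: smooth_continuous Ay; exact: symbol_smooth.
- by move=> j y Ay; exact: drift_continuous Ay.
- by rewrite /w (fr _ _ Ax Ax0 rx) subrr mulr0.
- by move=> y /Hx[/HB[]].
- move=> y /Hx[/HB[Ay s1y] ryc] yx; apply: pos => //.
  by rewrite s1y ryc.
- by move=> j; rewrite pw// gradnorm_eq0 ?mulr0//; exact: crit.
Unshelve. all: by end_near. Qed.

Hypothesis nonconst : forall delta, 0 < delta ->
  ~ exists c : R, forall x, punctured_ball U P G delta x -> f x = c.

Lemma noncritical x : A x -> 0 < N x.
Proof.
move=> Ax; rewrite lt0r gradnorm_ge0 andbT; apply/negP => /eqP Nx.
have [Ux /andP[rx0 rxe]] := Ax.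
pose nc (v : R) := exists y, [/\ A y, 0 < N y & r y = v].
have ncx : ~ nc (r x).
  move=> [y [Ay Ny ryx]]; have := critical_sphere Ax Ay (esym ryx) Nx.
  by move=> Ny0; rewrite Ny0 ltxx in Ny.
have below (v : R) : 0 < v -> v < r x -> exists2 y, A y & r y = v.
  by move=> v0 vx; have [y [Ay ry _]] := near_below Ax v0 vx ltr01; exists y.
have [[s1 [s10 s1x nc1]]|none] := pselect (exists v : R, [/\ 0 < v, v < r x & nc v]);
    last first.
  (* All radii below [r x] are critical, so [radial_lip] applies with [M = 0]. *)
  have Fc (v w : R) : 0 < v -> v <= w -> w < r x -> F w = F v.
    move=> v0 vw wx; have [y Ay ry] := below w (lt_le_trans v0 vw) wx.
    have wx2 : 0 < (r x - w) / 2 by rewrite divr_gt0// subr_gt0.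
    have vy : v <= r y by rewrite ry.
    have := radial_lip Ay v0 vy wx2 (lexx 0); rewrite mul0r normr_le0 subr_eq0 ry => H.
    apply/eqP/H => u Au /andP[vu uw] _; rewrite leNgt; apply/negP => Nu.
    apply: none; exists (r u); split; [exact: lt_le_trans vu| |by exists u].
    by apply: le_lt_trans uw _; lra.
  apply: (nonconst rx0); exists (F (r x / 2)) => y [Uy /andP[y0 yx]].
  have Ay : A y by split=> //; rewrite y0 (lt_trans yx).
  rewrite fF//; have x20 : 0 < r x / 2 by rewrite divr_gt0.
  have x2x : r x / 2 < r x by rewrite ltr_pdivrMr// ltr_pMr// ltr1n.
  have [h|h] := leP (r y) (r x / 2); first by rewrite (Fc (r y) (r x / 2)).
  by rewrite (Fc (r x / 2) (r y))// ltW.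
(* Its infimum [c] is the first critical radius above the noncritical [s1]; it is itself critical
   because noncritical radii form an open set. *)
pose S := [set v : R | s1 <= v <= r x /\ ~ nc v].
have Sx : S (r x) by split=> //; rewrite lexx ltW.
have infS : has_inf S by split; [exists (r x)|exists s1 => v [/andP[]]].
pose c := inf S.
have s1c : s1 <= c by apply: lb_le_inf; [exists (r x)|move=> v [/andP[]]].
have cx : c <= r x by exact: (ge_inf infS.2).
have ncc (v : R) : s1 <= v -> v < c -> nc v.
  move=> s1v vc; apply: contrapT => nv; have : c <= v.
    by apply: (ge_inf infS.2); split=> //; rewrite s1v (le_trans (ltW vc)).
  by rewrite leNgt vc.
have ncN : ~ nc c.
  move=> [y [Ay Ny ry]]; have := noncritical_open Ay Ny; rewrite ry.
  move=> /nbhs_ballP[d /= d0 Hd]; have [v Sv vd] := inf_adherent d0 infS.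
  apply: Sv.2; apply: Hd; rewrite /ball/= ltr_norml; apply/andP.
  by have := ge_inf infS.2 Sv; rewrite -/c in vd *; split; lra.
have c_s1 : s1 < c.
  by rewrite lt_neqAle s1c andbT; apply/negP => /eqP s1E; apply: ncN; rewrite -s1E.
have [x0 Ax0 rx0c] : exists2 y, A y & r y = c.
  move: cx; rewrite le_eqVlt => /orP[/eqP->|cx]; first by exists x.
  by apply: below => //; rewrite (lt_trans s10).
have Ncrit y : A y -> r y = r x0 -> N y = 0.
  move=> Ay ry; apply/eqP; rewrite eq_le gradnorm_ge0 andbT leNgt.
  by apply/negP => Ny; apply: ncN; exists y; rewrite ry rx0c.
have dF (v : R) : s1 <= v < r x0 -> exists2 l : R, l != 0 & is_derive v (1 : R) F l.
  rewrite rx0c => /andP[s1v vc]; have [y [Ay Ny <-]] := ncc v s1v vc.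
  have [s ss dy] := noncritical_derive Ay Ny; exists (s * N y) => //.
  apply: mulf_neq0; last by rewrite gt_eqF.
  by case: ss => ->; rewrite ?oppr_eq0 oner_eq0.
(* At the critical radius only the left Lipschitz bound on [F] is available, and it suffices. *)
have Fc : F v @[v --> (r x0)^'-] --> F (r x0).
  have N1 : N x0 < 1 by rewrite Ncrit.
  have [d d0 Hd] := radial_left_lip Ax0 N1.
  apply/cvgrPdist_lt => eps eps0; near=> v.
  have vx : v < r x0 by near: v; exact: nbhs_left_lt.
  apply: le_lt_trans (Hd v _ _ (ltW vx)) _.
  - by near: v; apply: nbhs_left_gt; rewrite rx0c (lt_trans s10).
  - by near: v; apply: nbhs_left_gt; rewrite ltrBlDr ltrDl.
  - rewrite mul1r ltrBlDr -ltrBlDl.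
    by near: v; apply: nbhs_left_gt; rewrite ltrBlDr ltrDl.
have s1x0 : s1 < r x0 by rewrite rx0c.
have [s ss Hs] := nonzero_derive_monotone s1x0 dF Fc.
apply: (no_touching Ax0 s10 s1x0 ss) => // y Ay /andP[s1y yx0].
by rewrite !fF// Hs// ltW.
Unshelve. all: by end_near. Qed.

(** The radii form an interval on which [F] has a nonzero derivative, so [F] is strictly monotone
    and the sign cannot change. One global sign is what makes [dr = s df / N] smooth. *)
Lemma radial_derivative : exists2 s : R, (s = 1 \/ s = -1) &
  forall x, A x -> is_derive (r x) (1 : R) F (s * N x).
Proof.
suff H x y sx sy : A x -> A y -> r x <= r y -> (sx = 1 \/ sx = -1) ->
    (sy = 1 \/ sy = -1) -> is_derive (r x) (1 : R) F (sx * N x) ->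
    is_derive (r y) (1 : R) F (sy * N y) -> sx = sy.
  have [[x Ax]|noA] := pselect (exists x, A x); last first.
    by exists 1; [left|move=> x Ax; case: noA; exists x].
  have [sx ssx dx] := noncritical_derive Ax (noncritical Ax).
  exists sx => // y Ay; have [sy ssy dy] := noncritical_derive Ay (noncritical Ay).
  have [xy|yx] := leP (r x) (r y).
    by rewrite (H _ _ _ _ Ax Ay xy ssx ssy dx dy).
  by rewrite -(H _ _ _ _ Ay Ax (ltW yx) ssy ssx dy dx).
move=> Ax Ay xy ssx ssy dx dy; have Nx := noncritical Ax; have Ny := noncritical Ay.
have n1 := cvg_at_right_filter cvg_id (noncritical_open Ay Ny).
(* A radius beyond [r y], so that the right derivative at [r y] is also taken inside the interval of
   monotonicity. *)
near (r y)^'+ => c.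
have yc : r y < c by near: c; exact: nbhs_right_gt.
have [y' [Ay' _ ry']] : exists y', [/\ A y', 0 < N y' & r y' = c] by near: c.
have dF (v : R) : r x <= v <= c -> exists2 l : R, l != 0 & is_derive v (1 : R) F l.
  move=> /andP[xv vc]; have v0 : 0 < v by case: Ax => _ /andP[? _]; exact: lt_le_trans xv.
  have [w Aw <-] : exists2 w, A w & r w = v.
    move: vc; rewrite le_eqVlt -ry' => /orP[/eqP->|vc]; first by exists y'.
    by have [w [Aw rw _]] := near_below Ay' v0 vc ltr01; exists w.
  have [s ss dw] := noncritical_derive Aw (noncritical Aw); exists (s * N w) => //.
  apply: mulf_neq0; last exact: (lt0r_neq0 (noncritical Aw)).
  by case: ss => ->; rewrite ?oppr_eq0 oner_eq0.
have Fc : F v @[v --> c^'-] --> F c.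
  have [|l _ dc] := dF c; first by rewrite lexx (le_trans xy (ltW yc)).
  by apply: cvg_at_left_filter; exact: derivable_cvg (is_derive_derivable dc).
have [|s ss Hs] := nonzero_derive_monotone (le_lt_trans xy yc) _ Fc.
  by move=> v /andP[xv vc]; apply: dF; rewrite xv ltW.
suff K z sz : (sz = 1 \/ sz = -1) -> r x <= r z -> r z < c -> 0 < N z ->
    is_derive (r z) (1 : R) F (sz * N z) -> sz = - s.
  by rewrite (K x sx)// ?(le_lt_trans xy)// (K y sy).
move=> ssz xz zc Nz dz; have dr := is_derive_rderiv dz.
have hF : \forall h \near (0 : R)^'+, 0 < s * (F (r z) - F (r z + h)).
  near=> h; apply: Hs => //; first by rewrite ltrDl; near: h; exact: nbhs_right_gt.
  by rewrite -lerBrDl; near: h; apply: nbhs_right_le; rewrite subr_gt0.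
case: ss ssz hF dr => -> [->|->] //; rewrite ?opprK ?mul1r ?mulN1r// => hF dr; exfalso.
- have n2 := cvgr_gt _ dr _ Nz; near (0 : R)^'+ => h.
  have h0 : 0 < h by near: h; exact: nbhs_right_gt.
  have : 0 < h^-1 * (F (r z + h) - F (r z)) by near: h; exact: n2.
  rewrite pmulr_rgt0 ?invr_gt0// => h1.
  have : 0 < 1 * (F (r z) - F (r z + h)) by near: h.
  by move: h1; lra.
- have Nz' : - N z < 0 by rewrite oppr_lt0.
  have n2 := cvgr_lt _ dr _ Nz'; near (0 : R)^'+ => h.
  have h0 : 0 < h by near: h; exact: nbhs_right_gt.
  have : h^-1 * (F (r z + h) - F (r z)) < 0 by near: h; exact: n2.
  rewrite pmulr_rlt0 ?invr_gt0// => h1.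
  have : 0 < -1 * (F (r z) - F (r z + h)) by near: h.
  by move: h1; lra.
Unshelve. all: by end_near. Qed.

(** * Smoothness of the distance *)

Lemma gradnorm_smooth : smooth_on A N.
Proof.
have pA y : A y -> posdef (G y) by move=> [Uy _]; exact: pG.
have sA i j : smooth_on A (fun y => G y i j) by exact: smooth_sub.
have oA := shell_open; have /smooth_onS[_ sdf] := sf.
apply: smooth_sqrt => //.
  by move=> x Ax; have := noncritical Ax; rewrite /gradnorm /gnorm sqrtr_gt0.
apply: (eq_smooth oA (f := fun x => \sum_i \sum_j
    partial i f x * invmx (G x) i j * partial j f x)).
  move=> x _; rewrite qfE; apply: eq_bigr => i _; apply: eq_bigr => j _.
  by rewrite /grad !mxE.
apply: smooth_sum => // i; apply: smooth_sum => // j; apply: smoothM => //.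
by apply: smoothM => //; apply: smooth_invmx => // x Ax; exact/posdef_unit/pA.
Qed.

(** The increment of [f] is [df(y - x)] up to [o(|y - x|)] and [l (r y - r x)] up to
    [o(|r y - r x|)]. As [l] is not 0, subtracting yields the expansion of [r]. *)
Lemma dist_diff s x : (s = 1 \/ s = -1) -> A x ->
  is_derive (r x) (1 : R) F (s * N x) ->
  differentiable r x /\ forall i, partial i r x = s * partial i f x * (N x)^-1.
Proof.
move=> ss Ax dF; have Nx := noncritical Ax; pose l := s * N x.
have l0 : l != 0.
  apply: mulf_neq0; last by rewrite gt_eqF.
  by case: ss => ->; rewrite ?oppr_eq0 oner_eq0.
have l1 : 0 < `|l| by rewrite normr_gt0.
have df := shell_diff Ax.
pose L : {linear 'rV[R]_m -> R} := l^-1 \*: 'd f x.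
have cL : continuous L.
  move=> v; apply: (@cvgM _ _ (nbhs v)); first exact: cvg_cst.
  exact: diff_continuous.
pose K := \sum_i `|partial i f x|.
have dfK (v : 'rV[R]_m) : `|'d f x v| <= K * `|v|.
  rewrite diff_partial// (le_trans (ler_norm_sum _ _ _))// mulr_suml ler_sum// => i _.
  by rewrite normrM mulrC ler_wpM2l// ler_coord_norm.
have K0 : 0 <= K by apply: sumr_ge0.
have [dF' dFE] := is_derive_diff dF.
have nF d : 0 < d -> \forall y \near x,
    `|f y - f x - l * (r y - r x)| <= d * `|r y - r x|.
  move=> d0; have n1 := shell_cts Ax (diff_eps dF' d0).
  apply: filterS2 (open_nbhs_nbhs (conj shell_open Ax)) n1 => y Ay.
  by rewrite /= (fF Ax) (fF Ay) dFE mulrC.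
(* Using the expansion in [r] with error [|l| / 2], half of [|l| |r y - r x|] is absorbed; the rest
   is at most [(K + 1) |y - x|]. *)
pose C := 2 * (K + 1) / `|l|.
have C0 : 0 <= C by rewrite !mulr_ge0 ?invr_ge0 ?addr_ge0.
have nC : \forall y \near x, `|r y - r x| <= C * `|y - x|.
  have l2 : 0 < `|l| / 2 by rewrite divr_gt0.
  apply: filterS2 (nF _ l2) (diff_eps df ltr01) => y h1 h2.
  have h3 := ler_normB (f y - f x) (f y - f x - l * (r y - r x)).
  have h4 := ler_normD (f y - f x - 'd f x (y - x)) ('d f x (y - x)).
  have h5 := dfK (y - x).
  rewrite subKr normrM in h3; rewrite subrK in h4.
  rewrite /C mulrAC ler_pdivlMr// mulrC; move: h1 h2 h3 h4 h5; lra.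
have LE v : l * L v = 'd f x v by exact: (mulVKf l0 ('d f x v : R)).
have [|dr rE] := eps_diff (f := r) (x := x) cL.
  move=> d d0; pose d' := d * `|l| / (C + 1).
  have d'0 : 0 < d' by rewrite divr_gt0 ?mulr_gt0// ltr_wpDl.
  apply: filterS3 nC (nF _ d'0) (diff_eps df d'0) => y h1 h2 h3.
  rewrite -(ler_pM2l l1) -normrM mulrBr LE.
  have h4 := ler_normB (f y - f x - 'd f x (y - x)) (f y - f x - l * (r y - r x)).
  rewrite (_ : _ - _ - (_ - _) = l * (r y - r x) - 'd f x (y - x)) in h4; last by ring.
  apply: le_trans h4 _; apply: le_trans (lerD h3 h2) _.
  apply: le_trans (_ : d' * (C + 1) * `|y - x| <= _).
    by rewrite -mulrDr -mulrA ler_pM2l// mulrDl mul1r addrC lerD2r.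
  rewrite /d' divfK; last by rewrite gt_eqF// ltr_wpDl.
  by rewrite mulrAC mulrA mulrC mulrA.
split=> // i; rewrite partialE// rE; apply: (mulfI l0); rewrite LE -partialE//.
rewrite /l; case: ss => ->; field; exact: lt0r_neq0.
Qed.

Lemma dist_smooth : smooth_on A r.
Proof.
have [s ss dF] := radial_derivative; have oA := shell_open.
have /smooth_onS[_ sdf] := sf.
apply/smooth_onS; split=> [x Ax|i]; first by have [] := dist_diff ss Ax (dF x Ax).
apply: (eq_smooth oA (f := fun x => s * partial i f x * (N x)^-1)).
  by move=> x Ax; have [_ ->] := dist_diff ss Ax (dF x Ax).
apply: smoothM => //; first by apply: smoothM => //; exact: smooth_cst.
apply: smoothV => //; last exact: gradnorm_smooth.
by move=> x Ax; exact: lt0r_neq0 (noncritical Ax).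
Qed.

Lemma radii_open : open (r @` A).
Proof.
rewrite openE => v [x Ax <-]; apply: filterS (noncritical_open Ax (noncritical Ax)).
by move=> w [y [Ay _ ry]]; exists y.
Qed.

Lemma radii_interval : is_interval (r @` A).
Proof.
move=> a b [x Ax <-] [y Ay <-] c /andP[xc].
rewrite le_eqVlt => /orP[/eqP->|cy]; first by exists y.
have c0 : 0 < c by case: Ax => _ /andP[? _]; exact: lt_le_trans xc.
by have [z [Az rz _]] := near_below Ay c0 cy ltr01; exists z.
Qed.

End RadialFunction.
End Shell.

(** * Transplantation to the conformal metric *)

Section Transplant.
Context {R : realType} {n : nat}.
Let m := n.+2.
Context (U : set 'rV[R]_m) (P : 'rV[R]_m) (G : 'rV[R]_m -> 'M[R]_m).
Hypothesis adm : admissible U P G.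
Hypothesis pG : forall x, U x -> posdef (G x).
Context (e : R) (f : 'rV[R]_m -> R) (F : R -> R).
Local Notation r := (geodesic_distance U G P).
Local Notation A := (punctured_ball U P G e).
Hypotheses (e0 : 0 < e) (sf : smooth_on A f) (fF : forall x, A x -> f x = F (r x)).
Hypothesis harm : forall x, A x -> laplace_beltrami G f x = 0.
Hypothesis nonconst : forall delta, 0 < delta ->
  ~ exists c : R, forall x, punctured_ball U P G delta x -> f x = c.
Hypothesis N0 : forall x, A x -> 0 < gradnorm G f x.
Hypotheses (sr : smooth_on A r) (oD : open (r @` A)) (iD : is_interval (r @` A)).
Hypothesis dF : forall x, A x -> exists l, is_derive (r x) (1 : R) F l.
Context (J : set R) (phi h kap kap' : R -> R).
Hypotheses (oJ : open J) (iJ : is_interval J) (J0 : J 0).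
Hypothesis (Jr : forall x, U x -> J (r x)).
Hypothesis (cphi : forall s, J s -> {for s, continuous phi}).
Hypothesis (phi_gt0 : forall s, J s -> 0 < phi s).
Hypotheses (dh : forall s, J s -> is_derive s (1 : R) h (phi s)) (h0 : h 0 = 0).
(* The dimension is [n + 2], so this is [kap = phi ^ (2 - m)]. *)
Hypothesis kapE : forall s, J s -> kap s = (phi s)^-1 ^+ n.
Hypothesis dkap : forall s, J s -> is_derive s (1 : R) kap (kap' s).
Hypothesis ckap : forall s, J s -> {for s, continuous kap'}.
Hypothesis skap : smooth_on A (fun x => kap (r x)).

Let oA : open A.
Proof. exact: shell_open. Qed.
Let G' := conformal U P G phi.
Let AU x : A x -> U x.
Proof. by case. Qed.

Lemma transplant_exists : exists u : 'rV[R]_m -> R, [/\ smooth_on A u,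
  exists F', forall x, A x -> u x = F' (r x) &
  forall i x, A x -> partial i u x = kap (r x) * partial i f x].
Proof.
have cF s : (r @` A) s -> {for s, continuous F}.
  move=> [x Ax <-]; have [l dl] := dF Ax.
  exact: derivable_cvg (is_derive_derivable dl).
have [K dK] : exists K, forall s, (r @` A) s ->
    is_derive s (1 : R) K (kap' s * F s).
  apply: antiderivative => // s Ds.
  apply: continuous_forM; last exact: cF.
  by apply: ckap; case: Ds => x /AU Ux <-; exact: Jr.
have rdiff x : A x -> differentiable r x by have /smooth_onS[d _] := sr; exact: d.
have fdiff x : A x -> differentiable f x by have /smooth_onS[d _] := sf; exact: d.
have kdiff x : A x -> differentiable (fun x => kap (r x)) x.
  by have /smooth_onS[d _] := skap; exact: d.
have Kdiff x : A x -> differentiable (fun x => - K (r x)) x.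
  move=> Ax; apply: differentiableN; apply: differentiable_comp (rdiff x Ax) _.
  by have [] := is_derive_diff (dK (r x) (ex_intro2 _ _ x Ax erefl)).
(* The two terms in [dr] cancel because [K' = kap' F] and [f = F(r)]. *)
pose u x := kap (r x) * f x + - K (r x).
have du i x : A x -> partial i u x = kap (r x) * partial i f x.
  move=> Ax; have Jx := Jr (AU Ax).
  rewrite /u partialD; [|exact: differentiableM (kdiff x Ax) (fdiff x Ax)|exact: Kdiff].
  rewrite partialM; [|exact: kdiff|exact: fdiff].
  rewrite (partial_comp i (rdiff x Ax) (dkap Jx)).
  have dKN := is_deriveN (dK (r x) (ex_intro2 _ _ x Ax erefl)).
  rewrite (partial_comp (h := - K) i (rdiff x Ax) dKN) fF//.
  by rewrite addrAC mulNr mulrAC subrr add0r.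
exists u; split=> //; last first.
  by exists (fun s => kap s * F s + - K s) => x Ax; rewrite /u fF.
apply/smooth_onS; split=> [x Ax|i].
  by apply: differentiableD; [exact: differentiableM (kdiff x Ax) (fdiff x Ax)|exact: Kdiff].
apply: (eq_smooth oA (f := fun x => kap (r x) * partial i f x)).
  by move=> x Ax; rewrite du.
by apply: smoothM => //; have /smooth_onS[] := sf.
Qed.

Lemma conformal_posdef x : U x -> posdef (G' x).
Proof.
move=> Ux; have [GT Gp] := pG Ux; split; first by rewrite linearZ/= GT.
by move=> v v0; rewrite qfZ mulr_gt0 ?Gp// exprn_gt0// phi_gt0//; exact: Jr.
Qed.

Lemma conformal_symbol x : U x -> symbol G' x = phi (r x) ^+ n *: symbol G x.
Proof.
move=> Ux; have p0 := phi_gt0 (Jr Ux).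
rewrite /symbol /G' /conformal detZ -exprM mulnC exprM sqrtrM ?sqr_ge0//.
rewrite sqrtr_sqr ger0_norm ?exprn_ge0 ?ltW// invmxZ; last first.
  by rewrite unitmxZ ?posdef_unit//; [exact: pG|rewrite unitfE expf_neq0// gt_eqF].
rewrite scalerA scalerA; congr (_ *: _).
have -> : phi (r x) ^+ m = phi (r x) ^+ n * phi (r x) ^+ 2 by rewrite -exprD addn2.
field; exact: lt0r_neq0.
Qed.

Lemma transplant_harmonic u x :
  (forall i x, A x -> partial i u x = kap (r x) * partial i f x) ->
  A x -> laplace_beltrami G' u x = 0.
Proof.
move=> du Ax.
have pA y : A y -> posdef (G y) by move=> /AU; exact: pG.
have pA' y : A y -> posdef (G' y) by move=> /AU; exact: conformal_posdef.
apply/(laplace_beltrami_eq0 pA' u Ax).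
rewrite -[RHS]((laplace_beltrami_eq0 pA f Ax).1 (harm Ax)).
apply: eq_bigr => i _; apply: eq_bigr => j _; apply: eq_partial Ax => // y Ay.
have Uy := AU Ay; rewrite conformal_symbol// du// [in LHS]mxE kapE; last exact: Jr.
have p0 := phi_gt0 (Jr Uy).
have pn0 : phi (r y) ^+ n != 0 by rewrite expf_neq0// lt0r_neq0.
by rewrite mulrACA exprVn (mulfV pn0) mul1r.
Qed.

Lemma primitive_strict s t : J s -> J t -> s < t -> h s < h t.
Proof.
move=> Js Jt st; have Jst c : s <= c <= t -> J c by exact: iJ.
have [||c] := @MVT R h phi s t st.
- by move=> c; rewrite in_itv/= => /andP[/ltW h1 /ltW h2]; apply/dh/Jst; rewrite h1.
- apply: derivable_within_continuous => c; rewrite in_itv/= => /Jst Jc.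
  exact: is_derive_derivable (dh Jc).
rewrite in_itv/= => /andP[/ltW h1 /ltW h2] hE.
by rewrite -subr_gt0 hE mulr_gt0 ?subr_gt0// phi_gt0//; apply: Jst; rewrite h1.
Qed.

Lemma primitive_lt s t : J s -> J t -> (h s < h t) = (s < t).
Proof.
move=> Js Jt; apply/idP/idP; last exact: primitive_strict.
apply: contraTT; rewrite -!leNgt le_eqVlt => /orP[/eqP->//|/primitive_strict].
by move=> /(_ Jt Js)/ltW.
Qed.

Lemma primitive_inj s t : J s -> J t -> h s = h t -> s = t.
Proof.
move=> Js Jt st; have [/(primitive_strict Js Jt)|/(primitive_strict Jt Js)|//] := ltgtP s t;
  by rewrite st ltxx.
Qed.

Lemma transplant_centrally_harmonic : centrally_harmonic U P G'.
Proof.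
have rE x : U x -> geodesic_distance U G' P x = h (r x).
  move=> Ux; exact: (dist_conformal adm oJ iJ J0 Jr cphi phi_gt0 dh h0 Ux).
have [u [su [F' uF] du]] := transplant_exists.
have /nbhs_ballP[d /= d0 Jd] := open_nbhs_nbhs (conj oJ J0).
(* All radii up to [e1] lie in [J], where [h] is strictly increasing, so the new ball of radius
   [h e1] is the old one of radius [e1]. *)
pose e1 := Num.min e d / 2.
have m0 : 0 < Num.min e d by rewrite lt_min e0.
have e10 : 0 < e1 by rewrite divr_gt0.
have e1m : e1 < Num.min e d by rewrite ltr_pdivrMr// ltr_pMr// ltr1n.
have [e1e e1d] : e1 < e /\ e1 < d by apply/andP; rewrite -lt_min.
have Js s : 0 <= s -> s <= e1 -> J s.
  move=> s0 s1; apply: Jd; rewrite /ball/= sub0r normrN ger0_norm//.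
  exact: le_lt_trans e1d.
have sub e2 x : 0 <= e2 -> e2 <= e1 -> U x ->
    (0 < h (r x) < h e2) = (0 < r x < e2).
  move=> e20 e21 Ux; rewrite -{1}h0 (primitive_lt J0 (Jr Ux)).
  rewrite (primitive_lt (Jr Ux) (Js _ e20 e21)).
  by [].
have subA x : punctured_ball U P G' (h e1) x -> A x.
  move=> [Ux]; rewrite rE// sub ?(ltW e10)// => /andP[r0 re].
  by split=> //; rewrite r0 (lt_trans re).
exists u, (h e1); split.
- by rewrite -h0 primitive_lt//; exact: Js (ltW e10) (lexx e1).
- by move=> s x /subA Ax; exact: su.
(* [xget] serves as the inverse of [h] on [J]. *)
- exists (fun t => F' (xget 0 [set s | J s /\ h s = t])) => x Bx.
  have Ax := subA x Bx; have Ux := AU Ax; rewrite rE// uF//; congr F'.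
  case: xgetP => [s _ [Jss hs]|/(_ (r x))[]].
    by apply: primitive_inj => //; exact: Jr.
  by split=> //; exact: Jr.
- by move=> x /subA; exact: transplant_harmonic.
(* If [u] were constant on a new ball, [df] would vanish on a small old ball, against [N0]; an empty
   ball would contradict the non-constancy of [f]. *)
move=> delta delta0 [c uc].
have ch : h t @[t --> (0 : R)^'+] --> h 0.
  by apply: cvg_at_right_filter; exact: derivable_cvg (is_derive_derivable (dh J0)).
have n1 : \forall t \near (0 : R)^'+, h t < delta by apply: (cvgr_lt _ ch); rewrite h0.
have [e2 [e20 e21 e2d]] : exists e2, [/\ 0 < e2, e2 <= e1 & h e2 < delta].
  near (0 : R)^'+ => t; exists t; split; near: t => //; first exact: nbhs_right_gt.
  exact: nbhs_right_le.
have BA x : punctured_ball U P G e2 x -> A x.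
  move=> [Ux /andP[r0 re]]; split=> //; rewrite r0 (lt_trans (lt_le_trans re e21))//.
have [[x Bx]|noB] := pselect (exists x, punctured_ball U P G e2 x); last first.
  by apply: (nonconst e20); exists 0 => x Bx; case: noB; exists x.
have uB y : punctured_ball U P G e2 y -> u y = cst c y.
  move=> [Uy ry]; apply: uc; split=> //; rewrite rE//.
  by move: ry; rewrite -(sub e2 y (ltW e20) e21 Uy) => /andP[-> /lt_trans->].
have := N0 (BA x Bx); rewrite /gradnorm (_ : grad f x = 0).
  by rewrite /gnorm qf0l sqrtr0 ltxx.
apply/rowP => i; rewrite !mxE; have := du i x (BA x Bx).
have -> : partial i u x = 0.
  apply: etrans (eq_partial (shell_open (e := e2) adm) i uB Bx) _.
  exact: derive_cst.
move=> /esym/eqP.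
rewrite mulf_eq0 kapE; last exact: Jr (AU (BA x Bx)).
rewrite expf_eq0 invr_eq0 (gt_eqF (phi_gt0 (Jr (AU (BA x Bx))))) andbF /=.
by move=> /eqP.
Unshelve. all: by end_near. Qed.

End Transplant.

(** * The conformal factor as a function of the distance, and the conclusion *)

Lemma constant_sign (R : realType) (I : set R) (psi : R -> R) : is_interval I ->
  I 0 -> (forall t, I t -> {for t, continuous psi}) -> (forall t, I t -> psi t != 0) ->
  exists2 s : R, (s = 1 \/ s = -1) & forall t, I t -> 0 < s * psi t.
Proof.
move=> iI I0 cpsi psi0.
have H (s : R) : 0 < s * psi 0 -> forall t, I t -> 0 < s * psi t.
  move=> s0 t It; rewrite ltNge; apply/negP => st.
  have [c Ic] : exists2 c, I c & s * psi c = 0.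
    have cs a b : I a -> I b -> {within `[a, b], continuous (fun t => s * psi t)}.
      move=> Ia Ib; apply: continuous_in_subspaceT => u; rewrite inE/= in_itv/= => uab.
      by apply: continuous_forM; [exact: cst_continuous|exact/cpsi/(iI _ _ Ia Ib)].
    have [t0|t0] := leP t 0.
      have [|c] := IVT (v := 0) t0 (cs _ _ It I0).
        by rewrite ge_min le_max st (ltW s0) orbT.
      by rewrite in_itv/= => /(iI _ _ It I0) Ic <-; exists c.
    have [|c] := IVT (v := 0) (ltW t0) (cs _ _ I0 It).
      by rewrite ge_min le_max st (ltW s0) orbT.
    by rewrite in_itv/= => /(iI _ _ I0 It) Ic <-; exists c.
  move=> /eqP; rewrite mulf_eq0 (negPf (psi0 c Ic)) orbF => /eqP sE.
  by rewrite sE mul0r ltxx in s0.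
have := psi0 0 I0; rewrite neq_lt => /orP[p|p].
  by exists (-1); [right|apply: H; rewrite mulN1r oppr_gt0].
by exists 1; [left|apply: H; rewrite mul1r].
Qed.

(** Continuity of the derivative is recorded because [kap' * F] has to be integrated. *)
Lemma power_derive (R : realType) (J : set R) (g g' : R -> R) n :
  (forall s, J s -> is_derive s (1 : R) g (g' s)) ->
  (forall s, J s -> {for s, continuous g'}) ->
  exists k, (forall s, J s -> is_derive s (1 : R) (fun s => g s ^+ n) (k s)) /\
    forall s, J s -> {for s, continuous k}.
Proof.
move=> dg cg'; elim: n => [|n [k [dk ck]]].
  exists (fun=> 0); split=> s _; last exact: cst_continuous.
  exact: is_derive_cst.
have cg s : J s -> {for s, continuous g}.
  by move=> /dg d; exact: derivable_cvg (is_derive_derivable d).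
exists (fun s => g s * k s + g s ^+ n * g' s); split=> s Js.
  have -> : (fun s => g s ^+ n.+1) = g * (fun s => g s ^+ n).
    by apply/funext => t; rewrite exprS.
  exact: (is_deriveM (dg s Js) (dk s Js)).
have cX : {for s, continuous (fun s => g s ^+ n)}.
  exact: derivable_cvg (is_derive_derivable (dk s Js)).
exact: cvgD (continuous_forM (cg s Js) (ck s Js)) (continuous_forM cX (cg' s Js)).
Qed.

Theorem theorem1p3 (R : realType) (m : nat) (U : set 'rV[R]_m)
    (P : 'rV[R]_m) (g : 'rV[R]_m -> 'M[R]_m) (I : set R) (psi : R -> R) :
  (2 <= m)%N ->
  riemannian_germ U P g ->
  open I -> is_interval I -> I 0 ->
  (forall x, U x -> I (geodesic_distance U g P x ^+ 2)) ->
  smooth_fun_on I psi ->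
  (forall t, I t -> psi t != 0) ->
  centrally_harmonic U P g ->
  centrally_harmonic U P (radial_conformal U P psi g).
Proof.
move=> m2; have [n mE] : exists n, m = n.+2 by exists (m - 2)%N; rewrite -addn2 subnK.
subst m; move=> [oU _ UP sg gT gpos] oI iI I0 rI spsi psi0.
move=> [f [eps [eps0 sf0 [F fF0] harm0 nonconst]]].
have adm : admissible U P g.
  by split=> // x Ux i j; exact: smooth_continuous (sg i j) Ux.
have pg x : U x -> posdef (g x) by move=> Ux; split; [exact: gT|exact: gpos].
have [k [rho [k0 rho0 kg]]] := euclidean_comparison adm (pg P UP).
pose e := Num.min eps (k * rho).
have e0 : 0 < e by rewrite lt_min eps0 mulr_gt0.
have ek : e <= k * rho by rewrite ge_min lexx orbT.
have sub x : punctured_ball U P g e x -> punctured_ball U P g eps x.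
  by move=> [Ux /andP[r0 re]]; split=> //; rewrite r0 (lt_le_trans re)// ge_min lexx.
have sf : smooth_on (punctured_ball U P g e) f by move=> s x /sub; exact: sf0.
have fF x : punctured_ball U P g e x -> f x = F (geodesic_distance U g P x).
  by move=> /sub; exact: fF0.
have harm x : punctured_ball U P g e x -> laplace_beltrami g f x = 0.
  by move=> /sub; exact: harm0.
have oA := shell_open (e := e) adm.
have N0 := noncritical adm pg sg k0 rho0 kg ek sf fF harm nonconst.
have sr := dist_smooth adm pg sg k0 rho0 kg ek sf fF harm nonconst.
have oD := radii_open adm pg sg k0 rho0 kg ek sf fF harm nonconst.
have iD := radii_interval adm k0 rho0 kg ek.
have [sgn sgn1 dF] := radial_derivative adm pg sg k0 rho0 kg ek sf fF harm nonconst.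
have dpsi t : I t -> is_derive t (1 : R) psi (derive1 psi t).
  by move=> It; rewrite derive1E; apply: derivableP; exact: (spsi 0%N t It).
have cpsi t : I t -> {for t, continuous psi}.
  by move=> /dpsi d; exact: derivable_cvg (is_derive_derivable d).
have cdpsi t : I t -> {for t, continuous (derive1 psi)}.
  by move=> It; exact: derivable_cvg (spsi 1%N t It).
(* [s * psi] is the absolute value of [psi] on [I] and is visibly smooth. *)
have [s s1 s_gt0] := constant_sign iI I0 cpsi psi0.
(* [psi] takes the squared distance, whereas [phi] takes the distance; the preimage is an interval
   because [I] contains 0. *)
pose J := [set t : R | I (t ^+ 2)].
have csqr : continuous (fun t : R => t ^+ 2) by exact: exprn_continuous.
have oJ : open J by apply: open_comp oI => t _; exact: csqr.
have iJ : is_interval J.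
  move=> a b Ia Ib c /andP[ac cb]; rewrite /J/=.
  have [c0|c0] := leP 0 c.
    by apply: (iI _ _ I0 Ib); rewrite sqr_ge0 ler_sqr ?nnegrE// (le_trans c0).
  apply: (iI _ _ I0 Ia); rewrite sqr_ge0 -sqrrN -(sqrrN a) ler_sqr ?nnegrE ?lerN2//.
    by rewrite oppr_ge0 ltW.
  by rewrite oppr_ge0 (le_trans ac)// ltW.
have J0 : J 0 by rewrite /J/= expr0n.
pose q t := s * psi (t ^+ 2).
have q_gt0 t : J t -> 0 < q t by exact: s_gt0.
have dq t : J t -> is_derive t (1 : R) q (s * (derive1 psi (t ^+ 2) * (2 * t))).
  move=> Jt; have d2 : is_derive t (1 : R) (fun t : R => t ^+ 2) (2 * t).
    have := is_deriveM (is_derive_id t (1 : R)) (is_derive_id t (1 : R)).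
    have -> : (fun t : R => t ^+ 2) = id * id by apply/funext => u; rewrite expr2.
    by move=> H; apply: is_derive_eq H _; rewrite /= /GRing.scale/=; ring.
  have dc := @is_derive1_comp R psi (fun t => t ^+ 2) t _ _ (dpsi (t ^+ 2) Jt) d2.
  have := is_deriveZ s dc.
  exact.
have cq' (t : R) : J t ->
    {for t, continuous (fun t : R => s * (derive1 psi (t ^+ 2) * (2 * t)))}.
  move=> Jt; apply: continuous_forM; first exact: cst_continuous.
  apply: continuous_forM; first exact: continuous_for_comp (csqr t) (cdpsi _ Jt).
  by apply: continuous_forM; [exact: cst_continuous|exact: cvg_id].
pose phi t := (q t)^-1.
have phi_gt0 t : J t -> 0 < phi t by move=> Jt; rewrite invr_gt0 q_gt0.
have cphi t : J t -> {for t, continuous phi}.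
  move=> Jt; apply: cvgV; first exact: lt0r_neq0 (q_gt0 t Jt).
  exact: derivable_cvg (is_derive_derivable (dq t Jt)).
have [H dH] := antiderivative oJ iJ cphi.
pose h t := H t - H 0.
have dh t : J t -> is_derive t (1 : R) h (phi t).
  move=> Jt; have := is_deriveB (dH t Jt) (is_derive_cst (H 0) t (1 : R)).
  by rewrite subr0.
have h0 : h 0 = 0 by rewrite /h subrr.
have -> : radial_conformal U P psi g = conformal U P g phi.
  apply/funext => x; rewrite /radial_conformal /conformal /phi /q exprVn exprMn.
  by rewrite (_ : s ^+ 2 = 1) ?mul1r//; case: s1 => ->; rewrite ?sqrrN expr1n.
(* With [phi = 1 / q] and [m = n + 2], the function [kap = phi^(2 - m)] is the power [q^n]. *)
have [kap' [dkap ckap]] := power_derive n dq cq'.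
apply: (transplant_centrally_harmonic adm pg e0 sf fF harm nonconst N0 sr oD iD _
  oJ iJ J0 rI cphi phi_gt0 dh h0 _ dkap ckap).
- by move=> x Ax; exists (sgn * gradnorm g f x); exact: dF.
- by move=> t _; rewrite invrK.
- apply: smoothX => //; apply: smoothM => //; first exact: smooth_cst.
  by apply: (smooth_comp oA spsi); [move=> x [Ux _]; exact: rI|exact: smoothX].
Qed.
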